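(* Assume $W$ is not $H$-stable and let $\beta_c<\infty$ be a transition point of $\mathcal F_\beta^4$. Assume that $$k^\sharp:=\arg\min_{k\in\mathbb N^d,\,k\ne0}\frac{\hat W(k)}{\Theta(k)}$$ is uniquely defined. Furthermore, assume that $\hat W(k)\ge0$ for all $k\ne k^\sharp$ and that $$\hat W(j)>\max_{\sigma_1,\sigma_2\in\mathrm{Sym}_{k^\sharp}(\Lambda)}\frac{6\,\Theta(j)^5\,(c_j^{\sigma_1,\sigma_2})^2\,|P_2(k^\sharp)\cup P_3(k^\sharp)|}{\rho_\infty\,\Theta(k^\sharp)}\,|\hat W(k^\sharp)|\qquad\forall j\in P_2(k^\sharp),$$ $$\hat W(\ell)>\max_{\sigma_1,\sigma_2,\sigma_3\in\mathrm{Sym}_{k^\sharp}(\Lambda)}\frac{2\,\Theta(\ell)^9\,\Theta(k^\sharp)\,(c_\ell^{\sigma_1,\sigma_2,\sigma_3})^2\,|P_2(k^\sharp)\cup P_3(k^\sharp)|}{3\rho_\infty^2}\,|\hat W(k^\sharp)|\qquad\forall \ell\in P_3(k^\sharp).$$ Then $\beta_c=\beta_\sharp^4$ is a continuous transition point, where $$\beta_\sharp^4:=-\frac{4\,\rho_\infty^{5/2}}{\displaystyle\min_{k\in\mathbb N^d,\,k\ne0}\frac{\hat W(k)}{\Theta(k)}}.$$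
   Context: $\Omega=\mathbb T^d$ is the torus of side length $L>0$, $\rho_\infty:=L^{-d}=|\Omega|^{-1}$; $\mathcal P(\Omega)$ is the set of Borel probability measures on $\Omega$, identified with their densities when these exist. $W\in C^2(\Omega)$ is even along every coordinate and has mean zero. For $m>1$, $$\mathcal F_\beta^m(\rho)=\frac{\beta^{-1}}{m-1}\int_\Omega\rho^m\,dx-\frac{\beta^{-1}}{m-1}+\frac12\iint_{\Omega\times\Omega}W(x-y)\rho(x)\rho(y)\,dx\,dy$$ whenever these quantities are finite, and $+\infty$ otherwise (here $m=4$); ''minimiser'' means minimiser over $\mathcal P(\Omega)$. Fourier conventions ($\mathbb N\ni0$): for $k\in\mathbb Z^d$, $e_k(x)=N_k\prod_{i=1}^d e_{k_i}(x_i)$ with $e_{k_i}(x_i)=\cos(2\pi k_ix_i/L)$ if $k_i>0$, $1$ if $k_i=0$, $\sin(2\pi k_ix_i/L)$ if $k_i<0$; $N_k=L^{-d/2}\Theta(k)$, $\Theta(k)=\prod_{i=1}^d(2-\delta_{k_i,0})^{1/2}$; $\hat W(k)=\langle W,e_k\rangle_{L^2(\Omega)}$. $W$ is $H$-stable if $\hat W(k)\ge0$ for all $k\in\mathbb Z^d\setminus\{0\}$. Symmetries: $\Lambda=\{1,-1\}^d$; $\mathrm{Sym}(\Lambda)$ is the group of sign changes $\sigma=(\sigma_1,\dots,\sigma_d)\in\{1,-1\}^d$ acting on $\mathbb Z^d$ by $(\sigma(k))_i=\sigma_ik_i$; for $k\in\mathbb Z^d$, $\mathrm{Sym}_k(\Lambda)=\mathrm{Sym}(\Lambda)/H_k$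 with $H_k=\{\sigma:\sigma(k)=k\}$. For $k\in\mathbb N^d$, $k\ne0$: $P_2(k)=\{j\in\mathbb N^d: j\ne0,\ j_i\in\{2k_i,0\}\}$ and $P_3(k)=\{\ell\in\mathbb N^d:\ell\ne k,\ \ell_i\in\{3k_i,k_i\}\}$. For $\sigma_1,\sigma_2,\sigma_3\in\mathrm{Sym}_k(\Lambda)$ the constants $c_j^{\sigma_1,\sigma_2}$ ($j\in P_2(k)$) and $c_\ell^{\sigma_1,\sigma_2,\sigma_3}$ ($\ell\in P_3(k)$) are the coefficients in the expansions $$e_{\sigma_1(k)}e_{\sigma_2(k)}=\sum_{j\in P_2(k)}c_j^{\sigma_1,\sigma_2}e_{\sigma_1\sigma_2(j)}+\text{const}\cdot e_0,$$ $$e_{\sigma_1(k)}e_{\sigma_2(k)}e_{\sigma_3(k)}=\sum_{\ell\in P_3(k)}c_\ell^{\sigma_1,\sigma_2,\sigma_3}e_{\sigma_1\sigma_2\sigma_3(\ell)}+\text{const}\cdot e_{\sigma_1\sigma_2\sigma_3(k)},$$ that is, $c_j^{\sigma_1,\sigma_2}=\langle e_{\sigma_1(k)}e_{\sigma_2(k)},e_{\sigma_1\sigma_2(j)}\rangle_{L^2(\Omega)}$ and $c_\ell^{\sigma_1,\sigma_2,\sigma_3}=\langle e_{\sigma_1(k)}e_{\sigma_2(k)}e_{\sigma_3(k)},e_{\sigma_1\sigma_2\sigma_3(\ell)}\rangle_{L^2(\Omega)}$. They are used with $k=k^\sharp$. Transition point: $\beta_c>0$ is a transition point of $\mathcal F_\beta^m$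 if (1) for $\beta<\beta_c$, $\rho_\infty$ is the unique minimiser of $\mathcal F_\beta^m$; (2) at $\beta=\beta_c$, $\rho_\infty$ is a minimiser; (3) for every $\beta>\beta_c$ there exists a minimiser $\rho_\beta\neq\rho_\infty$ of $\mathcal F_\beta^m$. It is continuous if $\rho_\infty$ is the unique minimiser of $\mathcal F_{\beta_c}^m$ and, for any family $\{\rho_\beta\}_{\beta>\beta_c}$ of minimisers, $\limsup_{\beta\to\beta_c^+}\|\rho_\beta-\rho_\infty\|_{L^\infty(\Omega)}=0$. *)

(* Defs.v *)
From HB Require Import structures.
From mathcomp Require Import all_boot all_order all_algebra finmap.
From mathcomp Require Import all_classical all_reals all_analysis.

Set Implicit Arguments.
Unset Strict Implicit.
Unset Printing Implicit Defensive.

Import Order.TTheory GRing.Theory Num.Theory.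
Import numFieldNormedType.Exports.

Local Open Scope classical_set_scope.
Local Open Scope ring_scope.

(* The torus of side L is represented by its fundamental domain [0, L[^d:
   functions on it are L-periodic functions on 'rV[R]_d, and Borel probability
   measures on it are probability measures on d.-tuples (whose library
   sigma-algebra is the product one, hence the Borel one) giving mass 1 to
   [0, L[^d.  Tuples carry the measurable structure; row vectors carry the norm
   and vector space structure. *)
Notation points R d := (d.-tuple (measurableTypeR R)).

Definition vec (R : realType) (d : nat) (x : points R d) : 'rV[R]_d :=
  \row_i (tnth x i : R).

Section torus_measure.
Variables (R : realType) (L : R).
Let R' : measurableType _ := measurableTypeR R.

Definition circle_dom : set R' := `[0, L[%classic.

Lemma measurable_circle_dom : measurable circle_dom.
Proof. exact: measurable_itv. Qed.

Lemma circle_dom_lty : (lebesgue_measure circle_dom < +oo)%E.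
Proof. by rewrite lebesgue_measure_itv/=; case: ifPn => // _; rewrite ltry. Qed.

Definition circle_measure : {finite_measure set R' -> \bar R} :=
  mfrestr measurable_circle_dom circle_dom_lty.

Section step.
Variables (n : nat) (m : {finite_measure set (points R n) -> \bar R}).

Definition cons_pair (p : R' * points R n) : points R n.+1 :=
  [the n.+1.-tuple R' of p.1 :: p.2].

Lemma measurable_cons_pair : measurable_fun setT cons_pair.
Proof. exact: measurable_cons. Qed.

Definition cons_measure : set (points R n.+1) -> \bar R :=
  pushforward (circle_measure \x m)%E cons_pair.

Let mcons A : measurable A -> measurable (cons_pair @^-1` A).
Proof.
by move=> mA; rewrite -[X in measurable X]setTI; exact: measurable_cons_pair.
Qed.

Let cons_measure0 : cons_measure set0 = 0%E.
Proof. by rewrite /cons_measure /pushforward preimage_set0 measure0. Qed.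

Let cons_measure_ge0 A : (0 <= cons_measure A)%E.
Proof. by rewrite /cons_measure /pushforward; exact: measure_ge0. Qed.

Let cons_measure_sigma_additive : semi_sigma_additive cons_measure.
Proof.
move=> F mF tF mUF; rewrite /cons_measure /pushforward preimage_bigcup.
apply: measure_semi_sigma_additive.
- by move=> i; exact: mcons.
- apply/trivIsetP => /= i j _ _ ij; rewrite -preimage_setI.
  by move/trivIsetP : tF => /(_ _ _ _ _ ij) ->//; rewrite preimage_set0.
- by rewrite -preimage_bigcup; exact: mcons.
Qed.

HB.instance Definition _ := isMeasure.Build _ _ _ cons_measure
  cons_measure0 cons_measure_ge0 cons_measure_sigma_additive.

Lemma cons_measure_setT :
  cons_measure setT = (circle_measure setT * m setT)%E.
Proof.
by rewrite /cons_measure /pushforward preimage_setT -setXTT product_measure1E.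
Qed.

Let cons_measure_fin : fin_num_fun cons_measure.
Proof.
apply: lty_fin_num_fun.
apply: (@eq_ind_r _ _ (fun x => (x < +oo)%E) _ _ cons_measure_setT).
by rewrite ltey_eq fin_numM//; exact: fin_num_measure.
Qed.

HB.instance Definition _ := Measure_isFinite.Build _ _ _ cons_measure
  cons_measure_fin.

End step.

Fixpoint torus_measure (d : nat) : {finite_measure set (points R d) -> \bar R} :=
  match d with
  | 0%N => \d_ [tuple]
  | n.+1 => cons_measure (torus_measure n)
  end.

Lemma torus_measure_setT (d : nat) :
  0 <= L -> torus_measure d setT = (L ^+ d)%:E.
Proof.
move=> L0; elim: d => [|d IH]; first by rewrite /= diracT.
rewrite /= cons_measure_setT IH /= /mfrestr /mrestr setTI.
rewrite lebesgue_measure_itv /= lte_fin exprS EFinM.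
case: ifPn => [_|]; first by rewrite sube0.
by rewrite -leNgt => Ln; rewrite (le_anti (_ : L <= 0 <= L)) ?L0 ?Ln.
Qed.

End torus_measure.

Definition torus_dom (R : realType) (d : nat) (L : R) : set (points R d) :=
  [set x | forall i, 0 <= (tnth x i : R) < L].

Definition basis_vec (R : realType) (d : nat) (i : 'I_d) : 'rV[R]_d :=
  delta_mx 0 i.

Definition torus_periodic (R : realType) (d : nat) (L : R) (f : 'rV[R]_d -> R) :=
  forall (i : 'I_d) x, f (x + L *: basis_vec R i) = f x.

Definition C2 (R : realType) (d : nat) (f : 'rV[R]_d -> R) :=
  continuous f /\ forall i : 'I_d,
  [/\ forall x, derivable f x (basis_vec R i),
      continuous ('D_(basis_vec R i) f) &
      forall j : 'I_d,
        (forall x, derivable ('D_(basis_vec R i) f) x (basis_vec R j)) /\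
        continuous ('D_(basis_vec R j) ('D_(basis_vec R i) f))].

Definition coord_even (R : realType) (d : nat) (f : 'rV[R]_d -> R) :=
  forall (i : 'I_d) (x : 'rV[R]_d),
    f (\row_j (if j == i then - x 0 j else x 0 j)) = f x.

Definition inner (R : realType) (d : nat) (L : R) (f g : 'rV[R]_d -> R) : R :=
  \int[torus_measure L d]_x (f (vec x) * g (vec x)).

Definition mean_zero (R : realType) (d : nat) (L : R) (f : 'rV[R]_d -> R) :=
  \int[torus_measure L d]_x f (vec x) = 0.

(* N^d is the set of nonnegative vectors of Z^d = 'rV[int]_d. *)

Definition Nd (d : nat) : set 'rV[int]_d := [set k | forall i, 0 <= k 0 i].

Definition Theta (R : realType) (d : nat) (k : 'rV[int]_d) : R :=
  \prod_i Num.sqrt (2 - (k 0 i == 0)%:R).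

Definition e1 (R : realType) (L : R) (n : int) (t : R) : R :=
  if 0 < n then cos (2 * pi * n%:~R * t / L)
  else if n == 0 then 1 else sin (2 * pi * n%:~R * t / L).

Definition fourier (R : realType) (d : nat) (L : R) (k : 'rV[int]_d)
    (x : 'rV[R]_d) : R :=
  L `^ (- (d%:R / 2)) * Theta R k * \prod_i e1 L (k 0 i) (x 0 i).

Definition hat (R : realType) (d : nat) (L : R) (W : 'rV[R]_d -> R)
    (k : 'rV[int]_d) : R :=
  inner L W (fourier L k).

Definition H_stable (R : realType) (d : nat) (L : R) (W : 'rV[R]_d -> R) :=
  forall k : 'rV[int]_d, k != 0 -> 0 <= hat L W k.

(* A sign change is encoded by s : {ffun 'I_d -> bool}, standing for the vector
   of signs (-1)^(s i); composition is then pointwise exclusive or. *)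
Definition signs (d : nat) := {ffun 'I_d -> bool}.

Definition sact (d : nat) (s : signs d) (k : 'rV[int]_d) : 'rV[int]_d :=
  \row_i ((-1) ^+ s i * k 0 i).

Definition smul (d : nat) (s t : signs d) : signs d := [ffun i => s i (+) t i].

(* The stabiliser H_k of k consists of the sign changes acting only on the
   coordinates where k vanishes.  The quotient of the group of sign changes by
   H_k is represented by the complement of H_k, which contains exactly one
   element of each class: the sign changes acting only where k does not vanish. *)
Definition Symk (d : nat) (k : 'rV[int]_d) : {set signs d} :=
  [set s : signs d | [forall i, (k 0 i == 0) ==> ~~ s i]]%SET.

Definition P2 (d : nat) (k : 'rV[int]_d) : set 'rV[int]_d :=
  [set j | [/\ Nd j, j != 0 &
               forall i, j 0 i = 2 * k 0 i \/ j 0 i = 0]].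

Definition P3 (d : nat) (k : 'rV[int]_d) : set 'rV[int]_d :=
  [set l | [/\ Nd l, l != k &
               forall i, l 0 i = 3 * k 0 i \/ l 0 i = k 0 i]].

Definition cardP (d : nat) (k : 'rV[int]_d) : nat :=
  #|` fset_set (P2 k `|` P3 k)|%fset.

Definition coef2 (R : realType) (d : nat) (L : R) (k : 'rV[int]_d)
    (s1 s2 : signs d) (j : 'rV[int]_d) : R :=
  inner L (fourier L (sact s1 k) \* fourier L (sact s2 k))
          (fourier L (sact (smul s1 s2) j)).

Definition coef3 (R : realType) (d : nat) (L : R) (k : 'rV[int]_d)
    (s1 s2 s3 : signs d) (l : 'rV[int]_d) : R :=
  inner L (fourier L (sact s1 k) \* fourier L (sact s2 k)
             \* fourier L (sact s3 k))
          (fourier L (sact (smul (smul s1 s2) s3) l)).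

Definition rho_inf (R : realType) (d : nat) (L : R) : R := (L ^+ d)^-1.

(* The maxima below are over nonempty sets of nonnegative numbers, so that the
   starting value 0 is immaterial. *)
Definition bound2 (R : realType) (d : nat) (L : R) (k j : 'rV[int]_d) : R :=
  \big[Num.max/0]_(s1 in Symk k) \big[Num.max/0]_(s2 in Symk k)
    (6 * Theta R j ^+ 5 * coef2 L k s1 s2 j ^+ 2 * (cardP k)%:R
     / (rho_inf d L * Theta R k)).

Definition bound3 (R : realType) (d : nat) (L : R) (k l : 'rV[int]_d) : R :=
  \big[Num.max/0]_(s1 in Symk k) \big[Num.max/0]_(s2 in Symk k)
  \big[Num.max/0]_(s3 in Symk k)
    (2 * Theta R l ^+ 9 * Theta R k * coef3 L k s1 s2 s3 l ^+ 2 * (cardP k)%:R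
     / (3 * rho_inf d L ^+ 2)).

Definition ratio (R : realType) (d : nat) (L : R) (W : 'rV[R]_d -> R)
    (k : 'rV[int]_d) : R :=
  hat L W k / Theta R k.

Definition argmin_ratio (R : realType) (d : nat) (L : R) (W : 'rV[R]_d -> R)
    : set 'rV[int]_d :=
  [set k | [/\ Nd k, k != 0 &
     forall k', Nd k' -> k' != 0 -> ratio L W k <= ratio L W k']].

(* inf is the minimum as soon as argmin_ratio is nonempty *)
Definition min_ratio (R : realType) (d : nat) (L : R) (W : 'rV[R]_d -> R) : R :=
  inf [set ratio L W k | k in [set k | Nd k /\ k != 0]].

Definition beta_sharp4 (R : realType) (d : nat) (L : R) (W : 'rV[R]_d -> R) : R :=
  - (4 * rho_inf d L `^ (5 / 2) / min_ratio L W).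

Section energy.
Variables (R : realType) (d : nat) (L : R).
Local Open Scope charge_scope.
Local Notation mu := (torus_measure L d).

Definition density (rho : probability (points R d) R) (x : points R d) : R :=
  fine (('d (charge_of_finite_measure rho) '/d mu) x).

Definition linfty_dist (rho : probability (points R d) R) : \bar R :=
  'N[mu]_+oo[(fun x => (density rho x - rho_inf d L)%:E)]%E.

Definition free_energy (m : R) (W : 'rV[R]_d -> R) (beta : R)
    (rho : probability (points R d) R) : \bar R :=
  let f := density rho in
  if `[< [/\ rho `<< mu,
             mu.-integrable setT (fun x => (f x `^ m)%:E) &
             (mu \x mu)%E.-integrable setT
               (fun z => (W (vec z.1 - vec z.2) * f z.1 * f z.2)%:E)] >]
  then (beta^-1 / (m - 1) * \int[mu]_x (f x `^ m) - beta^-1 / (m - 1)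
        + 2^-1 * \int[(mu \x mu)%E]_z
                   (W (vec z.1 - vec z.2) * f z.1 * f z.2))%:E
  else +oo%E.

Definition origin : points R d := nseq_tuple d (0 : R).

(* The probability measure with constant density rho_inf: mu is normalised by
   its total mass (torus_measure_setT); the Dirac mass is only the default value
   of mnormalize when mu is degenerate, which is excluded by 0 < L. *)
Definition uniform_measure : probability (points R d) R :=
  mnormalize mu \d_origin.

Definition is_minimiser (m : R) (W : 'rV[R]_d -> R) (beta : R)
    (rho : probability (points R d) R) :=
  rho (torus_dom L) = 1%E /\
  forall nu : probability (points R d) R, nu (torus_dom L) = 1%E ->
    (free_energy m W beta rho <= free_energy m W beta nu)%E.

(* Measures are functions on all sets, of which only the values on measurable
   sets are meaningful. *)
Definition same_measure (rho nu : probability (points R d) R) :=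
  forall A, measurable A -> rho A = nu A.

Definition uniform_unique_minimiser (m : R) (W : 'rV[R]_d -> R) (beta : R) :=
  is_minimiser m W beta uniform_measure /\
  forall rho, is_minimiser m W beta rho -> same_measure rho uniform_measure.

Definition transition_point (m : R) (W : 'rV[R]_d -> R) (beta_c : R) :=
  [/\ 0 < beta_c,
      forall beta, 0 < beta -> beta < beta_c ->
        uniform_unique_minimiser m W beta,
      is_minimiser m W beta_c uniform_measure &
      forall beta, beta_c < beta ->
        exists2 rho, is_minimiser m W beta rho &
          ~ same_measure rho uniform_measure].

Definition continuous_transition_point (m : R) (W : 'rV[R]_d -> R)
    (beta_c : R) :=
  [/\ transition_point m W beta_c,
      uniform_unique_minimiser m W beta_c &
      forall rho : R -> probability (points R d) R,
        (forall beta, beta_c < beta -> is_minimiser m W beta (rho beta)) ->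
        limf_esup (fun beta => linfty_dist (rho beta)) (at_right beta_c) = 0%E].

End energy.

(* Main.v *)
Require Import Defs.
From HB Require Import structures.
From mathcomp Require Import all_boot all_order all_algebra finmap.
From mathcomp Require Import all_classical all_reals all_analysis.
From mathcomp Require Import measurable_realfun ess_sup_inf zify ring lra.

Set Implicit Arguments.
Unset Strict Implicit.
Unset Printing Implicit Defensive.

Import Order.TTheory GRing.Theory Num.Theory.
Import numFieldNormedType.Exports.

Local Open Scope classical_set_scope.
Local Open Scope ring_scope.

(** Write r for the uniform density, w k for the integral of W against the
    product of the cosines of frequencies k, and let a be the inverse of
    beta_sharp4, so that w at ksharp is - 4 r^2 a. The uniform density turns
    out to be a global minimiser exactly for beta^-1 >= a.

    Above beta_sharp4 it is not a minimiser: perturbing it by a small multiple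
    of the cosine product of frequency ksharp lowers the energy [instability].

    At beta_sharp4, and hence below, it is the unique minimiser, with a
    quantitative gap [key_inequality]: for every density f,
      a/72 int (f - r)^4 <= a/3 (int f^4 - r^3) + 1/2 interaction W f.
    To see this, let p be the part of f carried by the frequency ksharp, and
    let q2, q3 be the parts carried by P2 and by P3. The tangent inequality
    u^4 >= v^4 + 4 v^3 (u - v) + (u - v)^4 / 3 with u = f and v = r + p bounds
    int f^4 from below [quartic_lower]. Products of two waves of frequency
    ksharp only have frequencies 0 and P2, products of three only ksharp and P3;
    hence int p^3 vanishes and the only cross terms are int p^2 q2 and
    int p^3 q3. The interaction, on the other hand, is at least
      - 4 r^2 a int f p + 96 a r^2 int q2^2 + 32/3 a G^2 int q3^2
    where G bounds the absolute value of p [interaction_lower]: indeed W plus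
    suitable multiples of the reproducing kernels of ksharp, P2 and P3 has
    nonnegative cosine coefficients, and a continuous, even, periodic function
    with this property is positive definite [positive_definite], being a limit
    of its Fejer means. By the Cauchy-Schwarz inequality the two squares, with
    help from int p^4, absorb the two cross terms; this is what the lower bounds
    on the coefficients at P2 and P3 are for.

    Consequently a transition point can only be beta_sharp4
    [transition_point_eq]. It is continuous: for beta slightly larger, the gap
    still forces int (f - r)^4 to be small for a minimiser f, so that the
    potential W * f is uniformly small. Moving mass from where f is large to
    where f is small must not lower the energy, which bounds the oscillation of
    f^3 by that of the potential [oscillation]; hence f is uniformly close to r
    [near_uniform].

    The thresholds on the Fourier coefficients are used through the terms of
    the maxima with trivial sign changes [bound2_ge], [bound3_ge]; a further
    factor 2 comes from P2 and P3 both being nonempty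
    [cardP_ge2]. The coefficient at ksharp is negative because otherwise all
    cosine coefficients would be nonnegative, W would be positive definite, and
    there would be no transition at all [positive_no_transition]. *)

(** * Bounded measurable functions and real-valued integrals *)

Definition bmeas d (T : measurableType d) (R : realType) (h : T -> R) :=
  measurable_fun setT h /\ exists M : R, forall x, `|h x| <= M.

Section bmeas_theory.
Context d (T : measurableType d) (R : realType).
Implicit Types f g : T -> R.

Lemma bmeas_cst c : bmeas (fun _ : T => c : R).
Proof. by split; [exact: measurable_cst | exists `|c|]. Qed.

Lemma bmeasD f g : bmeas f -> bmeas g -> bmeas (fun x => f x + g x).
Proof.
move=> [mf [M fM]] [mg [N gN]]; split; first exact: measurable_funD.
by exists (M + N) => x; rewrite (le_trans (ler_normD _ _))// lerD.
Qed.

Lemma bmeasM f g : bmeas f -> bmeas g -> bmeas (fun x => f x * g x).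
Proof.
move=> [mf [M fM]] [mg [N gN]]; split; first exact: measurable_funM.
by exists (M * N) => x; rewrite normrM ler_pM.
Qed.

Lemma bmeasN f : bmeas f -> bmeas (fun x => - f x).
Proof.
move=> [mf [M fM]]; split; first exact: measurableT_comp.
by exists M => x; rewrite normrN.
Qed.

Lemma bmeasB f g : bmeas f -> bmeas g -> bmeas (fun x => f x - g x).
Proof. by move=> bf bg; apply: bmeasD => //; exact: bmeasN. Qed.

Lemma bmeasX n f : bmeas f -> bmeas (fun x => f x ^+ n).
Proof.
move=> bf; elim: n => [|n IH]; first exact: (bmeas_cst 1).
by under eq_fun do rewrite exprS; exact: bmeasM.
Qed.

Lemma bmeas_sum I (r : seq I) (P : pred I) (F : I -> T -> R) :
  (forall i, bmeas (F i)) -> bmeas (fun x => \sum_(i <- r | P i) F i x).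
Proof.
move=> bF; elim: r => [|i r IH].
  have -> : (fun x => \sum_(i <- [::] | P i) F i x) = (fun=> 0).
    by apply/funext => x; rewrite big_nil.
  exact: bmeas_cst.
have -> : (fun x => \sum_(j <- i :: r | P j) F j x) = (fun x =>
    if P i then F i x + \sum_(j <- r | P j) F j x
    else \sum_(j <- r | P j) F j x).
  by apply/funext => x; rewrite big_cons.
by case: (P i) => //; exact: bmeasD.
Qed.

Lemma bmeas_prod I (r : seq I) (P : pred I) (F : I -> T -> R) :
  (forall i, bmeas (F i)) -> bmeas (fun x => \prod_(i <- r | P i) F i x).
Proof.
move=> bF; elim: r => [|i r IH].
  have -> : (fun x => \prod_(i <- [::] | P i) F i x) = (fun=> 1).
    by apply/funext => x; rewrite big_nil.
  exact: bmeas_cst.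
have -> : (fun x => \prod_(j <- i :: r | P j) F j x) = (fun x =>
    if P i then F i x * \prod_(j <- r | P j) F j x
    else \prod_(j <- r | P j) F j x).
  by apply/funext => x; rewrite big_cons.
by case: (P i) => //; exact: bmeasM.
Qed.

End bmeas_theory.

Lemma bmeas_comp d d' (T : measurableType d) (T' : measurableType d')
    (R : realType) (h : T' -> R) (phi : T -> T') :
  measurable_fun setT phi -> bmeas h -> bmeas (fun x => h (phi x)).
Proof.
move=> mphi [mh [M hM]]; split; last by exists M => x; exact: hM.
exact: measurableT_comp.
Qed.

Section finite_integral.
Context d (T : measurableType d) (R : realType).
Variable mu : {finite_measure set T -> \bar R}.
Implicit Types f g h : T -> R.

Definition intg f := mu.-integrable setT (EFin \o f).

Lemma intg_meas f : intg f -> measurable_fun setT f.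
Proof. by move=> /measurable_int/measurable_EFinP. Qed.

Lemma bmeas_intg h : bmeas h -> intg h.
Proof.
move=> [mh [M hM]]; apply: measurable_bounded_integrable => //.
  by rewrite ltey_eq fin_num_measure.
by exists M; split; [rewrite num_real | move=> x Mx y _; exact: le_trans (ltW Mx)].
Qed.

Lemma intgD f g : intg f -> intg g -> intg (fun x => f x + g x).
Proof.
move=> If Ig; rewrite /intg; have -> : EFin \o (fun x => f x + g x) =
  (EFin \o f) \+ (EFin \o g) by apply/funext => x /=; rewrite EFinD.
exact: integrableD.
Qed.

Lemma intgZ c f : intg f -> intg (fun x => c * f x).
Proof.
move=> If; rewrite /intg; have -> : EFin \o (fun x => c * f x) =
  (fun x => c%:E * (EFin \o f) x)%E by apply/funext => x /=; rewrite EFinM.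
exact: integrableZl.
Qed.

Lemma intgN f : intg f -> intg (fun x => - f x).
Proof. by move=> /(intgZ (-1)); under eq_fun do rewrite mulN1r. Qed.

Lemma intgB f g : intg f -> intg g -> intg (fun x => f x - g x).
Proof. by move=> If Ig; apply: intgD => //; exact: intgN. Qed.

Lemma intg_le f g : measurable_fun setT f -> (forall x, `|f x| <= g x) ->
  intg g -> intg f.
Proof.
move=> mf fg; apply: le_integrable => //; first exact/measurable_EFinP.
move=> x _ /=; rewrite lee_fin (le_trans (fg x))//; exact: ler_norm.
Qed.

Lemma intgM h f : bmeas h -> intg f -> intg (fun x => h x * f x).
Proof.
move=> [mh [M hM]] If; apply: (@intg_le _ (fun x => M * `|f x|)).
- by apply: measurable_funM => //; exact: intg_meas.
- by move=> x; rewrite normrM ler_wpM2r.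
- apply: intgZ; move/integrable_norm : If; exact.
Qed.

Lemma intg_norm f : intg f -> intg (fun x => `|f x|).
Proof. by move/integrable_norm; exact. Qed.

Lemma intD f g : intg f -> intg g ->
  \int[mu]_x (f x + g x) = \int[mu]_x f x + \int[mu]_x g x.
Proof. by move=> If Ig; exact: RintegralD. Qed.

Lemma intB f g : intg f -> intg g ->
  \int[mu]_x (f x - g x) = \int[mu]_x f x - \int[mu]_x g x.
Proof. by move=> If Ig; exact: RintegralB. Qed.

Lemma intZ c f : intg f -> \int[mu]_x (c * f x) = c * \int[mu]_x f x.
Proof. by move=> If; exact: RintegralZl. Qed.

Lemma int_le f g : intg f -> intg g -> (forall x, f x <= g x) ->
  \int[mu]_x f x <= \int[mu]_x g x.
Proof. by move=> If Ig fg; apply: le_Rintegral. Qed.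

Lemma int_ge0 f : (forall x, 0 <= f x) -> 0 <= \int[mu]_x f x.
Proof. by move=> f0; apply: Rintegral_ge0. Qed.

Lemma int_norm f : intg f -> `|\int[mu]_x f x| <= \int[mu]_x `|f x|.
Proof. by move=> If; exact: le_normr_Rintegral. Qed.

Lemma int_eq f g : f =1 g -> \int[mu]_x f x = \int[mu]_x g x.
Proof. by move=> fg; apply: eq_Rintegral => x _; exact: fg. Qed.

Lemma int_sum I (r : seq I) (P : pred I) (F : I -> T -> R) :
  (forall i, intg (F i)) ->
  intg (fun x => \sum_(i <- r | P i) F i x) /\
  \int[mu]_x (\sum_(i <- r | P i) F i x) = \sum_(i <- r | P i) \int[mu]_x F i x.
Proof.
move=> IF; elim: r => [|i r [IH1 IH2]].
  have -> : (fun x => \sum_(i <- [::] | P i) F i x) = (fun=> 0).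
    by apply/funext => x; rewrite big_nil.
  split; first exact/bmeas_intg/bmeas_cst.
  by rewrite big_nil Rintegral_cst ?mul0r.
have -> : (fun x => \sum_(j <- i :: r | P j) F j x) = (fun x =>
    if P i then F i x + \sum_(j <- r | P j) F j x
    else \sum_(j <- r | P j) F j x).
  by apply/funext => x; rewrite big_cons.
by rewrite big_cons; case: (P i) => //; rewrite -IH2; split; [exact: intgD | exact: intD].
Qed.

(** The integral of (s f + t g)^2 is a nonnegative quadratic form in (s, t).
   *)
Lemma int_cauchy_schwarz f g : bmeas f -> bmeas g ->
  (\int[mu]_x (f x * g x)) ^+ 2 <= (\int[mu]_x (f x ^+ 2)) * (\int[mu]_x (g x ^+ 2)).
Proof.
move=> bf bg; set A := \int[mu]_x (f x ^+ 2); set B := \int[mu]_x (g x ^+ 2).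
set C := \int[mu]_x (f x * g x).
have A0 : 0 <= A by apply: int_ge0 => x; exact: sqr_ge0.
have B0 : 0 <= B by apply: int_ge0 => x; exact: sqr_ge0.
have quad s t : 0 <= s ^+ 2 * A + 2 * s * t * C + t ^+ 2 * B.
  have : 0 <= \int[mu]_x ((s * f x + t * g x) ^+ 2).
    by apply: int_ge0 => x; exact: sqr_ge0.
  rewrite (@int_eq _ (fun x => (s ^+ 2 * f x ^+ 2 + (2 * s * t) * (f x * g x))
    + t ^+ 2 * g x ^+ 2)); last by move=> x; ring.
  have i1 := bmeas_intg (bmeasX 2 bf); have i2 := bmeas_intg (bmeasX 2 bg).
  have i3 := bmeas_intg (bmeasM bf bg).
  rewrite intD ?intZ// ?intD ?intZ//; first exact: intgZ.
  - exact: intgZ.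
  - by apply: intgD; exact: intgZ.
  - exact: intgZ.
have [B00|Bn0] := eqVneq B 0; last first.
  have := quad B (- C).
  have -> : B ^+ 2 * A + 2 * B * (- C) * C + (- C) ^+ 2 * B = B * (A * B - C ^+ 2) by ring.
  by rewrite pmulr_rge0 ?lt_def ?Bn0// subr_ge0.
(* When B = 0 the form at (C, - (A + 1)) equals - C^2 (A + 2). *)
have := quad C (- (A + 1)); rewrite B00 mulr0 addr0 mulr0.
have -> : C ^+ 2 * A + 2 * C * (- (A + 1)) * C = - (C ^+ 2 * (A + 2)) by ring.
by rewrite oppr_ge0 pmulr_lle0// ltr_wpDl.
Qed.

Variable K : T -> T -> R.
Hypothesis bK : bmeas (fun z : T * T => K z.1 z.2).

Lemma bmeas_section1 x : bmeas (K x).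
Proof.
exact: (@bmeas_comp _ _ _ _ _ (fun z : T * T => K z.1 z.2) (fun y => (x, y)) (pair1_measurable x)).
Qed.

Lemma bmeas_section2 y : bmeas (K ^~ y).
Proof.
exact: (@bmeas_comp _ _ _ _ _ (fun z : T * T => K z.1 z.2) (fun x => (x, y)) (pair2_measurable y)).
Qed.

(** A bounded kernel times a tensor product of integrable functions is
   dominated by the constant multiple of the latter, so both orders of
   integration are available below. *)
Lemma intg_kernel f g : intg f -> intg g ->
  (mu \x mu)%E.-integrable setT (fun z => (K z.1 z.2 * f z.1 * g z.2)%:E).
Proof.
move=> If Ig; have [mK [M KM]] := bK.
have mf := intg_meas If; have mg := intg_meas Ig.
have M0 (x : T * T) : 0 <= M by exact: le_trans (normr_ge0 _) (KM x).
have mm : measurable_fun setT (fun z : T * T => K z.1 z.2 * f z.1 * g z.2).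
  apply: measurable_funM; last exact: measurableT_comp.
  by apply: measurable_funM => //; exact: measurableT_comp.
apply/integrable12ltyP; first exact/measurable_EFinP.
apply: (@le_lt_trans _ _ (\int[mu]_x (M * `|f x| * \int[mu]_y `|g y|)%:E)%E); last first.
  have : intg (fun x => (M * (\int[mu]_y `|g y|)) * `|f x|).
    by apply: intgZ; exact: intg_norm.
  move=> /integrableP [_]; apply: le_lt_trans.
  apply: ge0_le_integral => //.
  - move=> x _; rewrite lee_fin mulr_ge0// ?mulr_ge0 ?(M0 (x, x))//.
    exact: int_ge0.
  - apply/measurable_EFinP; apply: measurable_funM => //.
    by apply: measurable_funM => //; exact: measurableT_comp.
  - apply: measurableT_comp => //; apply/measurable_EFinP.
    by apply: measurable_funM => //; exact: measurableT_comp.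
  - by move=> x _ /=; rewrite lee_fin mulrAC ler_norm.
have mprod := measurable_fun_fubini_tonelli_F (m2 := mu) (fun z => (`|K z.1 z.2 * f z.1 * g z.2|)%:E).
apply: ge0_le_integral => //.
- by move=> x _; exact: integral_ge0.
- by apply: mprod => //; apply/measurable_EFinP; exact: measurableT_comp.
- apply/measurable_EFinP; apply: measurable_funM => //.
  by apply: measurable_funM => //; exact: measurableT_comp.
move=> x _; rewrite EFinM.
have fing : (\int[mu]_y `|g y|%:E)%E = (\int[mu]_y `|g y|)%:E.
  rewrite fineK//; apply: integrable_fin_num => //; exact: (intg_norm Ig).
rewrite -fing -ge0_integralZl//; last 2 first.
  by apply/measurable_EFinP; exact: measurableT_comp.
  by rewrite lee_fin mulr_ge0// (M0 (x, x)).
apply: ge0_le_integral => //.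
- apply/measurable_EFinP; apply: measurableT_comp => //.
  have [mKx _] := bmeas_section1 x.
  apply: (measurable_funM (f := fun y => K x y * f x) (g := g)) => //.
  exact: (measurable_funM (f := K x) (g := fun=> f x)).
- apply: measurable_funeM; apply/measurable_EFinP; exact: measurableT_comp.
by move=> y _ /=; rewrite lee_fin !normrM !ler_wpM2r// (KM (x, y)).
Qed.

Lemma kernel_bmeas g : intg g -> bmeas (fun x => \int[mu]_y (K x y * g y)).
Proof.
move=> Ig; have [mK [M KM]] := bK; split.
  have i1 : intg (fun _ => 1) by exact/bmeas_intg/bmeas_cst.
  have := measurable_fubini_F (intg_kernel i1 Ig).
  move=> /(measurableT_comp (@fine_measurable R setT measurableT)).
  apply: eq_measurable_fun => x _; rewrite /Rintegral /fubini_F /=.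
  by congr fine; apply: eq_integral => y _; rewrite mulr1.
exists (M * \int[mu]_y `|g y|) => x.
have iKg : intg (fun y => K x y * g y) by apply: intgM => //; exact: bmeas_section1.
rewrite (le_trans (int_norm iKg))// -intZ; last exact: intg_norm.
apply: int_le; [exact: intg_norm|by apply: intgZ; exact: intg_norm|].
by move=> y; rewrite normrM ler_wpM2r// (KM (x, y)).
Qed.

Lemma kernel_integral f g : intg f -> intg g ->
  \int[(mu \x mu)%E]_z (K z.1 z.2 * f z.1 * g z.2) =
  \int[mu]_x (f x * \int[mu]_y (K x y * g y)).
Proof.
move=> If Ig; rewrite [LHS]/Rintegral -(integral12_prod_meas1 (intg_kernel If Ig)).
congr fine; apply: eq_integral => x _ /=; rewrite /fubini_F/=.
have iKg : intg (fun y => K x y * g y) by apply: intgM => //; exact: bmeas_section1.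
rewrite -intZ// /Rintegral fineK; last first.
  by apply: integrable_fin_num => //; exact: intgZ.
by apply: eq_integral => y _; rewrite mulrCA mulrA.
Qed.

Lemma kernel_adj f g : intg f -> intg g ->
  \int[mu]_x (f x * \int[mu]_y (K x y * g y)) =
  \int[mu]_y (g y * \int[mu]_x (K x y * f x)).
Proof.
move=> If Ig; rewrite -kernel_integral//.
rewrite [LHS]/Rintegral -(integral21_prod_meas1 (intg_kernel If Ig)).
congr fine; apply: eq_integral => y _ /=; rewrite /fubini_G/=.
have iKf : intg (fun x => K x y * f x) by apply: intgM => //; exact: bmeas_section2.
rewrite -intZ// /Rintegral fineK; last first.
  by apply: integrable_fin_num => //; exact: intgZ.
by apply: eq_integral => x _; rewrite mulrC.
Qed.

End finite_integral.

(** * Integration over the circle *)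

Section circle.
Variables (R : realType) (L : R).
Hypothesis L0 : 0 < L.

Local Notation circle := (circle_measure L).
Local Notation RM := (measurableTypeR R).

Lemma continuous_bmeas (h : R -> R) (M : R) :
  continuous h -> (forall x, `|h x| <= M) -> bmeas (h : RM -> R).
Proof.
by move=> ch hM; split; [exact: continuous_measurable_fun | exists M].
Qed.

(** The circle measure lives on a half-open interval; the closed one is what
   the fundamental theorem of calculus needs. *)
Lemma circle_integral (h : RM -> R) : bmeas h ->
  \int[circle]_t h t = \int[lebesgue_measure]_(t in `[0, L]) h t.
Proof.
move=> bh; have ih := bmeas_intg circle bh.
have mD := @measurable_circle_dom R L.
have -> : \int[circle]_t h t = \int[circle]_(t in circle_dom L) h t.
  rewrite /Rintegral (negligible_integral (N := ~` circle_dom L))//; last 2 first.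
  - exact: measurableC.
  - by rewrite /circle_measure /= /mfrestr /mrestr setICl measure0.
  by rewrite setTD setCK.
rewrite -(@Rintegral_itv_bndo_bndc _ (BLeft 0) L h); last first.
  apply: (@measurable_bounded_integrable _ _ _ lebesgue_measure) => //.
  - exact: circle_dom_lty.
  - exact: measurable_funTS bh.1.
  - have [M hM] := bh.2.
    by exists M; split; [rewrite num_real | move=> x Mx y _; exact: le_trans (ltW Mx)].
rewrite /Rintegral; congr fine; apply: eq_measure_integral => A mA AD.
by rewrite /circle_measure /= /mfrestr /mrestr setIidl.
Qed.

Lemma cos_shift_bmeas (a b : R) : bmeas ((fun t => cos (a * t + b)) : RM -> R).
Proof.
apply: (@continuous_bmeas _ 1); last by move=> x; exact: cos_max.
move=> x; apply: (@continuous_comp _ _ _ (fun t => a * t + b) cos);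
  last exact: continuous_cos.
by apply: cvgD; [exact: mulrl_continuous | exact: cvg_cst].
Qed.

Lemma sin_int_period (m : int) (b : R) : sin (2 * pi * m%:~R + b) = sin b.
Proof.
have H n (c : R) : sin (2 * pi * n%:R + c) = sin c.
  elim: n c => [|n IH] c; first by rewrite mulr0 add0r.
  rewrite -[n.+1%:R]natr1 mulrDr mulr1 -addrA IH addrC.
  by rewrite (_ : 2 * pi = pi *+ 2) ?sinD2pi// mulr_natl.
case: m => n; first exact: H.
rewrite NegzE mulrNz mulrN -[LHS](H n.+1); congr sin; exact: addNKr.
Qed.

Lemma circle_int_cos (m : int) (b : R) :
  \int[circle]_t cos (m%:~R * (2 * pi / L) * t + b) = (m == 0)%:R * L * cos b.
Proof.
rewrite circle_integral; last exact: cos_shift_bmeas.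
have [->|m0] := eqVneq m 0.
  under eq_Rintegral do rewrite !mul0r add0r.
  by rewrite Rintegral_cst//= lebesgue_measure_itv/= lte_fin L0 -EFinB subr0 mul1r mulrC.
rewrite mul0r mul0r; set a := m%:~R * (2 * pi / L).
have a0 : a != 0.
  have p0 : (pi : R) != 0 by rewrite lt0r_neq0// pi_gt0.
  have l0 : L != 0 by rewrite lt0r_neq0.
  rewrite /a mulf_neq0 ?intr_eq0//; apply: mulf_neq0; last by rewrite invr_neq0.
  by rewrite mulf_neq0// pnatr_eq0.
have cc : continuous (fun t : R => cos (a * t + b)).
  move=> x; apply: (@continuous_comp _ _ _ (fun t => a * t + b) cos);
    last exact: continuous_cos.
  by apply: cvgD; [exact: mulrl_continuous | exact: cvg_cst].
have dF (x : R) : is_derive x 1 (fun t : R => a^-1 * sin (a * t + b)) (cos (a * x + b)).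
  apply: is_derive_eq; rewrite /GRing.scale/=; field; exact: a0.
rewrite /Rintegral (@continuous_FTC2 _ _ (fun t => a^-1 * sin (a * t + b)))//.
- rewrite /= mulr0 add0r /a.
  have -> : m%:~R * (2 * pi / L) * L = 2 * pi * m%:~R :> R by field; rewrite gt_eqF.
  by rewrite sin_int_period subrr.
- exact: continuous_subspaceT.
- have cF : continuous (fun t : R => a^-1 * sin (a * t + b)).
    by move=> x; apply: differentiable_continuous; apply/derivable1_diffP; case: (dF x).
  split.
  - by move=> x _; case: (dF x).
  - by apply: cvg_at_right_filter; exact: cF.
  - by apply: cvg_at_left_filter; exact: cF.
- by move=> x _; rewrite derive1E; case: (dF x).
Qed.

End circle.

(** * Reproducing kernels on the circle *)

Section circle_kernel.
Variables (R : realType) (L : R).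
Hypothesis L0 : 0 < L.

Local Notation circle := (circle_measure L).
Local Notation RM := (measurableTypeR R).

Definition phase (t : R) : R := 2 * pi / L * t.

Definition cosn (n : nat) (t : R) : R := cos (n%:R * phase t).

(** The square of one factor of Theta; L / theta_sq n is the integral of the
   square of cosn n over a period. *)
Definition theta_sq (n : nat) : R := 2 - (n == 0%N)%:R.

Lemma theta_sq_gt0 n : 0 < theta_sq n.
Proof. by rewrite /theta_sq; case: eqP => _ /=; lra. Qed.

(** Convolution with this kernel is the orthogonal projection onto the waves,
   both cosines and sines, of frequencies in S. *)
Definition ker1 (S : seq nat) (t : R) : R :=
  L^-1 * \sum_(s <- S) theta_sq s * cosn s t.

Lemma phaseB x y : phase (x - y) = phase x - phase y.
Proof. by rewrite /phase mulrBr. Qed.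

Lemma cos_cos (a b : R) : cos a * cos b = 2^-1 * (cos (a + b) + cos (a - b)).
Proof. by rewrite cosD cosB; field. Qed.

Lemma cosn_bmeas n : bmeas (cosn n : RM -> R).
Proof.
have -> : cosn n = (fun t => cos (n%:R * (2 * pi / L) * t + 0)).
  by apply/funext => t; rewrite /cosn /phase addr0 mulrA.
exact: cos_shift_bmeas.
Qed.

Lemma cosn_phase_bmeas n b : bmeas ((fun t => cos (n%:R * phase t + b)) : RM -> R).
Proof.
have -> : (fun t => cos (n%:R * phase t + b)) = (fun t => cos (n%:R * (2 * pi / L) * t + b)).
  by apply/funext => t; rewrite /phase mulrA.
exact: cos_shift_bmeas.
Qed.

Lemma cosn_shift_bmeas n x : bmeas ((fun z => cosn n (x - z)) : RM -> R).
Proof.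
have -> : (fun t => cosn n (x - t)) = (fun t => cos (n%:R * phase t + - (n%:R * phase x))).
  by apply/funext => t; rewrite /cosn phaseB -cosN; congr cos; ring.
exact: cosn_phase_bmeas.
Qed.

Lemma ker1_bmeas S x : bmeas ((fun z => ker1 S (x - z)) : RM -> R).
Proof.
apply: bmeasM; first exact: bmeas_cst.
by apply: bmeas_sum => s; apply: bmeasM; [exact: bmeas_cst | exact: cosn_shift_bmeas].
Qed.

Lemma cosnN m t : cosn m (- t) = cosn m t.
Proof. by rewrite /cosn /phase !mulrN cosN. Qed.

Lemma cosn0 m : cosn m 0 = 1.
Proof. by rewrite /cosn /phase !mulr0 cos0. Qed.

Lemma ker1_even S t : ker1 S (- t) = ker1 S t.
Proof.
by congr (_ * _); apply: eq_bigr => s _; rewrite cosnN.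
Qed.

(** The phase b is arbitrary, so that sines are covered together with cosines.
   *)
Lemma cosn_reproduce s m x b :
  \int[circle]_z (cosn s (x - z) * cos (m%:R * phase z + b)) =
  (s == m)%:R * (L / theta_sq s) * cos (m%:R * phase x + b).
Proof.
rewrite (@int_eq _ _ _ circle _ (fun z : RM =>
   2^-1 * (cos ((m%:Z - s%:Z)%:~R * (2 * pi / L) * z + (s%:R * phase x + b))
    + cos ((m%:Z + s%:Z)%:~R * (2 * pi / L) * z + (b - s%:R * phase x))))); last first.
  move=> z; rewrite /cosn phaseB cos_cos; congr (_ * (cos _ + _)).
    by rewrite /phase intrB !pmulrn; ring.
  by rewrite -cosN; congr cos; rewrite /phase intrD !pmulrn; ring.
have bm k c : intg circle (fun z : RM => cos (k%:~R * (2 * pi / L) * z + c)).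
  exact/bmeas_intg/cos_shift_bmeas.
rewrite intZ; last exact: intgD.
rewrite intD// !circle_int_cos// subr_eq0 eqz_nat.
rewrite -PoszD -[0]/(0%:Z) eqz_nat addn_eq0 [s == m]eq_sym.
have [->|sm] := eqVneq s m; last first.
  have -> : (m == 0)%N && (s == 0)%N = false.
    by apply/negP => /andP[/eqP m0 /eqP s0]; rewrite m0 s0 eqxx in sm.
  by rewrite !mul0r addr0 mulr0.
rewrite andbb /theta_sq !mul1r.
have [->|m0] /= := eqVneq m 0%N; first by rewrite !mul0r subr0 add0r; field.
by rewrite !mul0r addr0 subr0; field.
Qed.

Lemma ker1_reproduce S m x b : uniq S ->
  \int[circle]_z (ker1 S (x - z) * cos (m%:R * phase z + b)) =
  (m \in S)%:R * cos (m%:R * phase x + b).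
Proof.
move=> uS.
rewrite (@int_eq _ _ _ circle _ (fun z : RM => L^-1 * \sum_(s <- S)
    (theta_sq s * (cosn s (x - z) * cos (m%:R * phase z + b))))); last first.
  move=> z; rewrite /ker1 -mulrA; congr (_ * _); rewrite big_distrl /=.
  by apply: eq_bigr => s _; rewrite mulrA.
have bm s : intg circle (fun z : RM => cosn s (x - z) * cos (m%:R * phase z + b)).
  by apply: bmeas_intg; apply: bmeasM; [exact: cosn_shift_bmeas | exact: cosn_phase_bmeas].
have [i1 e1] := @int_sum _ _ _ circle _ S xpredT (fun s (z : RM) =>
  theta_sq s * (cosn s (x - z) * cos (m%:R * phase z + b))) (fun s => intgZ _ (bm s)).
rewrite intZ// e1.
have mn s : theta_sq s != 0.
  by rewrite lt0r_neq0// theta_sq_gt0.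
have L0' : L != 0 by rewrite gt_eqF.
rewrite (eq_bigr (fun s => (s == m)%:R * (L * cos (m%:R * phase x + b)))); last first.
  move=> s _; rewrite intZ// cosn_reproduce; field; exact: mn.
rewrite -big_distrl /= mulrA [in LHS]mulrC.
have -> : \sum_(s <- S) (s == m)%:R = (m \in S)%:R :> R.
  rewrite -natr_sum -big_mkcond /= sum1_count -count_uniq_mem//.
by field.
Qed.

End circle_kernel.

(** * Integration over the torus *)

Section product_integral.
Context d1 d2 (T1 : measurableType d1) (T2 : measurableType d2) (R : realType).
Variables (m1 : {finite_measure set T1 -> \bar R}).
Variables (m2 : {finite_measure set T2 -> \bar R}).
Variables (g : T1 -> R) (h : T2 -> R).
Hypotheses (bg : bmeas g) (bh : bmeas h).

Lemma bmeas_product_integrable :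
  (m1 \x m2)%E.-integrable setT (fun p => (g p.1 * h p.2)%:E).
Proof.
have [mgh [M hM]] : bmeas (fun p : T1 * T2 => g p.1 * h p.2).
  by apply: bmeasM; [exact: (bmeas_comp (phi := fst)) | exact: (bmeas_comp (phi := snd))].
apply: measurable_bounded_integrable => //.
  have e : (m1 \x m2)%E setT = (m1 setT * m2 setT)%E.
    by rewrite -setXTT product_measure1E.
  apply: (@eq_ind_r _ _ (fun x => (x < +oo)%E) _ _ e).
  by rewrite ltey_eq fin_numM// fin_num_measure.
by exists M; split; [rewrite num_real | move=> x Mx y _; exact: le_trans (ltW Mx)].
Qed.

Lemma bmeas_product_integral :
  \int[(m1 \x m2)%E]_p (g p.1 * h p.2) = (\int[m1]_x g x) * (\int[m2]_y h y).
Proof.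
rewrite [LHS]/Rintegral -(integral12_prod_meas1 bmeas_product_integrable) /fubini_F /=.
rewrite mulrC -intZ; last exact: bmeas_intg.
congr fine; apply: eq_integral => t _.
rewrite mulrC -intZ; last exact: bmeas_intg.
by rewrite /Rintegral fineK//; apply: integrable_fin_num => //; apply: intgZ; exact: bmeas_intg.
Qed.

End product_integral.

Section torus.
Variables (R : realType) (L : R).
Hypothesis L0 : 0 < L.

Local Notation circle := (circle_measure L).
Local Notation RM := (measurableTypeR R).

Lemma bmeas_tnth d (i : 'I_d) (h : RM -> R) : bmeas h ->
  bmeas (fun x : points R d => h (tnth x i)).
Proof. by move=> bh; apply: bmeas_comp bh; exact: measurable_tnth. Qed.

Lemma bmeas_tnth_prod d (g : 'I_d -> RM -> R) : (forall i, bmeas (g i)) ->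
  bmeas (fun x : points R d => \prod_i g i (tnth x i)).
Proof. by move=> bg; apply: bmeas_prod => i; exact: bmeas_tnth. Qed.

Lemma torus_mass d : \int[torus_measure L d]_x 1 = L ^+ d.
Proof.
rewrite Rintegral_cst// mul1r -[RHS]/(fine (L ^+ d)%:E); congr fine.
by apply: torus_measure_setT; exact: ltW.
Qed.

Lemma torus_integral_prod d (g : 'I_d -> RM -> R) : (forall i, bmeas (g i)) ->
  \int[torus_measure L d]_x \prod_i g i (tnth x i) =
  \prod_i \int[circle]_t g i t.
Proof.
elim: d g => [|d IH] g bg.
  rewrite big_ord0 (_ : (fun x : points R 0 => \prod_i g i (tnth x i)) = cst 1).
    exact: torus_mass.
  by apply/funext => x; rewrite big_ord0.
rewrite big_ord_recl -IH//=.
set h := fun x : points R d => \prod_i g (lift ord0 i) (tnth x i).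
have bh : bmeas h := bmeas_tnth_prod (fun i => bg (lift ord0 i)).
have bF := bmeas_tnth_prod bg.
set F := (fun x : points R d.+1 => \prod_i g i (tnth x i)) in bF *.
have FE (p : RM * points R d) : F (cons_pair p) = g ord0 p.1 * h p.2.
  by rewrite /F big_ord_recl; congr (_ * _); apply: eq_bigr => i _; rewrite tnthS.
have ip := bmeas_product_integrable circle (torus_measure L d) (bg ord0) bh.
rewrite -(bmeas_product_integral circle (torus_measure L d) (bg ord0) bh).
rewrite [LHS]/Rintegral integral_pushforward//=; last 3 first.
- exact: measurable_cons_pair.
- by apply/measurable_EFinP; case: bF.
- by apply: eq_integrable ip => // p _ /=; rewrite FE.
rewrite preimage_setT; congr fine; apply: eq_integral => p _ /=; by rewrite FE.
Qed.

End torus.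

Lemma rV_norm_lt (R : realType) d (x : 'rV[R]_d) e : 0 < e ->
  (forall i, `|x 0 i| < e) -> `|x| < e.
Proof.
move=> e0 xe; rewrite [ltLHS]/Num.norm/= mx_normrE; apply/bigmax_ltP.
by split => // -[i j] _; rewrite (ord1 i).
Qed.

Section vec_measurability.
Context dT (T : measurableType dT) (R : realType) (d : nat).

(** V o u is the pointwise limit of V at u rounded down to the grid of mesh
   1/(n+1); the rounded map takes countably many values, so its preimages are
   countable unions of measurable boxes. *)
Lemma continuous_vec_measurable (V : 'rV[R]_d -> R) (u : T -> 'rV[R]_d) :
  continuous V -> (forall i, measurable_fun setT (fun x => u x 0 i)) ->
  measurable_fun setT (fun x => V (u x)).
Proof.
move=> cV mu.
pose fl n (x : T) (i : 'I_d) : int := Num.floor (u x 0 i * n.+1%:R).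
pose rnd n (k : {ffun 'I_d -> int}) : 'rV[R]_d := \row_i ((k i)%:~R / n.+1%:R).
pose Vn n x := V (rnd n [ffun i => fl n x i]).
have mfl n i k : measurable [set x | fl n x i = k].
  have -> : [set x | fl n x i = k] = setT `&` (fun x => u x 0 i * n.+1%:R) @^-1` `[k%:~R, (k + 1)%:~R[.
    rewrite setTI; apply/seteqP; split => x /=; rewrite in_itv/= /fl.
      by move=> <-; rewrite floor_le_tmp floorD1_gt.
    by move=> h; apply: floor_def.
  have := measurable_funM (mu i) (@measurable_cst _ _ T R setT n.+1%:R).
  by apply => //; exact: measurable_itv.
apply: (measurable_fun_cvg (h := Vn)).
  move=> n _ Y mY; rewrite setTI.
  have -> : Vn n @^-1` Y = \bigcup_(k in [set k : {ffun 'I_d -> int} | Y (V (rnd n k))])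
      \bigcap_(i in [set: 'I_d]) [set x | fl n x i = k i].
    apply/seteqP; split => x /=.
      move=> Yx; exists [ffun i => fl n x i] => //= i _.
      by rewrite ffunE.
      move=> [k Yk fk]; rewrite /Vn; suff -> : [ffun i => fl n x i] = k by [].
    by apply/ffunP => i; rewrite ffunE; exact: fk.
  rewrite bigcup_mkcond; apply: countable_bigcupT_measurable => // k.
  case: ifPn => _; last exact: measurable0.
  by apply: fin_bigcap_measurable.
move=> x _.
apply: (cvg_comp (fun n => rnd n [ffun i => fl n x i]) V _ (cV (u x))).
apply/cvgrPdist_lt => e e0; near=> n.
apply: rV_norm_lt => // i; rewrite !mxE ffunE /fl.
have /andP[fl1 fl2] := floor_itv (u x 0 i * n.+1%:R).
have n0 : 0 < n.+1%:R :> R by rewrite ltr0n.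
have ne : n.+1%:R^-1 < e by near: n; exact: (near_infty_natSinv_lt (PosNum e0)).
apply: le_lt_trans ne; rewrite ger0_norm ?subr_ge0 ?ler_pdivrMr//.
rewrite -(ler_pM2r n0) mulrBl divfK ?gt_eqF// mulVf ?gt_eqF// lerBlDl.
by rewrite ltW// (lt_le_trans fl2)// intrD.
Unshelve. all: by end_near. Qed.

End vec_measurability.

(** * Products of waves of one frequency *)

(** The frequencies occurring in a product of two waves of frequency k; freq3
   does the same for three waves. *)
Definition freq2 (k : nat) : seq nat :=
  if k == 0%N then [:: 0%N] else [:: 0%N; (2 * k)%N].

Definition freq3 (k : nat) : seq nat :=
  if k == 0%N then [:: 0%N] else [:: k; (3 * k)%N].

Lemma freq2_uniq k : uniq (freq2 k).
Proof. by rewrite /freq2; case: eqP => //=; case: k. Qed.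

Lemma freq3_uniq k : uniq (freq3 k).
Proof.
rewrite /freq3; case: eqP => //= k0; rewrite inE andbT eq_sym.
by apply/eqP; lia.
Qed.

(** Sets of frequency vectors are encoded as products of finite lists of
   frequencies, one list per coordinate; modes2 and modes3 are {0} u P2 and
   {k} u P3. *)
Definition modes1 d (k : 'I_d -> nat) i := [:: k i].
Definition modes2 d (k : 'I_d -> nat) i := freq2 (k i).
Definition modes3 d (k : 'I_d -> nat) i := freq3 (k i).

Lemma modes2_uniq d (k : 'I_d -> nat) i : uniq (modes2 k i).
Proof. exact: freq2_uniq. Qed.

Lemma modes3_uniq d (k : 'I_d -> nat) i : uniq (modes3 k i).
Proof. exact: freq3_uniq. Qed.

Lemma zero_freq2 n : 0%N \in freq2 n.
Proof. by rewrite /freq2; case: eqP. Qed.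

Lemma zero_freq3 n : n != 0%N -> 0%N \notin freq3 n.
Proof. by rewrite /freq3 => /[dup] n0 /negbTE ->; rewrite !inE; case: n n0. Qed.

Lemma self_freq3 n : n \in freq3 n.
Proof. by rewrite /freq3; case: eqP => [->|]; rewrite inE eqxx. Qed.

Section reproduced_products.
Variables (R : realType) (L : R).
Hypothesis L0 : 0 < L.

Local Notation circle := (circle_measure L).
Local Notation RM := (measurableTypeR R).

Definition reproduced (S : seq nat) (g : RM -> R) :=
  bmeas g /\ forall x, \int[circle]_z (ker1 L S (x - z) * g z) = g x.

Lemma reproduced_cos S m b : uniq S -> m \in S ->
  reproduced S (fun z => cos (m%:R * phase L z + b)).
Proof.
move=> uS mS; split; first exact: cosn_phase_bmeas.
by move=> x; rewrite ker1_reproduce// mS mul1r.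
Qed.

Lemma reproducedZ S c g : reproduced S g -> reproduced S (fun z => c * g z).
Proof.
move=> [bg rg]; split; first by apply: bmeasM => //; exact: bmeas_cst.
move=> x; rewrite (@int_eq _ _ _ circle _ (fun z : RM => c * (ker1 L S (x - z) * g z))).
  by rewrite intZ ?rg//; apply: bmeas_intg; apply: bmeasM => //; exact: ker1_bmeas.
by move=> z; ring.
Qed.

Lemma reproducedD S g h : reproduced S g -> reproduced S h ->
  reproduced S (fun z => g z + h z).
Proof.
move=> [bg rg] [bh rh]; split; first exact: bmeasD.
move=> x; rewrite (@int_eq _ _ _ circle _ (fun z : RM => ker1 L S (x - z) * g z + ker1 L S (x - z) * h z)).
  by rewrite intD ?rg ?rh//; apply: bmeas_intg; apply: bmeasM => //; exact: ker1_bmeas.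
by move=> z; ring.
Qed.

Lemma cosnB n z y : cosn L n (z - y) = cos (n%:R * phase L z + - (n%:R * phase L y)).
Proof. by rewrite /cosn phaseB mulrBr. Qed.

Lemma reproduced_ker1 S S' y : uniq S -> {subset S' <= S} ->
  reproduced S (fun z => ker1 L S' (z - y)).
Proof.
move=> uS sS; apply: reproducedZ.
elim: S' sS => [|s S' IH] sS.
  under eq_fun do rewrite big_nil.
  split; first exact: bmeas_cst.
  move=> x; rewrite (@int_eq _ _ _ circle _ (fun=> 0)).
    by rewrite Rintegral_cst// mul0r.
  by move=> z; rewrite mulr0.
have -> : (fun z => \sum_(t <- s :: S') theta_sq R t * cosn L t (z - y)) =
    (fun z => theta_sq R s * cos (s%:R * phase L z + - (s%:R * phase L y)) +
        \sum_(t <- S') theta_sq R t * cosn L t (z - y)).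
  by apply/funext => z; rewrite big_cons cosnB.
apply: reproducedD; last by apply: IH => t tS'; apply: sS; rewrite inE tS' orbT.
by apply: reproducedZ; apply: reproduced_cos => //; apply: sS; rewrite inE eqxx.
Qed.

Lemma ker1_single k z y : ker1 L [:: k] (z - y) =
  L^-1 * theta_sq R k * cos (k%:R * phase L z + - (k%:R * phase L y)).
Proof. by rewrite /ker1 big_seq1 cosnB mulrA. Qed.

(** Product-to-sum formulas; the shifts y and y' only change the phases. *)
Lemma reproduced_freq2 k y y' :
  reproduced (freq2 k) (fun z => ker1 L [:: k] (z - y) * ker1 L [:: k] (z - y')).
Proof.
have -> : (fun z => ker1 L [:: k] (z - y) * ker1 L [:: k] (z - y')) = (fun z =>
   ((L^-1 * theta_sq R k) ^+ 2 * 2^-1) *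
   (cos ((2 * k)%N%:R * phase L z + - (k%:R * phase L y + k%:R * phase L y')) +
    cos (0%N%:R * phase L z + (k%:R * phase L y' - k%:R * phase L y)))).
  apply/funext => z; rewrite !ker1_single.
  set c := L^-1 * _.
  transitivity (c ^+ 2 * (cos (k%:R * phase L z - k%:R * phase L y) *
    cos (k%:R * phase L z - k%:R * phase L y'))); first ring.
  rewrite cos_cos -mulrA; congr (_ * (_ * (cos _ + cos _))); first by rewrite natrM; ring.
  by ring.
apply: reproducedZ; apply: reproducedD; apply: reproduced_cos => //; try exact: freq2_uniq.
  by rewrite /freq2; case: eqP => [->|]; rewrite ?inE ?eqxx ?orbT// muln0.
by rewrite /freq2; case: eqP.
Qed.

Lemma reproduced_freq3 k y y' y'' :
  reproduced (freq3 k)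
    (fun z => ker1 L [:: k] (z - y) * ker1 L [:: k] (z - y') * ker1 L [:: k] (z - y'')).
Proof.
pose b := - (k%:R * phase L y); pose b' := - (k%:R * phase L y').
pose b'' := - (k%:R * phase L y'').
have -> : (fun z => ker1 L [:: k] (z - y) * ker1 L [:: k] (z - y') * ker1 L [:: k] (z - y'')) = (fun z =>
   ((L^-1 * theta_sq R k) ^+ 3 * 4^-1) *
   ((cos ((3 * k)%N%:R * phase L z + (b + b' + b'')) +
    cos (k%:R * phase L z + (b + b' - b''))) +
    (cos (k%:R * phase L z + (b'' + b - b')) + cos (k%:R * phase L z + (b'' + b' - b))))).
  apply/funext => z; rewrite !ker1_single.
  set c := L^-1 * _; set a := k%:R * phase L z.
  transitivity (c ^+ 3 * (cos (a + b) * cos (a + b') * cos (a + b''))); first ring.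
  rewrite (cos_cos (a + b)).
  transitivity (c ^+ 3 * 2^-1 * (cos (a + b + (a + b')) * cos (a + b'') +
    cos (a + b'') * cos (a + b - (a + b')))); first ring.
  rewrite !cos_cos.
  have -> : a + b + (a + b') + (a + b'') = (3 * k)%N%:R * phase L z + (b + b' + b'').
    by rewrite natrM /a; ring.
  have -> : a + b + (a + b') - (a + b'') = a + (b + b' - b'') by ring.
  have -> : a + b'' + (a + b - (a + b')) = a + (b'' + b - b') by ring.
  have -> : a + b'' - (a + b - (a + b')) = a + (b'' + b' - b) by ring.
  by field.
have k3 : (3 * k)%N \in freq3 k.
  by rewrite /freq3; case: eqP => [->|]; rewrite ?inE ?eqxx ?orbT// muln0.
have k1 : k \in freq3 k.
  by rewrite /freq3; case: eqP => [->|]; rewrite ?inE ?eqxx.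
apply: reproducedZ; apply: reproducedD; apply: reproducedD;
  by apply: reproduced_cos => //; exact: freq3_uniq.
Qed.

End reproduced_products.

(** * Reproducing kernels on the torus *)

Section torus_kernel.
Variables (R : realType) (L : R) (d : nat).
Hypothesis L0 : 0 < L.

Local Notation circle := (circle_measure L).
Local Notation RM := (measurableTypeR R).
Local Notation T := (points R d).
Local Notation mu := (torus_measure L d).

Definition kern (S : 'I_d -> seq nat) (z : 'rV[R]_d) : R :=
  \prod_i ker1 L (S i) (z 0 i).

Definition cosv (m : 'I_d -> nat) (z : 'rV[R]_d) : R :=
  \prod_i cosn L (m i) (z 0 i).

Lemma vecB (x y : T) i : (vec x - vec y) 0 i = (tnth x i : R) - tnth y i.
Proof. by rewrite !mxE. Qed.

Lemma ker1_bmeas0 S : bmeas (ker1 L S : RM -> R).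
Proof.
have := ker1_bmeas L S 0; congr bmeas; apply/funext => z.
by rewrite sub0r ker1_even.
Qed.

Lemma coord_diff_measurable i :
  measurable_fun setT (fun z : T * T => ((vec z.1 - vec z.2) 0 i : RM)).
Proof.
under eq_fun do rewrite vecB.
apply: (@measurable_funB _ _ _ _ (fun z : T * T => (tnth z.1 i : R)) (fun z => tnth z.2 i)).
  by apply: (measurableT_comp (measurable_tnth i)).
exact: (measurableT_comp (measurable_tnth i)).
Qed.

Lemma coord_measurable i : measurable_fun setT (fun x : T => (vec x 0 i : RM)).
Proof. by under eq_fun do rewrite mxE; exact: measurable_tnth. Qed.

Lemma kern_bmeas S : bmeas (fun z : T * T => kern S (vec z.1 - vec z.2)).
Proof.
apply: bmeas_prod => i.
exact: (bmeas_comp (coord_diff_measurable i) (ker1_bmeas0 (S i))).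
Qed.

Lemma cosv_bmeas m : bmeas (fun x : T => cosv m (vec x)).
Proof.
apply: bmeas_prod => i.
exact: (bmeas_comp (coord_measurable i) (cosn_bmeas L (m i))).
Qed.

Lemma kern_bmeas1 S x : bmeas (fun z : T => kern S (vec x - vec z)).
Proof. exact: (bmeas_section1 (K := fun x z : T => kern S (vec x - vec z)) (kern_bmeas S) x). Qed.

Lemma kern_bmeas2 S y : bmeas (fun z : T => kern S (vec z - vec y)).
Proof. exact: (bmeas_section2 (K := fun z y : T => kern S (vec z - vec y)) (kern_bmeas S) y). Qed.

Lemma kern_even S z : kern S (- z) = kern S z.
Proof. by apply: eq_bigr => i _; rewrite mxE ker1_even. Qed.

Lemma kern_sym S x y : kern S (vec x - vec y) = kern S (vec y - vec x).
Proof. by rewrite -kern_even opprB. Qed.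

(** Everything is a product over the coordinates, so the torus identities
   reduce to one circle identity per coordinate. *)
Lemma kern_conv S (g g' : 'I_d -> RM -> R) (x : T) : (forall i, bmeas (g i)) ->
  (forall i, \int[circle]_z (ker1 L (S i) ((tnth x i : R) - z) * g i z) = g' i (tnth x i)) ->
  \int[mu]_z (kern S (vec x - vec z) * \prod_i g i (tnth z i)) = \prod_i g' i (tnth x i).
Proof.
move=> bg gE.
rewrite (@int_eq _ _ _ mu _ (fun z => \prod_i
    (ker1 L (S i) ((tnth x i : R) - tnth z i) * g i (tnth z i)))); last first.
  by move=> z; rewrite big_split /=; congr (_ * _); apply: eq_bigr => i _; rewrite vecB.
rewrite (torus_integral_prod L0 (g := fun i (t : RM) => ker1 L (S i) ((tnth x i : R) - t) * g i t)).
  by apply: eq_bigr => i _; exact: gE.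
by move=> i; apply: bmeasM => //; exact: ker1_bmeas.
Qed.

Lemma kern_reproduce S (g : 'I_d -> RM -> R) (x : T) :
  (forall i, reproduced L (S i) (g i)) ->
  \int[mu]_z (kern S (vec x - vec z) * \prod_i g i (tnth z i)) = \prod_i g i (tnth x i).
Proof.
by move=> rg; apply: (kern_conv (g := g) (g' := g)) => i; case: (rg i) => // _; exact.
Qed.

Lemma kern_comp S S' x y : (forall i, uniq (S i)) ->
  (forall i, {subset S' i <= S i}) ->
  \int[mu]_z (kern S (vec x - vec z) * kern S' (vec z - vec y)) = kern S' (vec x - vec y).
Proof.
move=> uS sS.
have E (z : T) : kern S' (vec z - vec y) = \prod_i ker1 L (S' i) ((tnth z i : R) - tnth y i).
  by apply: eq_bigr => i _; rewrite vecB.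
rewrite E -(kern_reproduce (S := S) (g := fun i (t : RM) => ker1 L (S' i) (t - tnth y i))).
  by apply: int_eq => z; rewrite E.
by move=> i; exact: reproduced_ker1.
Qed.

(** Products of two translates of the kernel of frequency k stay within {0} u
   P2; the next lemma is the analogue for three translates and {k} u P3. *)
Lemma kern_modes2_reproduce k (x y y' : T) :
  \int[mu]_z (kern (modes2 k) (vec x - vec z) *
     (kern (modes1 k) (vec z - vec y) * kern (modes1 k) (vec z - vec y'))) =
  kern (modes1 k) (vec x - vec y) * kern (modes1 k) (vec x - vec y').
Proof.
have E (z : T) : kern (modes1 k) (vec z - vec y) * kern (modes1 k) (vec z - vec y') =
    \prod_i (ker1 L [:: k i] ((tnth z i : R) - tnth y i) * ker1 L [:: k i] ((tnth z i : R) - tnth y' i)).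
  by rewrite /kern [RHS]big_split; congr (_ * _); apply: eq_bigr => i _; rewrite vecB.
rewrite E -(kern_reproduce (S := modes2 k) (g := fun i (t : RM) =>
   ker1 L [:: k i] (t - tnth y i) * ker1 L [:: k i] (t - tnth y' i))).
  by apply: int_eq => z; rewrite E.
by move=> i; exact: reproduced_freq2.
Qed.

Lemma kern_modes3_reproduce k (x y y' y'' : T) :
  \int[mu]_z (kern (modes3 k) (vec x - vec z) *
     (kern (modes1 k) (vec z - vec y) * kern (modes1 k) (vec z - vec y') *
      kern (modes1 k) (vec z - vec y''))) =
  kern (modes1 k) (vec x - vec y) * kern (modes1 k) (vec x - vec y') * kern (modes1 k) (vec x - vec y'').
Proof.
have E (z : T) : kern (modes1 k) (vec z - vec y) * kern (modes1 k) (vec z - vec y') *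
      kern (modes1 k) (vec z - vec y'') =
    \prod_i (ker1 L [:: k i] ((tnth z i : R) - tnth y i) *
      ker1 L [:: k i] ((tnth z i : R) - tnth y' i) *
      ker1 L [:: k i] ((tnth z i : R) - tnth y'' i)).
  rewrite /kern [RHS]big_split [X in _ = X * _]big_split.
    by congr (_ * _ * _); apply: eq_bigr => i _; rewrite vecB.
rewrite E -(kern_reproduce (S := modes3 k) (g := fun i (t : RM) =>
   ker1 L [:: k i] (t - tnth y i) * ker1 L [:: k i] (t - tnth y' i) * ker1 L [:: k i] (t - tnth y'' i))).
  by apply: int_eq => z; rewrite E.
by move=> i; exact: reproduced_freq3.
Qed.

Lemma kern_int S x : (forall i, uniq (S i)) ->
  \int[mu]_z (kern S (vec x - vec z)) = \prod_i (0%N \in S i)%:R.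
Proof.
move=> uS; rewrite -(kern_conv (S := S) (g := fun=> cst 1) (g' := fun i => cst (0%N \in S i)%:R) (x := x)).
- by apply: int_eq => z; rewrite big1 ?mulr1.
- by move=> i; exact: bmeas_cst.
move=> i; have := ker1_reproduce L0 0 (tnth x i) 0 (uS i).
rewrite mul0r addr0 cos0 mulr1 => <-; apply: int_eq => z /=.
by rewrite mul0r addr0 cos0.
Qed.

(** The cosine coefficients of a reproducing kernel are 0 or 1: the indicator
   of its frequencies. *)
Lemma kern_coef S m : (forall i, uniq (S i)) ->
  \int[mu]_z (kern S (vec z) * cosv m (vec z)) = \prod_i (m i \in S i)%:R.
Proof.
move=> uS; pose x0 : T := origin R d.
have vx0 : vec x0 = 0.
  by apply/rowP => i; rewrite !mxE (tnth_nth 0) /= nth_nseq ltn_ord.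
have tx0 i : tnth x0 i = 0 by rewrite (tnth_nth 0) /= nth_nseq ltn_ord.
rewrite -(kern_conv (S := S) (g := fun i => cosn L (m i)) (g' := fun i => cst (m i \in S i)%:R) (x := x0)).
- apply: int_eq => z; rewrite vx0 sub0r kern_even; congr (_ * _).
  by apply: eq_bigr => i _; rewrite mxE.
- by move=> i; exact: cosn_bmeas.
move=> i; have := ker1_reproduce L0 (m i) (tnth x0 i) 0 (uS i).
rewrite tx0 /phase mulr0 mulr0 addr0 cos0 mulr1 => <-; apply: int_eq => z /=.
by rewrite addr0.
Qed.

Lemma kern_const z : kern (fun=> [:: 0%N]) z = rho_inf d L.
Proof.
rewrite /kern (eq_bigr (fun=> L^-1)); last first.
  by move=> i _; rewrite /ker1 big_seq1 /cosn mul0r cos0 /theta_sq /=; lra.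
by rewrite prodr_const card_ord /rho_inf exprVn.
Qed.

Lemma kern_modes1_bound k z : `|kern (modes1 k) z| <= rho_inf d L * \prod_i theta_sq R (k i).
Proof.
have -> : rho_inf d L * \prod_i theta_sq R (k i) = \prod_(i < d) (L^-1 * theta_sq R (k i)).
  by rewrite big_split /= prodr_const card_ord /rho_inf exprVn.
rewrite normr_prod; apply: ler_prod => i _; rewrite normr_ge0 /= /ker1 big_seq1.
have m0 := ltW (theta_sq_gt0 R (k i)); have l0 : 0 <= L^-1 by rewrite invr_ge0 ltW.
rewrite !normrM (ger0_norm l0) (ger0_norm m0) ler_wpM2l// ler_piMr//.
exact: cos_max.
Qed.

End torus_kernel.

(** * Spectral projections and the quartic entropy *)

Section lincomb.
Context dT (T : measurableType dT) (R : realType).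
Variable mu : {finite_measure set T -> \bar R}.

Fixpoint lincomb (s : seq (R * (T -> R))) (x : T) : R :=
  if s is (c, F) :: s' then c * F x + lincomb s' x else 0.

(** Integrates an explicit linear combination in one step; the integrability
   of its terms is collected into a right-nested conjunction. *)
Lemma int_lincomb s : foldr (fun cF P => intg mu cF.2 /\ P) True s ->
  intg mu (lincomb s) /\
  \int[mu]_x lincomb s x = foldr (fun cF a => cF.1 * (\int[mu]_x cF.2 x) + a) 0 s.
Proof.
elim: s => [_|[c F] s IH [iF /IH ise]] /=; last have [iS es] := ise.
  by split; [exact/bmeas_intg/bmeas_cst | rewrite Rintegral_cst// mul0r].
split; first by apply: intgD => //; exact: intgZ.
by rewrite intD ?intZ ?es//; exact: intgZ.
Qed.

End lincomb.

Section projections.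
Variables (R : realType) (L : R) (d : nat).
Hypothesis L0 : 0 < L.

Local Notation T := (points R d).
Local Notation mu := (torus_measure L d).

Definition proj (S : 'I_d -> seq nat) (f : T -> R) (x : T) : R :=
  \int[mu]_y (kern L S (vec x - vec y) * f y).

Lemma proj_bmeas S f : intg mu f -> bmeas (proj S f).
Proof.
exact: (kernel_bmeas (K := fun x y : T => kern L S (vec x - vec y)) (kern_bmeas L S)).
Qed.

Lemma proj_adj S f g : intg mu f -> intg mu g ->
  \int[mu]_x (g x * proj S f x) = \int[mu]_x (f x * proj S g x).
Proof.
move=> If Ig; rewrite (kernel_adj (K := fun x y : T => kern L S (vec x - vec y)) (kern_bmeas L S) Ig If).
by apply: int_eq => x; congr (_ * _); apply: int_eq => y; congr (_ * _); exact: kern_sym.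
Qed.

(** proj S' f is an average of translates of the kernel of S', so by Fubini a
   reproduction property of these translates passes to it. *)
Lemma proj_reproduce S S' f (h : T -> R) x : intg mu f -> bmeas h ->
  (forall y, \int[mu]_z (kern L S (vec x - vec z) * (h z * kern L S' (vec z - vec y))) =
     h x * kern L S' (vec x - vec y)) ->
  proj S (fun z => h z * proj S' f z) x = h x * proj S' f x.
Proof.
move=> If bh hE.
have bk := kern_bmeas1 L S x.
transitivity (\int[mu]_z ((kern L S (vec x - vec z) * h z) * proj S' f z)).
  by apply: int_eq => z; rewrite mulrA.
rewrite (kernel_adj (K := fun x y : T => kern L S' (vec x - vec y)) (kern_bmeas L S') _ If); last first.
  by apply: bmeas_intg; exact: bmeasM.
transitivity (\int[mu]_y (h x * (kern L S' (vec x - vec y) * f y))).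
  apply: int_eq => y; rewrite [RHS]mulrA -hE mulrC; congr (_ * _).
  by apply: int_eq => z; ring.
by rewrite intZ//; apply: intgM => //; exact: kern_bmeas1.
Qed.

Lemma proj_comp S S' f x : (forall i, uniq (S i)) ->
  (forall i, {subset S' i <= S i}) -> intg mu f ->
  proj S (proj S' f) x = proj S' f x.
Proof.
move=> uS sS If; have := @proj_reproduce S S' f (fun=> 1) x If (bmeas_cst T 1).
under eq_fun do rewrite mul1r; rewrite mul1r; apply => y; rewrite mul1r.
by under eq_Rintegral do rewrite mul1r; exact: kern_comp.
Qed.

(** The projection is symmetric and idempotent. *)
Lemma proj_sqr S f : (forall i, uniq (S i)) -> intg mu f ->
  \int[mu]_x (proj S f x ^+ 2) = \int[mu]_x (f x * proj S f x).
Proof.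
move=> uS If; have bp := proj_bmeas S If.
transitivity (\int[mu]_x (proj S f x * proj S f x)).
  by apply: int_eq => x; rewrite expr2.
rewrite (proj_adj S If (bmeas_intg mu bp)).
by apply: int_eq => x; rewrite proj_comp// => i s.
Qed.

(** The reproduction property for a product of two translated kernels,
   averaged once for each factor; three times for the cube below. *)
Lemma proj_modes2_sqr k f x : intg mu f ->
  proj (modes2 k) (fun z => proj (modes1 k) f z ^+ 2) x = proj (modes1 k) f x ^+ 2.
Proof.
move=> If; have bp := proj_bmeas (modes1 k) If.
under eq_fun do rewrite expr2; rewrite expr2.
apply: proj_reproduce => // y.
transitivity (proj (modes2 k) (fun z => kern L (modes1 k) (vec z - vec y) * proj (modes1 k) f z) x).
  by apply: int_eq => z; congr (_ * _); rewrite mulrC.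
rewrite proj_reproduce// 1?mulrC//; first exact: kern_bmeas2.
by move=> y'; exact: kern_modes2_reproduce.
Qed.

Lemma proj_modes3_cube k f x : intg mu f ->
  proj (modes3 k) (fun z => proj (modes1 k) f z ^+ 3) x = proj (modes1 k) f x ^+ 3.
Proof.
move=> If; have bp := proj_bmeas (modes1 k) If.
have bK y : bmeas (fun z : T => kern L (modes1 k) (vec z - vec y)) by exact: kern_bmeas2.
under eq_fun do rewrite exprSr; rewrite exprSr.
apply: proj_reproduce => //; first exact: bmeasX.
move=> y.
transitivity (proj (modes3 k) (fun z =>
  (kern L (modes1 k) (vec z - vec y) * proj (modes1 k) f z) * proj (modes1 k) f z) x).
  by apply: int_eq => z; congr (_ * _); ring.
rewrite proj_reproduce//; first by ring.
  exact: bmeasM.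
move=> y'.
transitivity (proj (modes3 k) (fun z =>
  (kern L (modes1 k) (vec z - vec y) * kern L (modes1 k) (vec z - vec y')) *
  proj (modes1 k) f z) x).
  by apply: int_eq => z; congr (_ * _); ring.
rewrite proj_reproduce//; first by ring.
  exact: bmeasM.
by move=> y''; exact: kern_modes3_reproduce.
Qed.

Lemma proj_one S x : (forall i, uniq (S i)) ->
  proj S (fun=> 1) x = \prod_i (0%N \in S i)%:R.
Proof.
move=> uS; rewrite -(kern_int L0 x uS); apply: int_eq => z; exact: mulr1.
Qed.

Lemma proj_int S f : (forall i, uniq (S i)) -> intg mu f ->
  \int[mu]_x proj S f x = (\prod_i (0%N \in S i)%:R) * \int[mu]_x f x.
Proof.
move=> uS If; transitivity (\int[mu]_x (1 * proj S f x)).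
  by apply: int_eq => x; rewrite mul1r.
rewrite proj_adj//; last exact/bmeas_intg/bmeas_cst.
by rewrite -intZ//; apply: int_eq => x; rewrite proj_one// mulrC.
Qed.

Lemma prod_mem_eq0 (S : 'I_d -> seq nat) (m : 'I_d -> nat) i : m i \notin S i ->
  \prod_i (m i \in S i)%:R = 0 :> R.
Proof. by move=> /negbTE mi; rewrite (bigD1 i)//= mi mul0r. Qed.

Lemma prod_mem_eq1 (S : 'I_d -> seq nat) (m : 'I_d -> nat) :
  (forall i, m i \in S i) -> \prod_i (m i \in S i)%:R = 1 :> R.
Proof. by move=> mS; rewrite big1// => i _; rewrite mS. Qed.

End projections.

Section quartic_inequalities.
Variable R : realType.

(** The difference of the two sides is 2/3 (u - v)^2 (u + 2 v)^2. The
   remainder (u - v)^4 / 3 is what makes the gap of the final inequality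
   quantitative. *)
Lemma quartic_tangent (u v : R) :
  v ^+ 4 + 4 * v ^+ 3 * (u - v) + 3^-1 * (u - v) ^+ 4 <= u ^+ 4.
Proof.
rewrite -subr_ge0.
have -> : u ^+ 4 - (v ^+ 4 + 4 * v ^+ 3 * (u - v) + 3^-1 * (u - v) ^+ 4) =
  (u - v) ^+ 2 * (2 / 3) * (u + 2 * v) ^+ 2 by field.
by rewrite mulr_ge0 ?sqr_ge0// mulr_ge0 ?sqr_ge0// divr_ge0.
Qed.

Lemma quartic_sum (u v : R) : (u - v) ^+ 4 <= 8 * u ^+ 4 + 8 * v ^+ 4.
Proof.
rewrite -subr_ge0.
have -> : 8 * u ^+ 4 + 8 * v ^+ 4 - (u - v) ^+ 4 =
  (u + v) ^+ 2 * (2 * u ^+ 2 + 2 * v ^+ 2 + (u - v) ^+ 2) + 4 * (u ^+ 2 - v ^+ 2) ^+ 2 by ring.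
have h (w : R) : 0 <= w ^+ 2 by exact: sqr_ge0.
apply: addr_ge0; last exact: mulr_ge0.
by apply: mulr_ge0 => //; rewrite addr_ge0// addr_ge0// mulr_ge0.
Qed.

End quartic_inequalities.

Section uniform_density.
Variables (R : realType) (L : R) (d : nat).
Hypothesis L0 : 0 < L.

Local Notation mu := (torus_measure L d).
Local Notation r := (rho_inf d L).

Lemma rho_inf_gt0 : 0 < r.
Proof. by rewrite /rho_inf invr_gt0 exprn_gt0. Qed.

Lemma rho_inf_mass : r * L ^+ d = 1.
Proof. by rewrite /rho_inf mulVf// gt_eqF// exprn_gt0. Qed.

Lemma rho_inf_pow_mass n : r ^+ n.+1 * L ^+ d = r ^+ n.
Proof. by rewrite exprSr -mulrA rho_inf_mass mulr1. Qed.

Lemma int_cst c : \int[mu]_x c = c * L ^+ d.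
Proof.
transitivity (\int[mu]_x (c * 1)); first by apply: int_eq => x; rewrite mulr1.
by rewrite intZ ?torus_mass//; exact/bmeas_intg/bmeas_cst.
Qed.

End uniform_density.

Section quartic.
Variables (R : realType) (L : R) (d : nat).
Hypothesis L0 : 0 < L.

Local Notation T := (points R d).
Local Notation mu := (torus_measure L d).
Local Notation r := (rho_inf d L).

Variables (k : 'I_d -> nat) (f : T -> R).
Hypotheses (k0 : exists i, k i != 0%N) (If : intg mu f) (f1 : \int[mu]_x f x = 1).
Hypotheses (f0 : forall x, 0 <= f x) (If4 : intg mu (fun x => f x ^+ 4)).

Local Notation p := (proj L (modes1 k) f).
Let q2 x := proj L (modes2 k) f x - r.
Let q3 x := proj L (modes3 k) f x - p x.

Let bp : bmeas p. Proof. exact: proj_bmeas. Qed.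

Lemma int_p : \int[mu]_x p x = 0.
Proof.
have [i ki] := k0; rewrite proj_int//.
by rewrite (prod_mem_eq0 R (m := fun=> 0%N) (i := i)) ?mul0r// inE eq_sym.
Qed.

(** The cube only has frequencies in {k} u P3, none of which is zero. *)
Lemma int_p3 : \int[mu]_x (p x ^+ 3) = 0.
Proof.
have [i ki] := k0.
transitivity (\int[mu]_x proj L (modes3 k) (fun z => p z ^+ 3) x).
  by apply: int_eq => x; rewrite proj_modes3_cube.
rewrite proj_int//; last 2 first.
- exact: modes3_uniq.
- exact/bmeas_intg/bmeasX.
by rewrite (prod_mem_eq0 R (m := fun=> 0%N) (i := i)) ?mul0r// zero_freq3.
Qed.

Let i_f2 h : bmeas h -> intg mu (fun x => h x * f x).
Proof. by move=> bh; exact: intgM. Qed.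

Let bP S : bmeas (proj L S f). Proof. exact: proj_bmeas. Qed.

Let bq2 : bmeas q2. Proof. by apply: bmeasB => //; exact: bmeas_cst. Qed.
Let bq3 : bmeas q3. Proof. exact: bmeasB. Qed.

(** Pythagoras: r is the projection of f onto the constants, which are among
   the frequencies of modes2. *)
Lemma int_even_sqr : \int[mu]_x (q2 x ^+ 2) = \int[mu]_x (f x * proj L (modes2 k) f x) - r.
Proof.
have [_ e] := @int_lincomb _ _ _ mu [:: (1, fun x => proj L (modes2 k) f x ^+ 2);
   (- (2 * r), proj L (modes2 k) f); (r ^+ 2, fun=> 1)]
   (conj (bmeas_intg _ (bmeasX 2 (bP (modes2 k)))) (conj (bmeas_intg _ (bP (modes2 k)))
     (conj (bmeas_intg _ (bmeas_cst T 1)) I))).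
transitivity (\int[mu]_x lincomb [:: (1, fun x => proj L (modes2 k) f x ^+ 2);
   (- (2 * r), proj L (modes2 k) f); (r ^+ 2, fun=> 1)] x).
  by apply: int_eq => x /=; rewrite /q2; ring.
rewrite e /= proj_sqr//; last exact: modes2_uniq.
rewrite proj_int//; last exact: modes2_uniq.
rewrite (prod_mem_eq1 R (m := fun=> 0%N)) => [|i]; last exact: zero_freq2.
by rewrite f1 torus_mass// -[r ^+ 2 * _]mulrA rho_inf_mass//; ring.
Qed.

(** Pythagoras again: p is the projection of proj L (modes3 k) f onto the
   frequency k. *)
Lemma int_odd_sqr : \int[mu]_x (q3 x ^+ 2) =
  \int[mu]_x (f x * proj L (modes3 k) f x) - \int[mu]_x (f x * p x).
Proof.
have ifP S : intg mu (fun x => f x * proj L S f x).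
  by under eq_fun do rewrite mulrC; exact: i_f2.
have [_ e] := @int_lincomb _ _ _ mu [:: (1, fun x => proj L (modes3 k) f x ^+ 2);
   (- 2, fun x => p x * proj L (modes3 k) f x); (1, fun x => p x ^+ 2)]
   (conj (bmeas_intg _ (bmeasX 2 (bP (modes3 k)))) (conj (bmeas_intg _ (bmeasM bp (bP (modes3 k))))
     (conj (bmeas_intg _ (bmeasX 2 bp)) I))).
transitivity (\int[mu]_x lincomb [:: (1, fun x => proj L (modes3 k) f x ^+ 2);
   (- 2, fun x => p x * proj L (modes3 k) f x); (1, fun x => p x ^+ 2)] x).
  by apply: int_eq => x /=; rewrite /q3; ring.
rewrite e /= !proj_sqr//; last exact: modes3_uniq.
rewrite proj_adj//; last exact: bmeas_intg.
have -> : \int[mu]_x (f x * proj L (modes3 k) p x) = \int[mu]_x (f x * p x).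
  apply: int_eq => x; congr (_ * _); apply: proj_comp => //; first exact: modes3_uniq.
  by move=> i s; rewrite inE => /eqP ->; exact: self_freq3.
have alg (u v : R) : 1 * u + (- 2 * v + (1 * v + 0)) = u - v by ring.
exact: alg.
Qed.

(** p^2 is reproduced by modes2, so it sees f only through r + q2; likewise
   p^3 sees f only through p + q3. *)
Lemma int_p2f : \int[mu]_x (p x ^+ 2 * f x) =
  r * \int[mu]_x (f x * p x) + \int[mu]_x (p x ^+ 2 * q2 x).
Proof.
have bp2 := bmeasX 2 bp.
have -> : \int[mu]_x (p x ^+ 2 * q2 x) =
    \int[mu]_x (p x ^+ 2 * proj L (modes2 k) f x) - r * \int[mu]_x (p x ^+ 2).
  rewrite -intZ; last exact: bmeas_intg.
  rewrite -intB; last 2 first.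
  - exact/bmeas_intg/bmeasM.
  - exact/intgZ/bmeas_intg.
  by apply: int_eq => x; rewrite /q2; ring.
rewrite proj_adj//; last exact: bmeas_intg.
rewrite proj_sqr// addrC subrK; apply: int_eq => x.
by rewrite proj_modes2_sqr// mulrC.
Qed.

Lemma int_p3f : \int[mu]_x (p x ^+ 3 * f x) =
  \int[mu]_x (p x ^+ 4) + \int[mu]_x (p x ^+ 3 * q3 x).
Proof.
have bp3 := bmeasX 3 bp.
have -> : \int[mu]_x (p x ^+ 3 * q3 x) =
    \int[mu]_x (p x ^+ 3 * proj L (modes3 k) f x) - \int[mu]_x (p x ^+ 4).
  rewrite -intB; last 2 first.
  - exact/bmeas_intg/bmeasM.
  - exact/bmeas_intg/bmeasX.
  by apply: int_eq => x; rewrite /q3; ring.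
rewrite proj_adj//; last exact: bmeas_intg.
rewrite addrC subrK; apply: int_eq => x.
by rewrite proj_modes3_cube// mulrC.
Qed.

Lemma intg_quartic_diff h : bmeas h -> intg mu (fun x => (f x - h x) ^+ 4).
Proof.
move=> bh; have mf := intg_meas If.
apply: (@intg_le _ _ _ _ _ (fun x => 8 * f x ^+ 4 + 8 * h x ^+ 4)).
- by apply: measurable_funX; apply: measurable_funB => //; case: bh.
- move=> x; rewrite ger0_norm ?exprn_even_ge0//; exact: quartic_sum.
- by apply: intgD; apply: intgZ => //; exact/bmeas_intg/bmeasX.
Qed.

(** The tangent inequality at v = r + p, integrated; the powers of p are
   expanded and the terms evaluated by the preceding lemmas. *)
Lemma quartic_lower :
  r ^+ 3 + 6 * r ^+ 2 * (\int[mu]_x (f x * p x))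
   + 12 * r * (\int[mu]_x (p x ^+ 2 * q2 x)) + \int[mu]_x (p x ^+ 4)
   + 4 * (\int[mu]_x (p x ^+ 3 * q3 x))
   + 3^-1 * (\int[mu]_x ((f x - (r + p x)) ^+ 4)) <= \int[mu]_x (f x ^+ 4).
Proof.
have bX n := bmeasX n bp.
have iX n : intg mu (fun x => p x ^+ n) by exact: bmeas_intg.
have iXf n : intg mu (fun x => p x ^+ n * f x) by exact: i_f2.
have iD : intg mu (fun x => (f x - (r + p x)) ^+ 4).
  by apply: intg_quartic_diff; apply: bmeasD => //; exact: bmeas_cst.
pose s : seq (R * (T -> R)) := [:: (4 * r ^+ 3, f); (12 * r ^+ 2, fun x => p x ^+ 1 * f x);
  (12 * r, fun x => p x ^+ 2 * f x); (4, fun x => p x ^+ 3 * f x);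
  (- (3 * r ^+ 4), fun x => p x ^+ 0); (- (12 * r ^+ 3), fun x => p x ^+ 1);
  (- (18 * r ^+ 2), fun x => p x ^+ 2); (- (12 * r), fun x => p x ^+ 3);
  (- 3, fun x => p x ^+ 4); (3^-1, fun x => (f x - (r + p x)) ^+ 4)].
have [iS es] := @int_lincomb _ _ _ mu s (conj If (conj (iXf 1) (conj (iXf 2) (conj (iXf 3)
  (conj (iX 0) (conj (iX 1) (conj (iX 2) (conj (iX 3) (conj (iX 4) (conj iD I)))))))))).
have le : \int[mu]_x lincomb s x <= \int[mu]_x (f x ^+ 4).
  apply: int_le => // x; apply: le_trans (quartic_tangent (f x) (r + p x)).
  by rewrite /s /= le_eqVlt; apply/orP; left; apply/eqP; ring.
apply: le_trans le; rewrite es /s /=.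
have e1 : \int[mu]_x (p x ^+ 1 * f x) = \int[mu]_x (f x * p x).
  by apply: int_eq => x; rewrite expr1 mulrC.
have e2 : \int[mu]_x (p x ^+ 0) = L ^+ d.
  by rewrite -torus_mass//; apply: int_eq => x.
have e3 : \int[mu]_x (p x ^+ 1) = 0.
  by rewrite -int_p; apply: int_eq => x.
rewrite f1 e1 e2 e3 int_p3 int_p2f int_p3f proj_sqr//.
have e4 : r ^+ 4 * L ^+ d = r ^+ 3 by exact: rho_inf_pow_mass.
have e5 : 3 * r ^+ 4 * L ^+ d = 3 * r ^+ 3 by rewrite -mulrA e4.
rewrite mulNr e5; lra.
Qed.

End quartic.

(** * Fejer kernels *)

Section fejer.
Variables (R : realType) (L : R).
Hypothesis L0 : 0 < L.

Local Notation circle := (circle_measure L).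
Local Notation RM := (measurableTypeR R).

Definition fejer_weight (n m : nat) : R := (n - m)%N%:R / n%:R.

Definition fejer_sum (n : nat) (t : R) : R :=
  \sum_(m < n) (n - m)%N%:R * theta_sq R m * cos (m%:R * t).

(** The right-hand side is the squared modulus of the sum of exp(i j t) for j
   < n, whence the positivity of the Fejer kernel. *)
Lemma fejer_sum_sqr n t : fejer_sum n t =
  (\sum_(j < n) cos (j%:R * t)) ^+ 2 + (\sum_(j < n) sin (j%:R * t)) ^+ 2.
Proof.
rewrite /fejer_sum; elim: n => [|n IH]; first by rewrite !big_ord0; ring.
have -> : \sum_(m < n.+1) (n.+1 - m)%N%:R * theta_sq R m * cos (m%:R * t) =
    \sum_(m < n) (n - m)%N%:R * theta_sq R m * cos (m%:R * t) +
    \sum_(m < n.+1) theta_sq R m * cos (m%:R * t).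
  rewrite [in RHS]big_ord_recr [LHS]big_ord_recr /= subSnn addrA mul1r -big_split /=.
  by congr (_ + _); apply: eq_bigr => i _; rewrite subSn ?(ltnW (ltn_ord i))// -natr1; ring.
rewrite IH !big_ord_recr /=.
set c := \sum_(j < n) cos _; set s := \sum_(j < n) sin _.
suff -> : \sum_(m < n) theta_sq R m * cos (m%:R * t) + theta_sq R n * cos (n%:R * t) =
    1 + 2 * (cos (n%:R * t) * c + sin (n%:R * t) * s).
  have -> : (c + cos (n%:R * t)) ^+ 2 + (s + sin (n%:R * t)) ^+ 2 =
     c ^+ 2 + s ^+ 2 + (cos (n%:R * t) ^+ 2 + sin (n%:R * t) ^+ 2)
     + 2 * (cos (n%:R * t) * c + sin (n%:R * t) * s) by ring.
  by rewrite cos2Dsin2; ring.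
transitivity (\sum_(m < n.+1) theta_sq R m * cos (m%:R * t)); first by rewrite big_ord_recr.
rewrite big_ord_recl /= mul0r cos0 {1}/theta_sq eqxx /=.
have -> : cos (n%:R * t) * c + sin (n%:R * t) * s = \sum_(i < n) cos (i.+1%:R * t).
  rewrite /c /s !big_distrr -big_split /= (reindex_inj rev_ord_inj) /=.
  apply: eq_bigr => i _; rewrite -cosB -mulrBl; congr (cos (_ * _)).
  by rewrite -natrB ?leq_subr// subKn.
rewrite big_distrr /=; congr (_ + _); first by ring.
by apply: eq_bigr => i _; rewrite /theta_sq /bump /= add1n subr0.
Qed.

(** The Fejer kernel symmetrised in y, which suffices for even functions: an
   expansion in cosn m z * cosn m y involves cosine coefficients alone. *)
Definition fejer (n : nat) (z y : R) : R :=
  \sum_(m < n) fejer_weight n m * (theta_sq R m / L) * (cosn L m z * cosn L m y).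

(** Product-to-sum writes it as the average of the usual Fejer kernel at z + y
   and at z - y. *)
Lemma fejer_ge0 n z y : 0 <= fejer n z y.
Proof.
have -> : fejer n z y = (n%:R^-1 * L^-1 * 2^-1) *
    (fejer_sum n (phase L z + phase L y) + fejer_sum n (phase L z - phase L y)).
  rewrite /fejer_sum -big_split big_distrr /=; apply: eq_bigr => m _.
  by rewrite /fejer_weight /cosn cos_cos -mulrDr -mulrBr; ring.
apply: mulr_ge0; first by rewrite mulr_ge0// mulr_ge0 ?invr_ge0// ltW.
by rewrite !fejer_sum_sqr; apply: addr_ge0; apply: addr_ge0; exact: sqr_ge0.
Qed.

Lemma fejer_bmeas n z : bmeas (fejer n z : RM -> R).
Proof.
apply: bmeas_sum => m; apply: bmeasM; first exact: bmeas_cst.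
by apply: bmeasM; [exact: bmeas_cst | exact: cosn_bmeas].
Qed.

Lemma fejer_eigen n k x w : (0 < n)%N ->
  \int[circle]_y (fejer n (x - y) w * cosn L k y) =
  fejer_weight n k * (cosn L k x * cosn L k w).
Proof.
move=> n0.
have bt m : bmeas (fun y : RM => cosn L m (x - y) * cosn L k y).
  by apply: bmeasM; [exact: cosn_shift_bmeas | exact: cosn_bmeas].
pose F (m : 'I_n) (y : RM) := (fejer_weight n m * (theta_sq R m / L) * cosn L m w) *
   (cosn L m (x - y) * cosn L k y).
have alg (a b c e : R) : a * (b * c) * e = (a * c) * (b * e) by ring.
have [_ e] := @int_sum _ _ _ circle _ (index_enum 'I_n) xpredT F
  (fun m => intgZ _ (bmeas_intg circle (bt m))).
transitivity (\int[circle]_y (\sum_(m < n) F m y)).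
  by apply: int_eq => y; rewrite /fejer big_distrl; apply: eq_bigr => m _; exact: alg.
rewrite e.
have rep m : \int[circle]_y (cosn L m (x - y) * cosn L k y) =
    (m == k)%:R * (L / theta_sq R m) * cosn L k x.
  have := cosn_reproduce L0 m k x 0; rewrite addr0 => <-.
  by apply: int_eq => y; rewrite addr0.
have nR : n%:R != 0 :> R by rewrite pnatr_eq0 -lt0n.
have LR : L != 0 by rewrite gt_eqF.
rewrite (eq_bigr (fun m : 'I_n => if (m : nat) == k then
    fejer_weight n k * (cosn L k x * cosn L k w) else 0)); last first.
  move=> m _; rewrite /F intZ ?rep//; last exact: bmeas_intg.
  case: eqP => [->|_]; last by rewrite !mul0r mulr0.
  have m0 : theta_sq R k != 0 by rewrite lt0r_neq0// theta_sq_gt0.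
  by rewrite mul1r; field; rewrite m0 LR.
rewrite -big_mkcond /=; have [kn|nk] := ltnP k n.
  by rewrite (big_pred1 (Ordinal kn)).
rewrite big_pred0; last by move=> m; apply/eqP => mk; have := ltn_ord m; rewrite mk ltnNge nk.
have -> : fejer_weight n k = 0 by rewrite /fejer_weight (_ : (n - k)%N = 0%N) ?mul0r//; lia.
by rewrite mul0r.
Qed.

Lemma fejer_coef n k z : (0 < n)%N ->
  \int[circle]_y (fejer n z y * cosn L k y) = fejer_weight n k * cosn L k z.
Proof.
move=> n0; have := fejer_eigen k 0 z n0; rewrite cosn0 mul1r => <-.
apply: int_eq => y; congr (_ * _); apply: eq_bigr => m _.
by rewrite sub0r cosnN; congr (_ * _); rewrite mulrC.
Qed.

Lemma fejer_mass n z : (0 < n)%N -> \int[circle]_y (fejer n z y) = 1.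
Proof.
move=> n0; have := fejer_coef 0 z n0.
rewrite /fejer_weight subn0 divff ?pnatr_eq0 -?lt0n// mul1r /cosn mul0r cos0 => <-.
by apply: int_eq => y; rewrite mul0r cos0 mulr1.
Qed.

(** The kernel concentrates where cosn 1 takes the same value as at z; the
   weights at frequencies 0, 1, 2 give the variance explicitly. *)
Lemma fejer_variance n z : (1 < n)%N ->
  \int[circle]_y (fejer n z y * (cosn L 1 z - cosn L 1 y) ^+ 2) = n%:R^-1.
Proof.
move=> n1; have n0 := ltnW n1.
have bF k := bmeasM (fejer_bmeas n z) (cosn_bmeas L k).
have iF k := bmeas_intg circle (bF k).
have dbl y : cosn L 2 y = 2 * cosn L 1 y ^+ 2 - 1.
  by rewrite /cosn mul1r mulr_natl cos_mulr2n -[in LHS]mulr_natl.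
pose s : seq (R * (RM -> R)) := [:: (cosn L 1 z ^+ 2 + 2^-1, fun y => fejer n z y * cosn L 0 y);
  (- (2 * cosn L 1 z), fun y => fejer n z y * cosn L 1 y); (2^-1, fun y => fejer n z y * cosn L 2 y)].
have [_ e] := @int_lincomb _ _ _ circle s (conj (iF 0) (conj (iF 1) (conj (iF 2) I))).
transitivity (\int[circle]_y lincomb s y).
  apply: int_eq => y; rewrite /s /= dbl.
  have -> : cosn L 0 y = 1 by rewrite /cosn mul0r cos0.
  by field.
rewrite e /s /= !fejer_coef// dbl /fejer_weight subn0.
have -> : cosn L 0 z = 1 by rewrite /cosn mul0r cos0.
have nR : n%:R != 0 :> R by rewrite pnatr_eq0 -lt0n.
by rewrite !natrB//; field.
Qed.

End fejer.

(** * Symmetric periodic functions *)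

Section symmetric.
Variables (R : realType) (L : R) (d : nat).
Hypothesis L0 : 0 < L.

(** Invariance under the group generated by all coordinate reflections and
   translations by L, acting on all coordinates at once. *)
Definition reflection_periodic (V : 'rV[R]_d -> R) :=
  forall y y' : 'rV[R]_d,
    (forall i, exists s : bool, exists m : int, y' 0 i = (-1) ^+ s * y 0 i + L * m%:~R) ->
    V y' = V y.

Lemma torus_periodic_int (V : 'rV[R]_d -> R) i (m : int) x : torus_periodic L V ->
  V (x + (L * m%:~R) *: basis_vec R i) = V x.
Proof.
move=> pV; have H n z : V (z + (L * n%:R) *: basis_vec R i) = V z.
  elim: n z => [|n IH] z; first by rewrite mulr0 scale0r addr0.
  by rewrite -[n.+1%:R]natr1 mulrDr mulr1 scalerDl addrA pV IH.
case: m => n; first exact: H.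
rewrite NegzE mulrNz mulrN scaleNr.
by rewrite -[LHS](H n.+1) subrK.
Qed.

(** Change the coordinates one at a time, from the first to the last. *)
Lemma symmetric_reflection_periodic (V : 'rV[R]_d -> R) : torus_periodic L V -> coord_even V ->
  reflection_periodic V.
Proof.
move=> pV eV y y' yy'.
pose h n : 'rV[R]_d := \row_i (if (i < n)%N then y' 0 i else y 0 i).
have hn n : (n <= d)%N -> V (h n) = V y.
  elim: n => [_|n IH nd].
    by congr V; apply/rowP => i; rewrite !mxE.
  rewrite -IH ?(ltnW nd)//; pose i0 := Ordinal nd.
  have [s [m e]] := yy' i0.
  pose w : 'rV[R]_d := if s then \row_j (if j == i0 then - h n 0 j else h n 0 j) else h n.
  have -> : h n.+1 = w + (L * m%:~R) *: basis_vec R i0.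
    apply/rowP => j; rewrite !mxE /=.
    have [ji|ji] := eqVneq j i0.
      rewrite ji /= ltnSn mulr1 e /w; case: (s); rewrite !mxE ?eqxx ?mxE /= ltnn.
        by rewrite mulN1r.
      by rewrite mul1r.
    have -> : (j < n.+1)%N = (j < n)%N.
      by rewrite ltnS leq_eqVlt (_ : (j == n :> nat) = false)//; apply/negbTE.
    by rewrite mulr0 addr0 /w; case: (s); rewrite !mxE ?(negbTE ji) ?mxE.
  rewrite torus_periodic_int// /w; case: (s) => //; exact: eV.
rewrite -(hn d)//; congr V; apply/rowP => i; by rewrite mxE ltn_ord.
Qed.

Lemma reflection_periodic_bounded (V : 'rV[R]_d -> R) : continuous V -> reflection_periodic V ->
  exists B, forall z, `|V z| <= B.
Proof.
move=> cV pV.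
pose box : set 'rV[R]_d := [set v | forall i, `[0, L]%classic (v 0 i)].
have cbox : compact box.
  by apply: (@rV_compact R d (fun=> `[0, L]%classic)) => i; exact: segment_compact.
have : compact (V @` box).
  by apply: continuous_compact => //; exact: continuous_subspaceT.
move=> /compact_bounded [M [_ MV]]; exists (M + 1) => z.
pose z' : 'rV[R]_d := \row_i (z 0 i - L * (Num.floor (z 0 i / L))%:~R).
have -> : V z = V z'.
  apply/esym/pV => i; exists false, (- Num.floor (z 0 i / L)).
  by rewrite mxE mul1r mulrNz mulrN.
apply: (MV (M + 1)); first by rewrite ltrDl.
exists z' => // i; rewrite /= in_itv /= mxE.
have /andP[h1 h2] := floor_itv (z 0 i / L).
rewrite ler_pdivlMr// in h1; rewrite ltr_pdivrMr// in h2.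
rewrite subr_ge0 mulrC h1 /= lerBlDl ltW// (lt_le_trans h2)//.
by rewrite intrD mulrDl mul1r mulrC.
Qed.

(** The cosine of the phase is a monotone function of the distance to the
   nearest multiple of L. *)
Lemma phase_near (t e : R) : 0 < e -> e <= L / 2 ->
  1 - cos (phase L t) < 1 - cos (phase L e) -> exists m : int, `|t - L * m%:~R| < e.
Proof.
move=> e0 eL ct; pose m := Num.floor (t / L + 2^-1); exists m.
set u := t - L * m%:~R.
have uL : `|u| <= L / 2.
  have /andP[h1 h2] := floor_itv (t / L + 2^-1); rewrite -/m intrD mulr1z in h1 h2.
  have tL : t = L * (t / L) by field; rewrite gt_eqF.
  rewrite ler_norml /u tL -mulrBr; apply/andP; split.
    rewrite -mulrN ler_pM2l//; lra.
  by rewrite ler_pM2l//; lra.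
have cu : cos (phase L `|u|) = cos (phase L t).
  have -> : phase L `|u| = `|phase L u|.
    by rewrite /phase normrM [X in _ = X * _]ger0_norm// divr_ge0 ?mulr_ge0 ?pi_ge0// ltW.
  rewrite cos_norm /u /phase mulrBr.
  have -> : 2 * pi / L * (L * m%:~R) = 2 * pi * m%:~R by field; rewrite gt_eqF.
  have sp := sin_int_period (- m) (2 * pi / L * t + pi / 2).
  rewrite -sinDpihalf -(sinDpihalf (2 * pi / L * t)) -sp; congr sin.
  by rewrite mulrNz mulrN; ring.
rewrite ltNge; apply/negP => eu.
have pL : 0 < pi / L by rewrite divr_gt0 ?pi_gt0.
have piE : phase L (L / 2) = pi by rewrite /phase; field; rewrite gt_eqF.
have mono (a b : R) : a <= b -> phase L a <= phase L b.
  by move=> ab; rewrite /phase ler_wpM2l// divr_ge0 ?mulr_ge0 ?pi_ge0// ltW.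
have ph0 : phase L 0 = 0 by rewrite /phase mulr0.
have itv a : 0 <= a -> a <= L / 2 -> phase L a \in `[0, pi].
  move=> a0 aL; rewrite in_itv /= -ph0 -piE; apply/andP.
  by split; exact: mono.
have : cos (phase L `|u|) <= cos (phase L e).
  have i1 := itv _ (ltW e0) eL; have i2 := itv _ (normr_ge0 u) uL.
  by rewrite leNgt (ltr_cos i2 i1) -leNgt mono.
by rewrite cu => h; move: ct; rewrite ltrD2l ltrN2 ltNge h.
Qed.

End symmetric.

(** * Uniform control by the first cosines *)

Section korovkin.
Variables (R : realType) (L : R) (d : nat).
Hypothesis L0 : 0 < L.

Variable V : 'rV[R]_d -> R.
Hypotheses (cV : continuous V) (sV : reflection_periodic L V).

(** V only depends on the cosines cosn 1 of the coordinates. If all of them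
   are close to those of z, then y is equivalent to a point near z and
   continuity applies; otherwise the sum is bounded below and the boundedness
   of V suffices. *)
Lemma korovkin_modulus z e : 0 < e -> exists2 C, 0 <= C &
  forall y, `|V y - V z| <= e + C * \sum_i (cosn L 1 (z 0 i) - cosn L 1 (y 0 i)) ^+ 2.
Proof.
move=> e0; have [B VB] := reflection_periodic_bounded L0 cV sV.
have /cvgrPdist_lt /(_ e e0) /nbhs_ballP [dl /= dl0 hdl] := cV (x := z).
pose de := Num.min dl (L / 2).
have de0 : 0 < de by rewrite lt_min dl0 divr_gt0.
have deL : de <= L / 2 by rewrite ge_min lexx orbT.
pose eta := 1 - cos (phase L de).
have eta0 : 0 < eta.
  have pd : 0 < phase L de.
    by rewrite /phase mulr_gt0// divr_gt0// mulr_gt0// pi_gt0.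
  have pp : phase L de <= pi.
    rewrite (_ : pi = phase L (L / 2)); first by rewrite /phase ler_wpM2l// divr_ge0 ?mulr_ge0 ?pi_ge0// ltW.
    by rewrite /phase; field; rewrite gt_eqF.
  rewrite subr_gt0 -(@cos0 R) ltr_cos// in_itv /= ?lexx ?pi_ge0// ltW//.
have B0 : 0 <= B by exact: le_trans (VB z).
have C0 : 0 <= 2 * B / eta ^+ 2.
  by apply: divr_ge0; [exact: mulr_ge0 | exact/exprn_ge0/ltW].
exists (2 * B / eta ^+ 2) => //.
move=> y.
have near1 i : (cosn L 1 (z 0 i) - cosn L 1 (y 0 i)) ^+ 2 < eta ^+ 2 ->
    exists t, [/\ `|z 0 i - t| < de & exists s : bool, exists m : int, t = (-1) ^+ s * y 0 i + L * m%:~R].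
  move=> h.
  (* The square is small only if y_i or - y_i is close to z_i modulo L. *)
  have hprod : (cosn L 1 (z 0 i) - cosn L 1 (y 0 i)) ^+ 2 =
     (1 - cos (phase L (z 0 i - y 0 i))) * (1 - cos (phase L (z 0 i - - y 0 i))).
    rewrite /cosn !mul1r !phaseB.
    have -> : phase L (- y 0 i) = - phase L (y 0 i) by rewrite /phase mulrN.
    rewrite opprK cosB cosD.
    have := cos2Dsin2 (phase L (z 0 i)); have := cos2Dsin2 (phase L (y 0 i)).
    set c := cos _; set s := sin _; set c' := cos _; set s' := sin _ => h1 h2.
    have -> : (1 - (c' * c + s' * s)) * (1 - (c' * c - s' * s)) =
      (1 - c' * c) ^+ 2 - s' ^+ 2 * s ^+ 2 by ring.
    have -> : s ^+ 2 = 1 - c ^+ 2 by rewrite -h1; ring.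
    have -> : s' ^+ 2 = 1 - c' ^+ 2 by rewrite -h2; ring.
    ring.
  have [h1|h1] := ltP (1 - cos (phase L (z 0 i - y 0 i))) eta.
    have [m hm] := phase_near L0 de0 deL h1.
    exists (y 0 i + L * m%:~R); split; first by rewrite opprD addrA.
    by exists false, m; rewrite mul1r.
  have [h2|h2] := ltP (1 - cos (phase L (z 0 i - - y 0 i))) eta.
    have [m hm] := phase_near L0 de0 deL h2.
    exists (- y 0 i + L * m%:~R); split; first by rewrite opprD addrA.
    by exists true, m; rewrite mulN1r.
  by move: h; rewrite hprod ltNge expr2 ler_pM// ltW.
have S0 : 0 <= \sum_i (cosn L 1 (z 0 i) - cosn L 1 (y 0 i)) ^+ 2.
  by apply: sumr_ge0 => i _; exact: sqr_ge0.
have [allnear|/existsNP[i /negP]] := pselect (forall i, (cosn L 1 (z 0 i) - cosn L 1 (y 0 i)) ^+ 2 < eta ^+ 2).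
  have [t ht] := choice (fun i => near1 i (allnear i)).
  pose y' : 'rV[R]_d := \row_i t i.
  have <- : V y' = V y.
    by apply: sV => i; rewrite mxE; case: (ht i).
  rewrite distrC; apply: (@le_trans _ _ e); last first.
    by rewrite lerDl mulr_ge0.
  apply/ltW/hdl; rewrite mx_norm_ball /ball_ /=.
  apply: rV_norm_lt => // i; rewrite !mxE.
  by case: (ht i) => h _; rewrite (lt_le_trans h)// ge_min lexx.
rewrite -leNgt => hi.
have : `|V y - V z| <= 2 * B.
  by rewrite (le_trans (ler_normB _ _))// mulrDl !mul1r lerD.
move=> /le_trans; apply; apply: ler_wpDl; first exact: ltW.
rewrite -[leLHS]mulr1 -!mulrA ler_wpM2l// ler_wpM2l//.
rewrite mulrC ler_pdivlMr ?exprn_gt0// mul1r (le_trans hi)//.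
rewrite (bigD1 i)//= lerDl; apply: sumr_ge0 => j _; exact: sqr_ge0.
Qed.

End korovkin.

(** * Fejer means of the potential *)

Lemma int_cvg dT (T : measurableType dT) (R : realType) (m : {measure set T -> \bar R})
    (fn : nat -> T -> R) (f g : T -> R) :
  (forall n, measurable_fun setT (fn n)) -> measurable_fun setT f ->
  (forall x, fn n x @[n --> \oo] --> f x) ->
  m.-integrable setT (EFin \o g) -> (forall n x, `|fn n x| <= g x) ->
  \int[m]_x fn n x @[n --> \oo] --> \int[m]_x f x.
Proof.
move=> mfn mf fnf ig fng.
have h x : (fn n x)%:E @[n --> \oo] --> (f x)%:E.
  by apply/fine_cvgP; split; [exact: nearW | exact: fnf].
have [i _ c] := @dominated_convergence _ T R m setT measurableT
  (fun n x => (fn n x)%:E) (EFin \o f) (EFin \o g)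
  (fun n => (measurable_EFinP _ _).2 (mfn n)) ((measurable_EFinP _ _).2 mf)
  (aeW _ (fun x _ => h x)) ig
  (aeW _ (fun x n _ => fng n x)).
apply: fine_cvg; rewrite fineK; last exact: integrable_fin_num.
exact: c.
Qed.

Section fejer_means.
Variables (R : realType) (L : R) (d : nat).
Hypothesis L0 : 0 < L.
Local Notation RM := (measurableTypeR R).
Local Notation T := (points R d).
Local Notation mu := (torus_measure L d).

Variable V : 'rV[R]_d -> R.
Hypotheses (cV : continuous V) (sV : reflection_periodic L V).

Definition coefv (m : 'I_d -> nat) : R := \int[mu]_y (V (vec y) * cosv L m (vec y)).

Lemma reflection_periodic_bmeas dT (T' : measurableType dT) (u : T' -> 'rV[R]_d) :
  (forall i, measurable_fun setT (fun x => u x 0 i)) -> bmeas (fun x => V (u x)).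
Proof.
move=> mu; split; first exact: continuous_vec_measurable.
by have [B VB] := reflection_periodic_bounded L0 cV sV; exists B.
Qed.

Lemma bmeas_vec : bmeas (fun x : T => V (vec x)).
Proof. by apply: reflection_periodic_bmeas => i; exact: coord_measurable. Qed.

Lemma bmeas_vec_diff : bmeas (fun z : T * T => V (vec z.1 - vec z.2)).
Proof. by apply: reflection_periodic_bmeas => i; exact: coord_diff_measurable. Qed.

Definition fejerv n (z y : 'rV[R]_d) : R := \prod_i fejer L n (z 0 i) (y 0 i).

(** Averaging V against fejerv n z yields a finite combination of products of
   cosines, with the coefficients of V multiplied by nonnegative weights. *)
Definition fejer_mean n z : R := \int[mu]_y (V (vec y) * fejerv n z (vec y)).

Lemma fejerv_ge0 n z y : 0 <= fejerv n z y.
Proof. by apply: prodr_ge0 => i _; exact: fejer_ge0. Qed.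

Lemma fejerv_bmeas n z : bmeas (fun y : T => fejerv n z (vec y)).
Proof.
apply: bmeas_prod => i; exact: (bmeas_comp (coord_measurable i) (fejer_bmeas L n (z 0 i))).
Qed.

Lemma fejerv_int n (z : 'rV[R]_d) (h h' : 'I_d -> RM -> R) : (forall i, bmeas (h i)) ->
  (forall i, \int[circle_measure L]_t (fejer L n (z 0 i) t * h i t) = h' i (z 0 i)) ->
  \int[mu]_y (fejerv n z (vec y) * \prod_i h i (tnth y i)) = \prod_i h' i (z 0 i).
Proof.
move=> bh hE.
transitivity (\int[mu]_y (\prod_i (fejer L n (z 0 i) (tnth y i) * h i (tnth y i)))).
  apply: int_eq => y; rewrite [RHS]big_split /=; congr (_ * _).
  by apply: eq_bigr => i _; rewrite mxE.
rewrite (torus_integral_prod L0 (g := fun i (t : RM) => fejer L n (z 0 i) t * h i t)).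
  by apply: eq_bigr => i _; exact: hE.
by move=> i; apply: bmeasM => //; exact: fejer_bmeas.
Qed.

Lemma fejerv_mass n z : (0 < n)%N -> \int[mu]_y fejerv n z (vec y) = 1.
Proof.
move=> n0; pose h (i : 'I_d) (t : RM) : R := 1.
transitivity (\int[mu]_y (fejerv n z (vec y) * \prod_i h i (tnth y i))).
  by apply: int_eq => y; rewrite big1 ?mulr1.
rewrite (@fejerv_int n z h h) ?big1// => i; first exact: bmeas_cst.
rewrite -[RHS](@fejer_mass R L L0 n (z 0 i) n0).
by apply: int_eq => t; rewrite mulr1.
Qed.

Lemma fejerv_variance n (z : 'rV[R]_d) i : (1 < n)%N ->
  \int[mu]_y (fejerv n z (vec y) * (cosn L 1 (z 0 i) - cosn L 1 (vec y 0 i)) ^+ 2) = n%:R^-1.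
Proof.
move=> n1; have n0 := ltnW n1.
pose h (j : 'I_d) (t : RM) : R := if j == i then (cosn L 1 (z 0 i) - cosn L 1 t) ^+ 2 else 1.
transitivity (\int[mu]_y (fejerv n z (vec y) * \prod_j h j (tnth y j))).
  apply: int_eq => y; congr (_ * _); rewrite (bigD1 i)//= /h eqxx big1 ?mulr1 ?mxE//.
  by move=> j /negbTE ->.
rewrite (@fejerv_int n z h (fun j => if j == i then cst n%:R^-1 else cst 1)).
- rewrite (bigD1 i)//= eqxx big1 ?mulr1// => j /negbTE ->//.
- move=> j; rewrite /h; case: eqP => _; last exact: bmeas_cst.
  by apply: bmeasX; apply: bmeasB; [exact: bmeas_cst | exact: cosn_bmeas].
- move=> j; rewrite /h; case: eqP => [->|_]; first exact: fejer_variance.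
  rewrite -[RHS](@fejer_mass R L L0 n (z 0 j) n0).
  by apply: int_eq => t; rewrite mulr1.
Qed.

Lemma fejer_mean_bound n z B : (0 < n)%N -> (forall y, `|V y| <= B) ->
  `|fejer_mean n z| <= B.
Proof.
move=> n0 VB; have bf := fejerv_bmeas n z.
have bm := bmeasM bmeas_vec bf.
rewrite (le_trans (int_norm (bmeas_intg mu bm)))//.
rewrite -[leRHS]mulr1 -(fejerv_mass z n0) -intZ; last exact: bmeas_intg.
apply: int_le.
- exact/intg_norm/bmeas_intg.
- exact/intgZ/bmeas_intg.
- by move=> y; rewrite normrM (ger0_norm (fejerv_ge0 _ _ _)) ler_wpM2r// fejerv_ge0.
Qed.

Lemma fejer_mean_dist n (z : 'rV[R]_d) e C : (1 < n)%N ->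
  (forall y, `|V y - V z| <= e + C * \sum_i (cosn L 1 (z 0 i) - cosn L 1 (y 0 i)) ^+ 2) ->
  `|fejer_mean n z - V z| <= e + C * (d%:R * n%:R^-1).
Proof.
move=> n1 VC; have n0 := ltnW n1; have bf := fejerv_bmeas n z.
have bd : bmeas (fun y : T => V (vec y) - V z).
  by apply: bmeasB; [exact: bmeas_vec | exact: bmeas_cst].
have bv i : bmeas (fun y : T => fejerv n z (vec y) * (cosn L 1 (z 0 i) - cosn L 1 (vec y 0 i)) ^+ 2).
  apply: bmeasM => //; apply: bmeasX; apply: bmeasB; first exact: bmeas_cst.
  exact: (bmeas_comp (coord_measurable i) (cosn_bmeas L 1)).
have -> : fejer_mean n z - V z = \int[mu]_y ((V (vec y) - V z) * fejerv n z (vec y)).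
  rewrite -[X in _ - X]mulr1 -(fejerv_mass z n0) -intZ; last exact: bmeas_intg.
  rewrite -intB; last 2 first.
  - by apply: bmeas_intg; apply: bmeasM => //; exact: bmeas_vec.
  - exact/intgZ/bmeas_intg.
  by apply: int_eq => y; rewrite mulrBl.
rewrite (le_trans (int_norm (bmeas_intg mu (bmeasM bd bf))))//.
have [i1 e1] := @int_sum _ _ _ mu _ (index_enum 'I_d) xpredT
  (fun i (y : T) => fejerv n z (vec y) * (cosn L 1 (z 0 i) - cosn L 1 (vec y 0 i)) ^+ 2)
  (fun i => bmeas_intg mu (bv i)).
have -> : e + C * (d%:R * n%:R^-1) = \int[mu]_y (e * fejerv n z (vec y) + C *
    \sum_i (fejerv n z (vec y) * (cosn L 1 (z 0 i) - cosn L 1 (vec y 0 i)) ^+ 2)).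
  rewrite intD; last 2 first.
  - exact/intgZ/bmeas_intg.
  - exact/intgZ.
  rewrite intZ; last exact: bmeas_intg.
  rewrite fejerv_mass// mulr1 intZ// e1 (eq_bigr (fun=> n%:R^-1)); last first.
    by move=> i _; exact: fejerv_variance.
  by rewrite sumr_const card_ord mulr_natl.
apply: int_le.
- exact/intg_norm/bmeas_intg/bmeasM.
- apply: intgD; [exact/intgZ/bmeas_intg | exact: intgZ].
- move=> y; rewrite normrM (ger0_norm (fejerv_ge0 _ _ _)) -big_distrr /=.
  rewrite (_ : e * _ + _ = (e + C *
    \sum_i (cosn L 1 (z 0 i) - cosn L 1 (vec y 0 i)) ^+ 2) * fejerv n z (vec y)); last by ring.
  by rewrite ler_wpM2r// fejerv_ge0.
Qed.

(** Korovkin argument: the modulus of continuity of V is measured by the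
   variance of the kernel, which is 1/n in each coordinate. The kernel index
   starts at 2, where the variance formula is valid. *)
Lemma fejer_mean_cvg z : fejer_mean n.+2 z @[n --> \oo] --> V z.
Proof.
apply/cvgrPdist_le => e e0.
have e20 : 0 < e / 2 by rewrite divr_gt0.
have [C C0 VC] := korovkin_modulus L0 cV sV z e20.
have Cd : 0 <= C * d%:R by rewrite mulr_ge0.
near=> n; rewrite distrC (le_trans (fejer_mean_dist (n := n.+2) _ VC))//.
rewrite [leRHS](splitr e) lerD2l mulrA.
rewrite ler_pdivrMr ?ltr0n//.
have : e / 2 * n.+1%:R > C * d%:R.
  rewrite [ltRHS]mulrC -ltr_pdivrMr//.
  near: n; exists (Num.bound (C * d%:R / (e / 2))) => // n /= hn.
  have := archi_boundP (divr_ge0 Cd (ltW e20)).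
  move=> /lt_le_trans; apply; rewrite ler_nat; exact: leqW.
move=> /ltW /le_trans; apply; by rewrite ler_wpM2l ?ler_nat// ltW.
Unshelve. all: by end_near. Qed.

End fejer_means.

(** * Positive definiteness and convolution *)

Lemma cvg_prod (R : realType) X (F : set_system X) (FF : Filter F) I (r : seq I)
    (u : I -> X -> R) (l : I -> R) : (forall i, u i x @[x --> F] --> l i) ->
  \prod_(i <- r) u i x @[x --> F] --> \prod_(i <- r) l i.
Proof.
move=> ul; elim: r => [|i r IH].
  have -> : (fun x => \prod_(i <- [::]) u i x) = cst 1 by apply/funext => x; rewrite big_nil.
  rewrite big_nil; exact: cvg_cst.
have -> : (fun x => \prod_(j <- i :: r) u j x) = (fun x => u i x * \prod_(j <- r) u j x).
  by apply/funext => x; rewrite big_cons.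
by rewrite big_cons; apply: cvgM.
Qed.

Section positive_definiteness.
Variables (R : realType) (L : R) (d : nat).
Hypothesis L0 : 0 < L.
Local Notation RM := (measurableTypeR R).
Local Notation T := (points R d).
Local Notation mu := (torus_measure L d).

Variable V : 'rV[R]_d -> R.
Hypotheses (cV : continuous V) (sV : reflection_periodic L V).

Local Notation Vn := (fejer_mean L V).

Lemma fejerv_expand n (z y : 'rV[R]_d) : fejerv L n z y =
  \sum_(phi : {ffun 'I_d -> 'I_n}) (\prod_i (fejer_weight R n (phi i) * (theta_sq R (phi i) / L))) *
    (cosv L (fun i => phi i) z * cosv L (fun i => phi i) y).
Proof.
rewrite /fejerv /fejer bigA_distr_bigA /=; apply: eq_bigr => phi _.
by rewrite big_split /=; congr (_ * _); rewrite big_split.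
Qed.

Lemma fejer_mean_expand n z : Vn n z =
  \sum_(phi : {ffun 'I_d -> 'I_n}) (\prod_i (fejer_weight R n (phi i) * (theta_sq R (phi i) / L))) *
    coefv L V (fun i => phi i) * cosv L (fun i => phi i) z.
Proof.
pose w (phi : {ffun 'I_d -> 'I_n}) := \prod_i (fejer_weight R n (phi i) * (theta_sq R (phi i) / L)).
pose F (phi : {ffun 'I_d -> 'I_n}) (y : T) := (w phi * cosv L (fun i => phi i) z) *
  (V (vec y) * cosv L (fun i => phi i) (vec y)).
have bF phi : intg mu (F phi).
  apply: intgZ; apply: bmeas_intg; apply: bmeasM; last exact: cosv_bmeas.
  exact: (bmeas_vec L0 cV sV).
have [_ e] := @int_sum _ _ _ mu _ (index_enum _) xpredT F bF.
transitivity (\int[mu]_y \sum_phi F phi y).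
  apply: int_eq => y; rewrite fejerv_expand big_distrr /=; apply: eq_bigr => phi _.
  by rewrite /F /w; ring.
rewrite e; apply: eq_bigr => phi _; rewrite /F intZ; first by rewrite /w /coefv; ring.
apply: bmeas_intg; apply: bmeasM; [exact: (bmeas_vec L0 cV sV) | exact: cosv_bmeas].
Qed.

Lemma cosv_diff_bmeas m : bmeas (fun z : T * T => cosv L m (vec z.1 - vec z.2)).
Proof.
apply: bmeas_prod => i.
exact: (bmeas_comp (coord_diff_measurable i) (cosn_bmeas L (m i))).
Qed.

(** Up to a positive factor, cosv m is a reproducing kernel, and the form is
   the squared norm of the projection. *)
Lemma cosv_positive m f : intg mu f ->
  0 <= \int[mu]_x (f x * \int[mu]_y (cosv L m (vec x - vec y) * f y)).
Proof.
move=> If; pose c : R := \prod_i (L / theta_sq R (m i)).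
have c0 : 0 <= c.
  by apply: prodr_ge0 => i _; apply: divr_ge0; apply: ltW => //; exact: theta_sq_gt0.
have E z : cosv L m z = c * kern L (modes1 m) z.
  rewrite /c -big_split; apply: eq_bigr => i _ /=; rewrite /ker1 big_seq1.
  have m0 : theta_sq R (m i) != 0 by rewrite lt0r_neq0// theta_sq_gt0.
  by field; rewrite m0 gt_eqF.
have -> : \int[mu]_x (f x * \int[mu]_y (cosv L m (vec x - vec y) * f y)) =
    c * \int[mu]_x (f x * proj L (modes1 m) f x).
  rewrite -intZ; last first.
    by under eq_fun do rewrite mulrC; apply: intgM => //; exact: proj_bmeas.
  apply: int_eq => x; rewrite mulrCA; congr (_ * _).
  rewrite -intZ; last by apply: intgM => //; exact: kern_bmeas1.
  by apply: int_eq => y; rewrite E mulrA.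
rewrite mulr_ge0// -proj_sqr//; apply: int_ge0 => x; exact: sqr_ge0.
Qed.

Lemma fejer_weight_ge0 n m : 0 <= fejer_weight R n m.
Proof. exact: divr_ge0. Qed.

Lemma fejer_mean_bmeas n : bmeas (fun z : T * T => Vn n (vec z.1 - vec z.2)).
Proof.
under eq_fun do rewrite fejer_mean_expand.
apply: bmeas_sum => phi; apply: bmeasM; first exact: bmeas_cst.
exact: cosv_diff_bmeas.
Qed.

Lemma fejer_mean_positive n f : (forall m, 0 <= coefv L V m) -> intg mu f ->
  0 <= \int[mu]_x (f x * \int[mu]_y (Vn n (vec x - vec y) * f y)).
Proof.
move=> V0 If.
pose a (phi : {ffun 'I_d -> 'I_n}) := (\prod_i (fejer_weight R n (phi i) * (theta_sq R (phi i) / L))) *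
    coefv L V (fun i => phi i).
pose H (phi : {ffun 'I_d -> 'I_n}) (x : T) := \int[mu]_y (cosv L (fun i => phi i) (vec x - vec y) * f y).
have bH phi : bmeas (H phi).
  exact: (kernel_bmeas (K := fun x y : T => cosv L (fun i => phi i) (vec x - vec y)) (cosv_diff_bmeas _) If).
have VE x : \int[mu]_y (Vn n (vec x - vec y) * f y) = \sum_phi a phi * H phi x.
  have ic (phi : {ffun 'I_d -> 'I_n}) : intg mu (fun y : T => cosv L (fun i => phi i) (vec x - vec y) * f y).
    apply: intgM => //.
    exact: (bmeas_section1 (K := fun x y : T => cosv L (fun i => phi i) (vec x - vec y)) (cosv_diff_bmeas _)).
  have [_ e] := @int_sum _ _ _ mu _ (index_enum _) xpredT
    (fun (phi : {ffun 'I_d -> 'I_n}) (y : T) => a phi * (cosv L (fun i => phi i) (vec x - vec y) * f y))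
    (fun phi => intgZ _ (ic phi)).
  transitivity (\int[mu]_y \sum_(phi : {ffun 'I_d -> 'I_n}) a phi * (cosv L (fun i => phi i) (vec x - vec y) * f y)).
    apply: int_eq => y; rewrite fejer_mean_expand big_distrl /=; apply: eq_bigr => phi _.
    by rewrite /a mulrA.
  by rewrite e; apply: eq_bigr => phi _; rewrite intZ.
have iH phi : intg mu (fun x => f x * H phi x).
  by under eq_fun do rewrite mulrC; exact: intgM.
have [_ e] := @int_sum _ _ _ mu _ (index_enum _) xpredT
  (fun (phi : {ffun 'I_d -> 'I_n}) (x : T) => a phi * (f x * H phi x)) (fun phi => intgZ _ (iH phi)).
have -> : \int[mu]_x (f x * \int[mu]_y (Vn n (vec x - vec y) * f y)) =
   \int[mu]_x \sum_phi a phi * (f x * H phi x).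
  apply: int_eq => x; rewrite VE big_distrr /=; apply: eq_bigr => phi _; exact: mulrCA.
rewrite e; apply: sumr_ge0 => phi _; rewrite intZ//.
apply: mulr_ge0; last exact: cosv_positive.
apply: mulr_ge0 => //; apply: prodr_ge0 => i _.
apply: mulr_ge0; first exact: fejer_weight_ge0.
by apply: divr_ge0; apply: ltW => //; exact: theta_sq_gt0.
Qed.

(** The quadratic form of each Fejer mean is a nonnegative combination of
   those of the cosv m; pass to the limit by dominated convergence. *)
Lemma positive_definite f : (forall m, 0 <= coefv L V m) -> intg mu f ->
  0 <= \int[mu]_x (f x * \int[mu]_y (V (vec x - vec y) * f y)).
Proof.
move=> V0 If; have [B VB] := reflection_periodic_bounded L0 cV sV.
have bVd := bmeas_vec_diff L0 cV sV.
have mf := intg_meas If.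
rewrite -(kernel_integral (K := fun x y : T => V (vec x - vec y)) bVd If If).
pose Fn n (z : T * T) := Vn n.+2 (vec z.1 - vec z.2) * f z.1 * f z.2.
have cvgF : \int[(mu \x mu)%E]_z Fn n z @[n --> \oo] -->
   \int[(mu \x mu)%E]_z (V (vec z.1 - vec z.2) * f z.1 * f z.2).
  have mff (h : T * T -> R) : bmeas h -> measurable_fun setT (fun z : T * T => h z * f z.1 * f z.2).
    move=> [mh _]; apply: measurable_funM; last exact: measurableT_comp.
    by apply: measurable_funM => //; exact: measurableT_comp.
  apply: (int_cvg (g := fun z : T * T => B * `|f z.1| * `|f z.2|)).
  - by move=> n; apply: mff; exact: fejer_mean_bmeas.
  - exact: mff.
  - move=> z; apply: cvgM; last exact: cvg_cst.
    by apply: cvgM; [exact: fejer_mean_cvg | exact: cvg_cst].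
  - exact: (intg_kernel (K := fun x y : T => B) (bmeas_cst _ B) (intg_norm If) (intg_norm If)).
  - move=> n z; rewrite !normrM ler_wpM2r// ler_wpM2r//.
    exact: fejer_mean_bound.
apply: (cvgr_to_ge cvgF); apply: nearW => n /=.
rewrite /Fn (kernel_integral (K := fun x y : T => Vn n.+2 (vec x - vec y)) (fejer_mean_bmeas _) If If).
exact: fejer_mean_positive.
Qed.

Lemma fejerv_shift_bmeas n x :
  bmeas (fun z : T * T => fejerv L n (vec x - vec z.1) (vec z.2)).
Proof.
apply: bmeas_prod => i; apply: bmeas_sum => m.
apply: bmeasM; first exact: bmeas_cst.
have m1 := bmeas_comp (coord_measurable i) (cosn_shift_bmeas L m (tnth x i)).
have m2 := bmeas_comp (coord_measurable i) (cosn_bmeas L m).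
apply: bmeasM.
  have := bmeas_comp (phi := fun z : T * T => z.1) measurable_fst m1.
  by congr bmeas; apply/funext => z; rewrite vecB mxE.
exact: (bmeas_comp (phi := fun z : T * T => z.2) measurable_snd m2).
Qed.

(** Fubini reduces the convolution with a Fejer mean to this product of
   one-coordinate identities. *)
Lemma fejerv_eigen n m (x w : T) : (0 < n)%N ->
  \int[mu]_y (fejerv L n (vec x - vec y) (vec w) * cosv L m (vec y)) =
  (\prod_i fejer_weight R n (m i)) * (cosv L m (vec x) * cosv L m (vec w)).
Proof.
move=> n0.
have bs (i : 'I_d) : bmeas (fun t : RM => fejer L n ((tnth x i : R) - t) (tnth w i)).
  apply: bmeas_sum => j; apply: bmeasM; first exact: bmeas_cst.
  by apply: bmeasM; [exact: cosn_shift_bmeas | exact: bmeas_cst].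
transitivity (\int[mu]_y (\prod_i
  (fejer L n ((tnth x i : R) - tnth y i) (tnth w i) * cosn L (m i) (tnth y i)))).
  apply: int_eq => y; rewrite [RHS]big_split /=; congr (_ * _).
    by apply: eq_bigr => i _; rewrite vecB mxE.
  by apply: eq_bigr => i _; rewrite mxE.
rewrite (torus_integral_prod L0 (g := fun i (t : RM) =>
  fejer L n ((tnth x i : R) - t) (tnth w i) * cosn L (m i) t)); last first.
  by move=> i; apply: bmeasM => //; exact: cosn_bmeas.
rewrite -!big_split; apply: eq_bigr => i _ /=; rewrite !mxE.
exact: fejer_eigen.
Qed.

Lemma fejer_mean_eigen n m (x : T) : (0 < n)%N ->
  \int[mu]_y (Vn n (vec x - vec y) * cosv L m (vec y)) =
  (\prod_i fejer_weight R n (m i)) * (coefv L V m * cosv L m (vec x)).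
Proof.
move=> n0; have bc := cosv_bmeas L m; have bV := bmeas_vec L0 cV sV.
transitivity (\int[mu]_y (cosv L m (vec y) *
   \int[mu]_w (fejerv L n (vec x - vec y) (vec w) * V (vec w)))).
  apply: int_eq => y; rewrite mulrC; congr (_ * _); apply: int_eq => w; exact: mulrC.
rewrite (kernel_adj (K := fun y w : T => fejerv L n (vec x - vec y) (vec w))
  (fejerv_shift_bmeas n x) (bmeas_intg mu bc) (bmeas_intg mu bV)).
transitivity (\int[mu]_w (((\prod_i fejer_weight R n (m i)) * cosv L m (vec x)) *
   (V (vec w) * cosv L m (vec w)))).
  by apply: int_eq => w; rewrite fejerv_eigen//; ring.
rewrite intZ; last by apply: bmeas_intg; exact: bmeasM.
by rewrite /coefv; ring.
Qed.

Lemma fejer_weight_cvg m : fejer_weight R n.+2 m @[n --> \oo] --> (1 : R).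
Proof.
apply/cvgrPdist_le => e e0; near=> n.
have n0 : 0 < n.+2%:R :> R by rewrite ltr0n.
have mn : (m <= n.+2)%N.
  by rewrite ltnW// ltnS ltnW// ltnS; near: n; exact: nbhs_infty_ge.
rewrite /fejer_weight natrB// mulrBl divff ?gt_eqF// opprB addrC subrK.
rewrite ger0_norm ?divr_ge0// ler_pdivrMr// [leRHS]mulrC -ler_pdivrMr//.
have h := archi_boundP (divr_ge0 (ler0n R m) (ltW e0)).
apply: ltW; apply: (lt_le_trans h); rewrite ler_nat.
apply: leq_trans (leqnSn _); apply: leq_trans (leqnSn _).
near: n; exact: nbhs_infty_ge.
Unshelve. all: by end_near. Qed.

(** Holds for the Fejer means with the coefficient multiplied by a weight
   tending to 1. *)
Lemma conv_eigen m (x : T) :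
  \int[mu]_y (V (vec x - vec y) * cosv L m (vec y)) = coefv L V m * cosv L m (vec x).
Proof.
have [B VB] := reflection_periodic_bounded L0 cV sV.
have bc := cosv_bmeas L m; have bVd := bmeas_vec_diff L0 cV sV.
have mc : measurable_fun setT (fun y : T => cosv L m (vec y)) by case: bc.
have c1 : \int[mu]_y (Vn n.+2 (vec x - vec y) * cosv L m (vec y)) @[n --> \oo] -->
   \int[mu]_y (V (vec x - vec y) * cosv L m (vec y)).
  apply: (int_cvg (g := fun y : T => B * `|cosv L m (vec y)|)).
  - move=> n; apply: measurable_funM => //.
    by have [] := bmeas_section1 (K := fun x y : T => Vn n.+2 (vec x - vec y)) (fejer_mean_bmeas _) x.
  - apply: measurable_funM => //.
    by have [] := bmeas_section1 (K := fun x y : T => V (vec x - vec y)) bVd x.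
  - by move=> y; apply: cvgM; [exact: fejer_mean_cvg | exact: cvg_cst].
  - exact/intgZ/intg_norm/bmeas_intg.
  - by move=> n y; rewrite normrM ler_wpM2r//; exact: fejer_mean_bound.
have c2 : (\prod_i fejer_weight R n.+2 (m i)) * (coefv L V m * cosv L m (vec x)) @[n --> \oo] -->
   (\prod_(i < d) 1) * (coefv L V m * cosv L m (vec x)).
  apply: cvgM; last exact: cvg_cst.
  by apply: cvg_prod => i; exact: fejer_weight_cvg.
rewrite big1// mul1r in c2; move: c1.
have -> : (fun n => \int[mu]_y (Vn n.+2 (vec x - vec y) * cosv L m (vec y))) =
    (fun n => (\prod_i fejer_weight R n.+2 (m i)) * (coefv L V m * cosv L m (vec x))).
  by apply/funext => n; exact: fejer_mean_eigen.
by move=> c1; exact: (cvg_unique _ c1 c2).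
Qed.

End positive_definiteness.

(** * The interaction energy controls the critical mode *)

Lemma rV_continuousZ (R : realType) d (f : 'rV[R]_d -> R) c :
  continuous f -> continuous (fun z => c * f z).
Proof.
move=> cf z; exact: (@cvgM _ _ (nbhs z) (nbhs_filter z) (fun=> c) f _ _
  (@cvg_cst _ _ _ _ (nbhs_filter z)) (cf z)).
Qed.

Lemma rV_continuousD (R : realType) d (f g : 'rV[R]_d -> R) :
  continuous f -> continuous g -> continuous (fun z => f z + g z).
Proof.
move=> cf cg z; exact: (@cvgD _ _ _ (nbhs z) (nbhs_filter z) f g _ _ (cf z) (cg z)).
Qed.

Section kern_regularity.
Variables (R : realType) (L : R) (d : nat).
Hypothesis L0 : 0 < L.

Lemma continuous_ker1 S : continuous (ker1 L S).
Proof.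
have cc s : continuous (cosn L s).
  move=> t; apply: (@continuous_comp _ _ _ (fun t => s%:R * phase L t) cos);
    last exact: continuous_cos.
  apply: cvgM; first exact: cvg_cst.
  by apply: cvgM; [exact: cvg_cst | exact: cvg_id].
move=> t; apply: cvgM; first exact: cvg_cst.
elim: S => [|s S IH].
  have -> : (fun t => \sum_(s <- [::]) theta_sq R s * cosn L s t) = cst 0.
    by apply/funext => x; rewrite big_nil.
  rewrite big_nil; exact: cvg_cst.
have -> : (fun t => \sum_(s <- s :: S) theta_sq R s * cosn L s t) =
   (fun t => theta_sq R s * cosn L s t + \sum_(s <- S) theta_sq R s * cosn L s t).
  by apply/funext => x; rewrite big_cons.
rewrite big_cons; apply: cvgD => //; apply: cvgM; [exact: cvg_cst | exact: cc].
Qed.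

Lemma continuous_kern (S : 'I_d -> seq nat) : continuous (kern L S).
Proof.
move=> z; apply: (@cvg_prod R _ (nbhs z) (nbhs_filter z)) => i.
apply: (cvg_comp (fun z : 'rV[R]_d => z 0 i) (ker1 L (S i))).
  exact: coord_continuous.
exact: continuous_ker1.
Qed.

Lemma cosn_period n (s : bool) (m : int) t :
  cosn L n ((-1) ^+ s * t + L * m%:~R) = cosn L n t.
Proof.
rewrite /cosn; have -> : n%:R * phase L ((-1) ^+ s * t + L * m%:~R) =
    2 * pi * (n%:Z * m)%:~R + (-1) ^+ s * (n%:R * phase L t).
  by rewrite /phase intrM pmulrn; field; rewrite gt_eqF.
rewrite -sinDpihalf -addrA sin_int_period sinDpihalf.
by case: s; rewrite ?mul1r ?mulN1r ?cosN.
Qed.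

Lemma reflection_periodic_kern (S : 'I_d -> seq nat) : reflection_periodic L (kern L S).
Proof.
move=> y y' yy'; apply: eq_bigr => i _; have [s [m ->]] := yy' i.
by congr (_ * _); apply: eq_bigr => j _; rewrite cosn_period.
Qed.

End kern_regularity.

Section key.
Variables (R : realType) (L : R) (d : nat).
Hypothesis L0 : 0 < L.
Local Notation T := (points R d).
Local Notation mu := (torus_measure L d).
Local Notation r := (rho_inf d L).

Definition interaction (W : 'rV[R]_d -> R) (f : T -> R) : R :=
  \int[mu]_x (f x * \int[mu]_y (W (vec x - vec y) * f y)).

Lemma interaction_kern S f : interaction (kern L S) f = \int[mu]_x (f x * proj L S f x).
Proof. by []. Qed.

Definition vbmeas (W : 'rV[R]_d -> R) := bmeas (fun z : T * T => W (vec z.1 - vec z.2)).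

Lemma interaction_lin W W' c f : vbmeas W -> vbmeas W' -> intg mu f ->
  interaction (fun z => W z + c * W' z) f = interaction W f + c * interaction W' f.
Proof.
move=> bW bW' If.
have b1 := kernel_bmeas (K := fun x y : T => W (vec x - vec y)) bW If.
have b2 := kernel_bmeas (K := fun x y : T => W' (vec x - vec y)) bW' If.
have fI h : bmeas h -> intg mu (fun x => f x * h x).
  by move=> bh; under eq_fun do rewrite mulrC; exact: intgM.
rewrite /interaction -intZ; last exact: fI.
rewrite -intD; last 2 first.
- exact: fI.
- by apply: intgZ; exact: fI.
apply: int_eq => x; rewrite mulrCA -mulrDr; congr (_ * _).
have bs1 := bmeas_section1 (K := fun x y : T => W (vec x - vec y)) bW x.
have bs2 := bmeas_section1 (K := fun x y : T => W' (vec x - vec y)) bW' x.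
rewrite -intZ; last exact: intgM.
rewrite -intD; last 2 first.
- exact: intgM.
- by apply: intgZ; exact: intgM.
by apply: int_eq => y; rewrite mulrDl mulrA.
Qed.

Lemma coefv_lin W W' c m : bmeas (fun x : T => W (vec x)) -> bmeas (fun x : T => W' (vec x)) ->
  coefv L (fun z => W z + c * W' z) m = coefv L W m + c * coefv L W' m.
Proof.
move=> bW bW'; have bc := cosv_bmeas L m.
rewrite /coefv -intZ; last exact/bmeas_intg/bmeasM.
rewrite -intD; last 2 first.
- exact/bmeas_intg/bmeasM.
- exact/intgZ/bmeas_intg/bmeasM.
by apply: int_eq => y; rewrite mulrDl mulrA.
Qed.

Variables (W : 'rV[R]_d -> R) (k : 'I_d -> nat) (a : R).
Hypotheses (cW : continuous W) (sW : reflection_periodic L W).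
Hypotheses (k0 : exists i, k i != 0%N) (a0 : 0 < a).
Local Notation w := (coefv L W).
(* G bounds the absolute value of the part of a density of frequency k. *)
Local Notation G := (r * \prod_i theta_sq R (k i)).
Hypothesis wk : w k = - (4 * r ^+ 2 * a).
Hypothesis w_ge0 : forall m, (exists i, m i != k i) -> 0 <= w m.
Hypothesis w2 : forall m, (forall i, m i \in freq2 (k i)) -> (exists i, m i != 0%N) ->
  96 * a * r ^+ 2 <= w m.
Hypothesis w3 : forall m, (forall i, m i \in freq3 (k i)) -> (exists i, m i != k i) ->
  32 / 3 * a * G ^+ 2 <= w m.

Let om2 := 96 * a * r ^+ 2.
Let om3 := 32 / 3 * a * G ^+ 2.
Let Z (S : 'I_d -> seq nat) := kern L S.
Let S0 (i : 'I_d) : seq nat := [:: 0%N].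
(* The coefficients of V agree with those of W away from the critical and
   resonant frequencies; they are 0 at k, where the negative coefficient of W
   is compensated and om3 cancels, and w - om2, w - om3 on P2, P3. *)
Let V z := W z + (4 * r ^+ 2 * a + om3) * Z (modes1 k) z + (- om2) * Z (modes2 k) z
   + om2 * Z S0 z + (- om3) * Z (modes3 k) z.

Let cV : continuous V.
Proof.
have cs c S : continuous (fun z => c * Z S z).
  by apply: rV_continuousZ; apply: continuous_kern.
do 4 (apply: rV_continuousD; last exact: cs); exact: cW.
Qed.

Let sV : reflection_periodic L V.
Proof.
by move=> y y' yy'; rewrite /V (sW yy') /Z !(reflection_periodic_kern L0 _ yy').
Qed.

Let memP (S : 'I_d -> seq nat) (m : 'I_d -> nat) :
  (forall i, m i \in S i) \/ (exists i, m i \notin S i).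
Proof.
have [/forallP h|] := boolP [forall i, m i \in S i]; first by left.
by rewrite negb_forall => /existsP [i hi]; right; exists i.
Qed.

Let coefV m : coefv L V m = w m + (4 * r ^+ 2 * a + om3) * \prod_i (m i \in modes1 k i)%:R
  + (- om2) * \prod_i (m i \in modes2 k i)%:R + om2 * \prod_i (m i \in S0 i)%:R
  + (- om3) * \prod_i (m i \in modes3 k i)%:R.
Proof.
have bW : bmeas (fun x : T => W (vec x)) by exact: (bmeas_vec L0 cW sW).
have bZ S : bmeas (fun x : T => Z S (vec x)).
  apply: bmeas_prod => i; exact: (bmeas_comp (coord_measurable i) (ker1_bmeas0 L (S i))).
have bcZ c S : bmeas (fun x : T => c * Z S (vec x)) by apply: bmeasM => //; exact: bmeas_cst.
rewrite /V coefv_lin//; last by do 3 apply: bmeasD => //.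
rewrite coefv_lin//; last by do 2 apply: bmeasD => //.
rewrite coefv_lin//; last by apply: bmeasD => //.
rewrite coefv_lin//.
by rewrite /coefv !kern_coef//; [exact: modes3_uniq | exact: modes2_uniq].
Qed.

Let coefV_ge0 m : 0 <= coefv L V m.
Proof.
rewrite coefV; have [i0 ki0] := k0.
have r2a : 0 < 4 * r ^+ 2 * a by rewrite mulr_gt0// mulr_gt0// exprn_gt0// rho_inf_gt0.
have [hk|[i1 hi1]] := memP (modes1 k) m.
  have mk i : m i = k i by move: (hk i); rewrite inE => /eqP.
  have -> : w m = w k by congr w; apply/funext.
  rewrite (prod_mem_eq1 R hk) (prod_mem_eq1 R (S := modes3 k)); last first.
    by move=> i; rewrite mk; exact: self_freq3.
  rewrite (prod_mem_eq0 R (S := S0) (i := i0)); last by rewrite mk inE.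
  rewrite (prod_mem_eq0 R (S := modes2 k) (i := i0)); last first.
    by rewrite mk /modes2 /freq2 (negbTE ki0) !inE negb_or ki0 /=; apply/eqP; move: ki0; lia.
  by rewrite wk; lra.
have mk : exists i, m i != k i by exists i1; move: hi1; rewrite inE.
rewrite (prod_mem_eq0 R hi1).
have [h0|[i2 hi2]] := memP S0 m.
  have m0 i : m i = 0%N by move: (h0 i); rewrite inE => /eqP.
  rewrite (prod_mem_eq1 R h0) (prod_mem_eq1 R (S := modes2 k)); last first.
    by move=> i; rewrite m0; exact: zero_freq2.
  rewrite (prod_mem_eq0 R (S := modes3 k) (i := i0)); last by rewrite m0; exact: zero_freq3.
  by have := w_ge0 mk; lra.
rewrite (prod_mem_eq0 R hi2).
have [h2|[i3 hi3]] := memP (modes2 k) m.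
  rewrite (prod_mem_eq1 R h2) (prod_mem_eq0 R (S := modes3 k) (i := i0)); last first.
    move: (h2 i0); rewrite /modes2 /modes3 /freq2 /freq3 (negbTE ki0) !inE.
    by move=> /orP[] /eqP ->; apply/negP => /orP[] /eqP; move: ki0; lia.
  have : om2 <= w m by apply: w2 => //; exists i2; move: hi2; rewrite inE.
  by lra.
rewrite (prod_mem_eq0 R hi3).
have [h3|[i4 hi4]] := memP (modes3 k) m.
  rewrite (prod_mem_eq1 R h3).
  have : om3 <= w m by apply: w3.
  by lra.
by rewrite (prod_mem_eq0 R hi4); have := w_ge0 mk; lra.
Qed.

Variable f : T -> R.
Hypotheses (If : intg mu f) (f1 : \int[mu]_x f x = 1).
Hypotheses (f0 : forall x, 0 <= f x) (If4 : intg mu (fun x => f x ^+ 4)).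

Local Notation p := (proj L (modes1 k) f).
Let q2 x := proj L (modes2 k) f x - r.
Let q3 x := proj L (modes3 k) f x - p x.

Lemma interaction_lower :
  - (4 * r ^+ 2 * a) * (\int[mu]_x (f x * p x)) + om2 * \int[mu]_x (q2 x ^+ 2)
   + om3 * \int[mu]_x (q3 x ^+ 2) <= interaction W f.
Proof.
have := positive_definite L0 cV sV coefV_ge0 If; rewrite -/(interaction V f).
have bW : vbmeas W by exact: (bmeas_vec_diff L0 cW sW).
have bZ S : vbmeas (Z S) by exact: kern_bmeas.
have bcZ c S : vbmeas (fun x => c * Z S x).
  apply: (bmeasM (f := fun=> c) (g := fun z : T * T => Z S (vec z.1 - vec z.2))); last exact: bZ.
  exact: bmeas_cst.
have bD W1 W2 : vbmeas W1 -> vbmeas W2 -> vbmeas (fun z => W1 z + W2 z) by exact: bmeasD.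
rewrite /V interaction_lin//; last by do 3 (apply: (bD) => //).
rewrite interaction_lin//; last by do 2 (apply: (bD) => //).
rewrite interaction_lin//; last by apply: (bD) => //.
rewrite interaction_lin// !interaction_kern.
have -> : \int[mu]_x (f x * proj L S0 f x) = r.
  rewrite -[RHS]mulr1 -f1 -intZ//; apply: int_eq => x; rewrite mulrC; congr (_ * _).
  rewrite -[RHS]mulr1 -f1 -intZ//; apply: int_eq => y; congr (_ * _).
  exact: kern_const.
rewrite /q2 /q3 int_even_sqr// int_odd_sqr//.
have alg (e i1 i2 i3 c o2 o3 s : R) : e + (c + o3) * i1 + (- o2) * i2 + o2 * s + (- o3) * i3 =
  e - (- c * i1 + o2 * (i2 - s) + o3 * (i3 - i1)) by ring.
by rewrite alg subr_ge0.
Qed.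

Lemma p_bound x : `|p x| <= G.
Proof.
have iKf : intg mu (fun y => kern L (modes1 k) (vec x - vec y) * f y).
  by apply: intgM => //; exact: kern_bmeas1.
rewrite (le_trans (int_norm iKf))//.
have -> : G = \int[mu]_y (G * f y) by rewrite intZ// f1 mulr1.
apply: int_le; [exact: intg_norm | exact: intgZ|].
move=> y; rewrite normrM (ger0_norm (f0 y)) ler_wpM2r//.
exact: (kern_modes1_bound L0 k (vec x - vec y)).
Qed.

(** The arithmetic-geometric mean inequality. *)
Lemma square_completion (X Y z : R) : 0 <= X -> 0 <= Y -> z ^+ 2 <= 4 * X * Y ->
  0 <= X + Y + z.
Proof.
move=> X0 Y0 h; rewrite leNgt; apply/negP => neg.
have : (X + Y) ^+ 2 < z ^+ 2 by nra.
by have := sqr_ge0 (X - Y); nra.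
Qed.

(** With weights a/3 and 1/2, the terms 6 r^2 int f p of the quartic bound and
   - 4 r^2 a int f p of the interaction cancel exactly; the cross terms are
   absorbed by completing squares. *)
Lemma key_inequality :
  a / 72 * (\int[mu]_x ((f x - r) ^+ 4)) <=
  a / 3 * (\int[mu]_x (f x ^+ 4) - r ^+ 3) + 2^-1 * interaction W f.
Proof.
have bp : bmeas p by exact: proj_bmeas.
have bq2 : bmeas q2 by apply: bmeasB; [exact: proj_bmeas | exact: bmeas_cst].
have bq3 : bmeas q3 by apply: bmeasB => //; exact: proj_bmeas.
have low := quartic_lower L0 k0 If f1 If4.
have ilow := interaction_lower.
have r0 := rho_inf_gt0 d L0.
have G0 : 0 <= G.
  by rewrite mulr_ge0 ?(ltW r0)// prodr_ge0// => i _; exact/ltW/theta_sq_gt0.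
have csA := int_cauchy_schwarz mu (bmeasX 2 bp) bq2.
have csB := int_cauchy_schwarz mu (bmeasX 3 bp) bq3.
set T4 := \int[mu]_x (p x ^+ 4) in low.
have eA : \int[mu]_x ((p x ^+ 2) ^+ 2) = T4 by apply: int_eq => x; rewrite -exprM.
have T40 : 0 <= T4 by apply: int_ge0 => x; exact: exprn_even_ge0.
have eB : \int[mu]_x ((p x ^+ 3) ^+ 2) <= G ^+ 2 * T4.
  rewrite -intZ; last exact/bmeas_intg/bmeasX.
  apply: int_le; first exact/bmeas_intg/bmeasX/bmeasX.
    exact/intgZ/bmeas_intg/bmeasX.
  move=> x; have -> : (p x ^+ 3) ^+ 2 = p x ^+ 2 * p x ^+ 4 by ring.
  rewrite ler_wpM2r ?exprn_even_ge0// -real_normK ?num_real//.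
  by rewrite lerXn2r ?nnegrE ?normr_ge0// p_bound.
have Q20 : 0 <= \int[mu]_x (q2 x ^+ 2) by apply: int_ge0 => x; exact: sqr_ge0.
have Q30 : 0 <= \int[mu]_x (q3 x ^+ 2) by apply: int_ge0 => x; exact: sqr_ge0.
have D4 : \int[mu]_x ((f x - r) ^+ 4) <= 8 * \int[mu]_x ((f x - (r + p x)) ^+ 4) + 8 * T4.
  have iD : intg mu (fun x => (f x - (r + p x)) ^+ 4).
    apply: (intg_quartic_diff If If4); apply: bmeasD => //; exact: bmeas_cst.
  have iT : intg mu (fun x => p x ^+ 4) by exact/bmeas_intg/bmeasX.
  rewrite -!intZ// -intD; [|exact: intgZ|exact: intgZ].
  apply: int_le.
  - by apply: (intg_quartic_diff If If4); exact: bmeas_cst.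
  - by apply: intgD; exact: intgZ.
  - move=> x; have := quartic_sum (f x - (r + p x)) (- p x).
    have -> : f x - (r + p x) - - p x = f x - r by ring.
    by rewrite (_ : (- p x) ^+ 4 = p x ^+ 4)//; ring.
rewrite eA in csA.
have {csB eB} csB := le_trans csB (ler_wpM2r Q30 eB).
move: low ilow csA csB Q20 Q30 D4; rewrite /om2 /om3 -/q2 -/q3.
set S := \int[mu]_x (f x * p x).
set Q2 := \int[mu]_x (q2 x ^+ 2).
set Q3 := \int[mu]_x (q3 x ^+ 2).
set A := \int[mu]_x (p x ^+ 2 * q2 x).
set B := \int[mu]_x (p x ^+ 3 * q3 x).
set D := \int[mu]_x ((f x - (r + p x)) ^+ 4).
set X4 := \int[mu]_x (f x ^+ 4).
set E := interaction W f.
set g := G in G0 *.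
move=> low ilow csA csB Q20 Q30 D4.
(* Of the available T4 / 3, one twelfth of T4 goes to each cross term; what is
   left pays for the part of (f - r)^4 coming from p. *)
have sA : 0 <= T4 / 12 + 48 * r ^+ 2 * Q2 + 4 * r * A.
  apply: square_completion.
  - by rewrite divr_ge0.
  - by rewrite mulr_ge0// mulr_ge0// sqr_ge0.
  - have -> : 4 * (T4 / 12) * (48 * r ^+ 2 * Q2) = 16 * r ^+ 2 * (T4 * Q2) by field.
    have -> : (4 * r * A) ^+ 2 = 16 * r ^+ 2 * A ^+ 2 by ring.
    by rewrite ler_wpM2l// mulr_ge0// sqr_ge0.
have sB : 0 <= T4 / 12 + 16 / 3 * g ^+ 2 * Q3 + 4 / 3 * B.
  apply: square_completion.
  - by rewrite divr_ge0.
  - by rewrite mulr_ge0// mulr_ge0// sqr_ge0.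
  - have -> : 4 * (T4 / 12) * (16 / 3 * g ^+ 2 * Q3) = 16 / 9 * (g ^+ 2 * T4 * Q3) by field.
    have -> : (4 / 3 * B) ^+ 2 = 16 / 9 * B ^+ 2 by field.
    by rewrite ler_wpM2l.
have h1 : a / 3 * (6 * r ^+ 2 * S + 12 * r * A + T4 + 4 * B + 3^-1 * D) <= a / 3 * (X4 - r ^+ 3).
  by rewrite ler_wpM2l ?divr_ge0 ?(ltW a0)//; lra.
have h2 : 0 <= a * (T4 / 12 + 48 * r ^+ 2 * Q2 + 4 * r * A) by rewrite mulr_ge0// ltW.
have h3 : 0 <= a * (T4 / 12 + 16 / 3 * g ^+ 2 * Q3 + 4 / 3 * B) by rewrite mulr_ge0// ltW.
have D0 : 0 <= D by apply: int_ge0 => x; exact: exprn_even_ge0.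
have aT : 0 <= a * T4 by rewrite mulr_ge0// ltW.
have h4 : a / 72 * (\int[mu]_x ((f x - r) ^+ 4)) <= a / 72 * (8 * D + 8 * T4).
  by rewrite ler_wpM2l// divr_ge0// ltW.
lra.
Qed.

End key.

(** * Free energy in terms of densities *)

Lemma mnormalizeE dT (T : measurableType dT) (R : realType)
    (m : {measure set T -> \bar R}) (P : probability T R) c A :
  m setT = c%:E -> c != 0 -> mnormalize m P A = (m A * (c^-1)%:E)%E.
Proof. by move=> mT c0; rewrite /mnormalize mT /= eqe (negbTE c0). Qed.

Section density.
Variables (R : realType) (L : R) (d : nat).
Hypothesis L0 : 0 < L.
Local Notation T := (points R d).
Local Notation mu := (torus_measure L d).
Local Notation r := (rho_inf d L).
Local Notation RM := (measurableTypeR R).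

Definition admissible (g : T -> R) :=
  [/\ intg mu g, forall x, 0 <= g x, \int[mu]_x g x = 1 &
      intg mu (fun x => g x ^+ 4)].

Definition has_density (rho : set T -> \bar R) (g : T -> R) :=
  forall A, measurable A -> rho A = (\int[mu]_(x in A) (g x)%:E)%E.

Definition energy (W : 'rV[R]_d -> R) (beta : R) (g : T -> R) : R :=
  beta^-1 / 3 * \int[mu]_x (g x ^+ 4) - beta^-1 / 3 + 2^-1 * interaction L W g.

Lemma int_ae_eq (f g : T -> R) : measurable_fun setT f -> measurable_fun setT g ->
  (\forall x \ae mu, f x = g x) -> \int[mu]_x f x = \int[mu]_x g x.
Proof.
move=> mf mg fg; congr fine; apply: ae_eq_integral => //; [exact/measurable_EFinP..|].
by apply: filterS fg => x + _ /= => ->.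
Qed.

Lemma intg_ae_eq (f g : T -> R) : measurable_fun setT f -> intg mu g ->
  (\forall x \ae mu, f x = g x) -> intg mu f.
Proof.
move=> mf ig fg; have /integrableP [mg fing] := ig.
apply/integrableP; split; first exact/measurable_EFinP.
rewrite (ae_eq_integral (fun x => `|(EFin \o g) x|%E))//.
- by apply: measurableT_comp => //; exact/measurable_EFinP.
- exact: measurableT_comp.
- by apply: filterS fg => x + _ /= => ->.
Qed.

Lemma has_density_dominates (rho : probability T R) g :
  intg mu g -> has_density rho g -> rho `<< mu.
Proof.
move=> ig rg; apply/null_content_dominatesP => A mA A0.
rewrite rg//; apply: null_set_integral => //.
by apply: measurable_funTS; exact: measurable_int ig.
Qed.

Lemma density_intg (rho : probability T R) : rho `<< mu ->
  intg mu (density L rho).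
Proof.
move=> rmu; have := Radon_Nikodym_integrable (nu := charge_of_finite_measure rho) rmu.
apply: eq_integrable => // x _; rewrite /= /density fineK//.
exact: Radon_Nikodym_fin_num.
Qed.

(** The density in the definition of the energy is a Radon-Nikodym derivative,
   determined only up to null sets. *)
Lemma has_density_ae (rho : probability T R) g : intg mu g -> has_density rho g ->
  \forall x \ae mu, density L rho x = g x.
Proof.
move=> ig rg; have rmu := has_density_dominates ig rg.
have : ae_eq mu setT (EFin \o density L rho) (EFin \o g).
  apply: integral_ae_eq => //; [exact: density_intg | exact: measurable_int ig|].
  move=> E _ mE; rewrite -rg//.
  have -> : rho E = charge_of_finite_measure rho E by [].
  rewrite (@Radon_Nikodym_integral _ _ _ (charge_of_finite_measure rho) mu E rmu mE).
  apply: eq_integral => x _ /=.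
  by rewrite /density fineK//; exact: Radon_Nikodym_fin_num.
by apply: filterS => x /(_ Logic.I) /= [].
Qed.

(** A version of the derivative that is nonnegative everywhere, not just
   almost everywhere. *)
Lemma dominated_has_density (rho : probability T R) : rho `<< mu ->
  exists g, [/\ intg mu g, forall x, 0 <= g x & has_density rho g].
Proof.
move=> rmu; pose g x := fine (Radon_Nikodym_SigmaFinite.f rho mu x).
have gE x : (g x)%:E = Radon_Nikodym_SigmaFinite.f rho mu x.
  by rewrite /g fineK//; exact: Radon_Nikodym_SigmaFinite.f_fin_num.
exists g; split.
- have := Radon_Nikodym_SigmaFinite.f_integrable rmu.
  by apply: eq_integrable => // x _; rewrite /= gE.
- by move=> x; rewrite fine_ge0//; exact: Radon_Nikodym_SigmaFinite.f_ge0.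
- move=> A mA; rewrite (Radon_Nikodym_SigmaFinite.f_integral rmu mA).
  by apply: eq_integral => x _; rewrite gE.
Qed.

Variable W : 'rV[R]_d -> R.
Hypotheses (cW : continuous W) (sW : reflection_periodic L W).

Let bW : bmeas (fun z : T * T => W (vec z.1 - vec z.2)).
Proof. exact: (bmeas_vec_diff L0 cW sW). Qed.

Lemma interaction_ae_eq (f g : T -> R) : intg mu f -> intg mu g ->
  (\forall x \ae mu, f x = g x) -> interaction L W f = interaction L W g.
Proof.
move=> If Ig fg.
have E x : \int[mu]_y (W (vec x - vec y) * f y) = \int[mu]_y (W (vec x - vec y) * g y).
  have bs := bmeas_section1 (K := fun x y : T => W (vec x - vec y)) bW x.
  apply: int_ae_eq; [exact: (intg_meas )(intgM bs If) | exact: (intg_meas )(intgM bs Ig)|].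
  by apply: filterS fg => y ->.
rewrite /interaction; under [LHS]eq_Rintegral do rewrite E.
have bk := kernel_bmeas (K := fun x y : T => W (vec x - vec y)) bW Ig.
apply: int_ae_eq.
- by apply: measurable_funM; [exact: (intg_meas If) | case: bk].
- by apply: measurable_funM; [exact: (intg_meas Ig) | case: bk].
- by apply: filterS fg => y ->.
Qed.

Lemma powR4 (x : R) : 0 <= x -> x `^ 4 = x ^+ 4.
Proof. by move=> x0; rewrite -powR_mulrn. Qed.

Lemma free_energy_density (beta : R) (rho : probability T R) (g : T -> R) :
  admissible g -> has_density rho g ->
  free_energy L 4 W beta rho = (energy W beta g)%:E.
Proof.
move=> [ig g0 g1 ig4] rg.
have rmu := has_density_dominates ig rg; have iD := density_intg rmu.
have Dg := has_density_ae ig rg.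
have D4 : \forall x \ae mu, density L rho x `^ 4 = g x ^+ 4.
  by apply: filterS Dg => x ->; exact: powR4.
have mD4 : measurable_fun setT (fun x => density L rho x `^ 4).
  exact: (measurableT_comp (measurable_powR 4) (intg_meas iD)).
have iD4 : mu.-integrable setT (fun x => (density L rho x `^ 4)%:E).
  exact: (intg_ae_eq mD4 ig4 D4).
have iK := intg_kernel (K := fun x y : T => W (vec x - vec y)) bW iD iD.
rewrite /free_energy; case: asboolP => [_|]; last by case.
congr EFin; rewrite /energy.
have -> : 4 - 1 = 3 :> R by lra.
rewrite (@int_ae_eq (fun x => density L rho x `^ 4) (fun x => g x ^+ 4))//; last exact: (intg_meas ig4).
congr (_ + _ * _).
by rewrite (kernel_integral (K := fun x y : T => W (vec x - vec y)) bW iD iD); exact: interaction_ae_eq.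
Qed.

(** Finite energy means absolute continuity with a density in L^4; thus
   minimisation may be restricted to admissible densities. *)
Lemma finite_energy_density (beta : R) (rho : probability T R) :
  (free_energy L 4 W beta rho < +oo)%E -> exists2 g, admissible g & has_density rho g.
Proof.
rewrite /free_energy; case: asboolP => [[rmu i4 _] _|]; last by rewrite ltxx.
have [g [ig g0 rg]] := dominated_has_density rmu; exists g => //; split => //.
  have := rg setT measurableT; rewrite probability_setT /Rintegral => <-.
  by [].
have Dg := has_density_ae ig rg.
apply: (intg_ae_eq _ i4); first by apply: measurable_funX; exact: (intg_meas ig).
by apply: filterS Dg => x ->; rewrite powR4.
Qed.

Section density_probability.
Variables (g : T -> R) (ag : admissible g).

Definition density_measure of admissible g : set T -> \bar R :=
  fun A => (\int[mu]_(x in A) (g x)%:E)%E.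

Let m := density_measure ag.

Let m0 : m set0 = 0%E. Proof. exact: integral_set0. Qed.

Let m_ge0 A : (0 <= m A)%E.
Proof. by apply: integral_ge0 => x _; rewrite lee_fin; have [_ + _ _] := ag; exact. Qed.

Let m_sigma : semi_sigma_additive m.
Proof.
have [ig g0 _ _] := ag; apply: semi_sigma_additive_nng_induced.
  exact: measurable_int ig.
by move=> x; rewrite lee_fin.
Qed.

HB.instance Definition _ := isMeasure.Build _ _ _ (density_measure ag) m0 m_ge0 m_sigma.

Let m_setT : density_measure ag setT = 1%E.
Proof.
have [ig _ g1 _] := ag; rewrite /density_measure -[LHS]fineK; last exact: integrable_fin_num.
by congr EFin.
Qed.

HB.instance Definition _ := Measure_isProbability.Build _ _ _ (density_measure ag) m_setT.

End density_probability.

Lemma admissible_probability g : admissible g ->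
  exists rho : probability T R, has_density rho g.
Proof. by move=> ag; exists (density_measure ag). Qed.

Lemma torus_dom_measurable : measurable (torus_dom L : set T).
Proof.
have -> : torus_dom L = \bigcap_(i in [set: 'I_d]) ((fun x : T => tnth x i) @^-1` circle_dom L).
  apply/seteqP; split=> x /= h i; first by move=> _; rewrite /circle_dom /= in_itv/=; exact: h.
  by have := h i Logic.I; rewrite /circle_dom /= in_itv.
apply: fin_bigcap_measurable => // i _; rewrite -[X in measurable X]setTI.
by apply: measurable_tnth => //; exact: measurable_circle_dom.
Qed.

(** The domain already has the full mass L^d, one factor L per coordinate. *)
Lemma torus_dom_compl0 : mu (~` torus_dom L) = 0%E.
Proof.
have mD := torus_dom_measurable.
have ind : \int[mu]_x (\1_(torus_dom L) x) = L ^+ d.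
  have bind : bmeas (\1_(circle_dom L) : RM -> R).
    split; first by apply: measurable_indic; exact: measurable_circle_dom.
    by exists 1 => x; rewrite indicE; case: (_ \in _); rewrite ?normr1 ?normr0.
  transitivity (\int[mu]_x \prod_(i < d) (\1_(circle_dom L) : RM -> R) (tnth x i)).
    apply: int_eq => x; rewrite indicE; case: (boolP (x \in _)) => [/set_mem xD|xD].
      rewrite big1// => i _; rewrite indicE mem_set// /circle_dom /= in_itv /=; exact: xD.
    have [i hi] : exists i, ~ (0 <= (tnth x i : R) < L).
      by apply/existsNP => h; move/negP: xD; apply; exact/mem_set.
    by rewrite (bigD1 i)//= indicE memNset ?mul0r// /circle_dom /= in_itv.
  rewrite (torus_integral_prod L0 (g := fun=> \1_(circle_dom L)))//.
  rewrite (eq_bigr (fun=> L)) ?prodr_const ?card_ord// => i _.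
  rewrite /Rintegral integral_indic//; last exact: measurable_circle_dom.
  rewrite setIT /= /mfrestr /mrestr setIid lebesgue_measure_itv/= lte_fin L0.
  by rewrite -EFinB subr0.
have muD : mu (torus_dom L) = (L ^+ d)%:E.
  have := integral_indic mu measurableT mD; rewrite setIT => <-.
  rewrite -ind /Rintegral fineK//.
  apply: integrable_fin_num => //; exact: integrable_indic.
have muT : mu (torus_dom L `|` ~` torus_dom L) = (L ^+ d)%:E.
  by rewrite setUv; apply: torus_measure_setT; exact: ltW.
have e : (L ^+ d)%:E = ((L ^+ d)%:E + mu (~` torus_dom L))%E :=
  etrans (esym muT) (etrans (measureU mu mD (measurableC mD) (setICr _))
    (congr1 (fun t => (t + mu (~` torus_dom L))%E) muD)).
have fC : mu (~` torus_dom L) \is a fin_num by apply: fin_num_measure; exact: measurableC.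
move: e; rewrite -(fineK fC) -EFinD => -[] /eqP.
by rewrite addrC -subr_eq subrr => /eqP <-.
Qed.

Lemma has_density_torus_dom (rho : probability T R) g : intg mu g -> has_density rho g ->
  rho (torus_dom L) = 1%E.
Proof.
move=> ig rg; have mD := torus_dom_measurable.
have /null_content_dominatesP := has_density_dominates ig rg.
move=> /(_ _ (measurableC mD) torus_dom_compl0) rC.
have e1 : rho (torus_dom L `|` ~` torus_dom L) = 1%E.
  by rewrite setUv; exact: probability_setT.
have e2 : 1%E = (rho (torus_dom L) + 0)%E :=
  etrans (esym e1) (etrans (measureU rho mD (measurableC mD) (setICr _))
    (congr1 (fun t => (rho (torus_dom L) + t)%E) rC)).
by rewrite adde0 in e2; rewrite -e2.
Qed.

Lemma uniform_admissible : admissible (fun=> r).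
Proof.
split; first exact/bmeas_intg/bmeas_cst.
- by move=> _; exact/ltW/rho_inf_gt0.
- by rewrite int_cst// rho_inf_mass.
- exact/bmeas_intg/(bmeas_cst _ (r ^+ 4)).
Qed.

Lemma uniform_has_density : has_density (uniform_measure d L) (fun=> r).
Proof.
move=> A mA; have Ld0 : L ^+ d != 0 by rewrite expf_neq0// gt_eqF.
rewrite integral_cst// muleC.
exact: (mnormalizeE _ _ (torus_measure_setT d (ltW L0)) Ld0).
Qed.

Lemma same_density_ae (rho nu : probability T R) g h : intg mu g -> intg mu h ->
  has_density rho g -> has_density nu h -> (\forall x \ae mu, g x = h x) ->
  same_measure rho nu.
Proof.
move=> ig ih rg nh gh A mA; rewrite rg// nh//; apply: ae_eq_integral => //.
- by apply: measurable_funTS; apply/measurable_EFinP; exact: (intg_meas ig).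
- by apply: measurable_funTS; apply/measurable_EFinP; exact: (intg_meas ih).
- by apply: filterS gh => x + _ => ->.
Qed.

(** The uniform measure has finite energy, hence so does every minimiser. *)
Lemma minimiser_density (beta : R) (rho : probability T R) :
  is_minimiser L 4 W beta rho ->
  exists g, [/\ admissible g, has_density rho g &
    forall h, admissible h -> energy W beta g <= energy W beta h].
Proof.
move=> [_ rmin].
have uD := has_density_torus_dom (bmeas_intg mu (bmeas_cst T r)) uniform_has_density.
have := rmin _ uD; rewrite (free_energy_density beta uniform_admissible uniform_has_density) => le1.
have [g ag rg] := finite_energy_density (le_lt_trans le1 (ltry _)).
exists g; split; [exact: ag | exact: rg | move=> h ah]; have [nu nuh] := admissible_probability ah.
have [ih _ _ _] := ah.
have := rmin _ (has_density_torus_dom ih nuh).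
by rewrite (free_energy_density beta ag rg) (free_energy_density beta ah nuh) lee_fin.
Qed.

End density.

(** * Instability of the uniform density *)

Section variational.
Variables (R : realType) (L : R) (d : nat).
Hypothesis L0 : 0 < L.
Local Notation T := (points R d).
Local Notation mu := (torus_measure L d).
Local Notation r := (rho_inf d L).

Variable W : 'rV[R]_d -> R.
Hypotheses (cW : continuous W) (sW : reflection_periodic L W).
Hypothesis W0 : \int[mu]_x W (vec x) = 0.
Variable B : R.
Hypothesis WB : forall z, `|W z| <= B.

Let bW : bmeas (fun z : T * T => W (vec z.1 - vec z.2)).
Proof. exact: (bmeas_vec_diff L0 cW sW). Qed.

Let bW1 x : bmeas (fun y : T => W (vec x - vec y)).
Proof. exact: (bmeas_section1 (K := fun x y : T => W (vec x - vec y)) bW x). Qed.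

(** The function 1 is the cosine product of frequency 0, an eigenvector for
   the eigenvalue 0. *)
Lemma conv_zero (x : T) : \int[mu]_y W (vec x - vec y) = 0.
Proof.
have c1 z : cosv L (fun=> 0%N) z = 1.
  by rewrite /cosv big1// => i _; rewrite /cosn mul0r cos0.
have := conv_eigen L0 cW sW (fun=> 0%N) x.
rewrite c1 mulr1 /coefv.
have -> : \int[mu]_y (W (vec y) * cosv L (fun=> 0%N) (vec y)) = 0.
  by rewrite -W0; apply: int_eq => y; rewrite c1 mulr1.
by move=> <-; apply: int_eq => y; rewrite c1 mulr1.
Qed.

Lemma conv_shift c g (x : T) : intg mu g ->
  \int[mu]_y (W (vec x - vec y) * (c + g y)) = \int[mu]_y (W (vec x - vec y) * g y).
Proof.
move=> ig.
transitivity (c * (\int[mu]_y W (vec x - vec y)) + \int[mu]_y (W (vec x - vec y) * g y)); last first.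
  by rewrite conv_zero mulr0 add0r.
rewrite -intZ; last exact: bmeas_intg.
rewrite -intD; last 2 first.
- exact/intgZ/bmeas_intg.
- exact: intgM.
by apply: int_eq => y; ring.
Qed.

Lemma energy_uniform beta :
  energy L W beta (fun=> r) = beta^-1 / 3 * r ^+ 3 - beta^-1 / 3.
Proof.
rewrite /energy int_cst// rho_inf_pow_mass//.
suff -> : interaction L W (fun=> r) = 0 by rewrite mulr0 addr0.
rewrite /interaction (@int_eq _ _ _ mu _ (fun=> 0)); first by rewrite Rintegral_cst// mul0r.
move=> x; rewrite (@int_eq _ _ _ mu _ (fun y => W (vec x - vec y) * (r + 0))); last by move=> y; rewrite addr0.
rewrite conv_shift; last exact/bmeas_intg/bmeas_cst.
rewrite (@int_eq _ _ _ mu _ (fun=> 0)); last by move=> y; rewrite mulr0.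
by rewrite Rintegral_cst// mul0r mulr0.
Qed.

Lemma energy_diff beta g : energy L W beta g - energy L W beta (fun=> r) =
  beta^-1 / 3 * (\int[mu]_x (g x ^+ 4) - r ^+ 3) + 2^-1 * interaction L W g.
Proof. by rewrite energy_uniform /energy; ring. Qed.

Section instability.
Variables (k : 'I_d -> nat) (a : R).
Hypotheses (k0 : exists i, k i != 0%N).
Hypothesis wk : coefv L W k = - (4 * r ^+ 2 * a).

Let c (x : T) := cosv L k (vec x).
Let bc : bmeas c. Proof. exact: cosv_bmeas. Qed.

Let c_int : \int[mu]_x c x = 0.
Proof.
have [i ki] := k0.
have := @kern_coef R L d L0 (fun=> [:: 0%N]) k (fun=> isT).
rewrite (prod_mem_eq0 R (S := fun=> [:: 0%N]) (i := i)) ?inE// => e.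
have r0 : r != 0 by rewrite gt_eqF// rho_inf_gt0.
apply: (mulfI r0); rewrite mulr0 -e -intZ; last exact: bmeas_intg.
by apply: int_eq => x; rewrite kern_const.
Qed.

Let c2_gt0 : 0 < \int[mu]_x (c x ^+ 2).
Proof.
have := @kern_coef R L d L0 (modes1 k) k (fun=> isT).
rewrite (prod_mem_eq1 R) => [|i]; last by rewrite inE.
pose n : R := \prod_i (L^-1 * theta_sq R (k i)).
rewrite (@int_eq _ _ _ mu _ (fun x => n * c x ^+ 2)); last first.
  move=> x; rewrite expr2 mulrA; congr (_ * _); rewrite /n /c -big_split.
  by apply: eq_bigr => i _; rewrite /ker1 big_seq1 /= mulrA.
rewrite intZ; last exact/bmeas_intg/bmeasX.
have c20 : 0 <= \int[mu]_x (c x ^+ 2) by apply: int_ge0 => x; exact: sqr_ge0.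
rewrite lt_def c20 andbT => e; apply/eqP => z.
by move/eqP: e; rewrite z mulr0 eq_sym oner_eq0.
Qed.

Let c_le1 x : `|c x| <= 1.
Proof.
rewrite /c normr_prod; apply: prodr_ile1 => i _; rewrite normr_ge0 /=; exact: cos_max.
Qed.

(** Along r (1 + e c) the quartic term grows at rate 2 r^4 b e^2 int c^2 and
   the interaction decreases at rate 2 r^4 a e^2 int c^2, to second order in
   e. *)
Lemma instability beta : 0 < beta -> beta^-1 < a ->
  exists2 h, admissible L h & energy L W beta h < energy L W beta (fun=> r).
Proof.
move=> b0 ba; set b := beta^-1 in ba *; have bp : 0 < b by rewrite invr_gt0.
have r0 := rho_inf_gt0 d L0.
(* e <= 1 keeps the density nonnegative; b e <= a - b makes the cubic and
   quartic remainders, at most 5/3 b e^3, smaller than 2 (a - b) e^2. *)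
pose e := Num.min 1 ((a - b) / b).
have e0 : 0 < e by rewrite lt_min ltr01 divr_gt0// subr_gt0.
have e1 : e <= 1 by rewrite ge_min lexx.
have eb : b * e <= a - b.
  by rewrite mulrC -ler_pdivlMr// ge_min lexx orbT.
pose h x := r + r * e * c x.
have bh : bmeas h by apply: bmeasD; [exact: bmeas_cst | apply: bmeasM => //; exact: bmeas_cst].
have bX n := bmeas_intg mu (bmeasX n bc).
have ic : intg mu c by exact: bmeas_intg.
have irc : intg mu (fun x => r * e * c x) by exact: intgZ.
exists h.
  split; first exact: bmeas_intg.
  - move=> x; have := c_le1 x; rewrite ler_norml => /andP[c1 _].
    have -> : h x = r * (1 + e * c x) by rewrite /h; ring.
    apply: mulr_ge0; first exact: ltW.
    have : e * -1 <= e * c x by rewrite ler_wpM2l// ltW.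
    by lra.
  - rewrite intD//; last exact/bmeas_intg/bmeas_cst.
    by rewrite int_cst// rho_inf_mass// intZ// c_int mulr0 addr0.
  - exact/bmeas_intg/bmeasX.
rewrite -subr_lt0 energy_diff.
set C2 := \int[mu]_x (c x ^+ 2); have C20 : 0 < C2 := c2_gt0.
have C3 : \int[mu]_x (c x ^+ 3) <= C2.
  apply: int_le => // x; rewrite exprS ler_piMl ?sqr_ge0//.
  by apply: le_trans (c_le1 x); exact: ler_norm.
have C4 : \int[mu]_x (c x ^+ 4) <= C2.
  apply: int_le => // x; have -> : c x ^+ 4 = c x ^+ 2 * c x ^+ 2 by ring.
  rewrite ler_piMl ?sqr_ge0// -real_normK ?num_real//.
  by rewrite -[leRHS](expr1n _ 2) lerXn2r ?nnegrE.
have I4 : \int[mu]_x (h x ^+ 4) - r ^+ 3 = r ^+ 4 * (6 * e ^+ 2 * C2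
    + 4 * e ^+ 3 * (\int[mu]_x (c x ^+ 3)) + e ^+ 4 * (\int[mu]_x (c x ^+ 4))).
  pose s : seq (R * (T -> R)) := [:: (r ^+ 4, fun x => c x ^+ 0); (4 * r ^+ 4 * e, c);
    (6 * r ^+ 4 * e ^+ 2, fun x => c x ^+ 2); (4 * r ^+ 4 * e ^+ 3, fun x => c x ^+ 3);
    (r ^+ 4 * e ^+ 4, fun x => c x ^+ 4)].
  have [_ es] := @int_lincomb _ _ _ mu s (conj (bX 0) (conj ic (conj (bX 2) (conj (bX 3) (conj (bX 4) I))))).
  rewrite (@int_eq _ _ _ mu _ (lincomb s)); last by move=> x; rewrite /s /h /=; ring.
  rewrite es /s /= c_int.
  have -> : \int[mu]_x (c x ^+ 0) = L ^+ d by rewrite -torus_mass//; apply: int_eq => x.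
  have e4 : r ^+ 4 * L ^+ d = r ^+ 3 by exact: rho_inf_pow_mass.
  by rewrite e4 -/C2; ring.
have IW : interaction L W h = - (4 * r ^+ 4 * a * e ^+ 2) * C2.
  rewrite /interaction.
  have E x : \int[mu]_y (W (vec x - vec y) * h y) = r * e * coefv L W k * c x.
    rewrite conv_shift// (@int_eq _ _ _ mu _ (fun y => r * e * (W (vec x - vec y) * c y))); last first.
      by move=> y; ring.
    by rewrite intZ ?conv_eigen ?mulrA//; exact: intgM.
  rewrite (@int_eq _ _ _ mu _ (fun x => (r * e * coefv L W k * r) * c x
     + (r * e * coefv L W k * (r * e)) * c x ^+ 2)); last first.
    by move=> x; rewrite E /h; ring.
  rewrite intD ?intZ//; [|exact: intgZ|exact: intgZ].
  by rewrite c_int wk -/C2; ring.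
rewrite I4 IW.
set D3 := \int[mu]_x (c x ^+ 3) in C3 *; set D4 := \int[mu]_x (c x ^+ 4) in C4 *.
have p3 : e ^+ 3 * D3 <= e ^+ 3 * C2 by rewrite ler_wpM2l// exprn_ge0// ltW.
have p4 : e ^+ 4 * D4 <= e ^+ 3 * C2.
  apply: (@le_trans _ _ (e ^+ 4 * C2)); first by rewrite ler_wpM2l// exprn_ge0// ltW.
  by rewrite ler_wpM2r ?(ltW C20)// exprS ler_piMl// exprn_ge0// ltW.
have q : b / 3 * (6 * e ^+ 2 * C2 + 4 * e ^+ 3 * D3 + e ^+ 4 * D4) <=
   b / 3 * (6 * e ^+ 2 * C2 + 5 * (e ^+ 3 * C2)).
  rewrite ler_wpM2l ?divr_ge0 ?(ltW bp)//; lra.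
have -> : b / 3 * (r ^+ 4 * (6 * e ^+ 2 * C2 + 4 * e ^+ 3 * D3 + e ^+ 4 * D4)) +
    2^-1 * (- (4 * r ^+ 4 * a * e ^+ 2) * C2) =
   r ^+ 4 * (b / 3 * (6 * e ^+ 2 * C2 + 4 * e ^+ 3 * D3 + e ^+ 4 * D4) - 2 * a * e ^+ 2 * C2) by field.
rewrite pmulr_rlt0 ?exprn_gt0// subr_lt0; apply: le_lt_trans q _.
have -> : b / 3 * (6 * e ^+ 2 * C2 + 5 * (e ^+ 3 * C2)) =
   (2 * b + 5 / 3 * (b * e)) * (e ^+ 2 * C2) by field.
rewrite -[ltRHS]mulrA ltr_pM2r; last by rewrite mulr_gt0// exprn_gt0.
by lra.
Qed.

End instability.
End variational.

(** * Oscillation of a minimiser *)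

Section level_sets.
Context dT (T : measurableType dT) (R : realType) (g : T -> R).
Hypothesis mg : measurable_fun setT g.

Lemma measurable_superlevel a : measurable [set x | a <= g x].
Proof.
rewrite -[X in measurable X]setTI (_ : [set x | _] = g @^-1` `[a, +oo[).
  by apply: mg => //; exact: measurable_itv.
by apply/seteqP; split => x /=; rewrite in_itv /= andbT.
Qed.

Lemma measurable_sublevel a : measurable [set x | g x <= a].
Proof.
rewrite -[X in measurable X]setTI (_ : [set x | _] = g @^-1` `]-oo, a]).
  by apply: mg => //; exact: measurable_itv.
by apply/seteqP; split => x /=; rewrite in_itv.
Qed.

End level_sets.

Section oscillation.
Variables (R : realType) (L : R) (d : nat).
Hypothesis L0 : 0 < L.
Local Notation T := (points R d).
Local Notation mu := (torus_measure L d).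
Local Notation r := (rho_inf d L).

(** Pointwise, either the absolute value of h is at most e, or h^4 exceeds e^3
   times it. *)
Lemma int_abs_le_quartic (h : T -> R) (e : R) : 0 < e -> intg mu h ->
  intg mu (fun x => h x ^+ 4) ->
  \int[mu]_x `|h x| <= e * L ^+ d + e^-1 ^+ 3 * \int[mu]_x (h x ^+ 4).
Proof.
move=> e0 ih ih4.
rewrite -int_cst// -intZ// -intD; last 2 first.
- exact/bmeas_intg/bmeas_cst.
- exact: intgZ.
apply: int_le; first exact: intg_norm.
  by apply: intgD; [exact/bmeas_intg/bmeas_cst | exact: intgZ].
move=> x; have h4 : 0 <= h x ^+ 4 by exact: exprn_even_ge0.
have ei : 0 < e^-1 ^+ 3 by rewrite exprn_gt0// invr_gt0.
have [he|eh] := leP `|h x| e.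
  by rewrite ler_wpDr// mulr_ge0// ltW.
have -> : h x ^+ 4 = `|h x| ^+ 3 * `|h x|.
  by rewrite -exprSr -normrX ger0_norm.
apply: (ler_wpDl (ltW e0)); rewrite mulrA -exprMn; apply: ler_peMl => //.
by rewrite exprn_ege1// mulrC ler_pdivlMr// mul1r ltW.
Qed.

Lemma mu_pos : (0 < mu setT)%E.
Proof.
have e : mu setT = (L ^+ d)%:E by apply: torus_measure_setT; exact: ltW.
by apply: (@eq_ind_r _ _ (fun x => (0 < x)%E) _ _ e); rewrite lte_fin exprn_gt0.
Qed.

Lemma zero_mean_nonpos (h : T -> R) : intg mu h -> \int[mu]_x h x = 0 ->
  (0 < mu [set x | (h x <= 0)%R])%E.
Proof.
move=> ih h0; rewrite lt0e measure_ge0 andbT; apply/eqP => z.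
have mh := intg_meas ih.
have mN : measurable [set x | h x <= 0] := measurable_sublevel mh 0.
have pos : \forall x \ae mu, 0 < h x.
  exists [set x | h x <= 0]; split => // x /= /negP; by rewrite -leNgt.
have : (\int[mu]_x `|(h x)%:E|)%E = 0%E.
  transitivity (\int[mu]_x (h x)%:E)%E.
    apply: ae_eq_integral => //.
    - by apply: measurableT_comp => //; exact/measurable_EFinP.
    - exact/measurable_EFinP.
    - by apply: filterS pos => x hx _ /=; rewrite gtr0_norm.
  by rewrite -[LHS]fineK ?h0//; [rewrite -[fine _]/(\int[mu]_x h x) h0 | exact: integrable_fin_num].
move=> /(ae_eq_integral_abs mu measurableT ((measurable_EFinP _ _).2 mh)) hz.
have : \forall x \ae mu, False.
  apply: filterS2 pos hz => x hx /(_ Logic.I) /= [] e; by rewrite e ltxx in hx.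
move=> [N [mN0 N0 sN]]; have : (mu setT <= mu N)%E.
  by apply: le_measure; rewrite ?inE//; move=> x _; apply: sN.
by rewrite N0 leNgt mu_pos.
Qed.

Variable W : 'rV[R]_d -> R.
Hypotheses (cW : continuous W) (sW : reflection_periodic L W).
Hypothesis W0 : \int[mu]_x W (vec x) = 0.
Variable B : R.
Hypothesis WB : forall z, `|W z| <= B.

Let bW : bmeas (fun z : T * T => W (vec z.1 - vec z.2)).
Proof. exact: (bmeas_vec_diff L0 cW sW). Qed.

Let bW1 x : bmeas (fun y : T => W (vec x - vec y)).
Proof. exact: (bmeas_section1 (K := fun x y : T => W (vec x - vec y)) bW x). Qed.

Let B0 : 0 <= B. Proof. exact: le_trans (WB 0). Qed.

Definition potential (g : T -> R) (x : T) := \int[mu]_y (W (vec x - vec y) * g y).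

Lemma potential_bmeas g : intg mu g -> bmeas (potential g).
Proof. exact: (kernel_bmeas (K := fun x y : T => W (vec x - vec y)) bW). Qed.

Lemma potential_bound g x : intg mu g -> `|potential g x| <= B * \int[mu]_y `|g y|.
Proof.
move=> ig; rewrite (le_trans (int_norm (intgM (bW1 x) ig)))// -intZ; last exact: intg_norm.
apply: int_le; first exact/intg_norm/intgM.
  exact/intgZ/intg_norm.
by move=> y; rewrite normrM ler_wpM2r.
Qed.

Lemma potential_sym f g : intg mu f -> intg mu g ->
  \int[mu]_x (f x * potential g x) = \int[mu]_x (g x * potential f x).
Proof.
move=> If Ig; rewrite (kernel_adj (K := fun x y : T => W (vec x - vec y)) bW If Ig).
apply: int_eq => x; congr (_ * _); apply: int_eq => y; congr (_ * _).
apply: sW => i; exists true, 0; by rewrite mulr0z mulr0 addr0 mulN1r !mxE opprB.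
Qed.

Lemma interaction_perturb g psi t : intg mu g -> bmeas psi ->
  interaction L W (fun x => g x + t * psi x) = interaction L W g +
    2 * t * (\int[mu]_x (psi x * potential g x)) + t ^+ 2 * (\int[mu]_x (psi x * potential psi x)).
Proof.
move=> ig bpsi; have ip := bmeas_intg mu bpsi.
have bpg := potential_bmeas ig; have bpp := potential_bmeas ip.
have E x : \int[mu]_y (W (vec x - vec y) * (g y + t * psi y)) = potential g x + t * potential psi x.
  rewrite /potential -intZ; last exact: intgM.
  rewrite -intD; last 2 first.
  - exact: intgM.
  - by apply: intgZ; exact: intgM.
  by apply: int_eq => y; ring.
have i1 : intg mu (fun x => g x * potential g x).
  by under eq_fun do rewrite mulrC; exact: intgM.
have i2 : intg mu (fun x => g x * potential psi x).
  by under eq_fun do rewrite mulrC; exact: intgM.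
have i3 : intg mu (fun x => psi x * potential g x) by exact/bmeas_intg/bmeasM.
have i4 : intg mu (fun x => psi x * potential psi x) by exact/bmeas_intg/bmeasM.
have [_ e] := @int_lincomb _ _ _ mu [:: (1, fun x => g x * potential g x);
  (t, fun x => g x * potential psi x); (t, fun x => psi x * potential g x);
  (t ^+ 2, fun x => psi x * potential psi x)] (conj i1 (conj i2 (conj i3 (conj i4 I)))).
rewrite /interaction (@int_eq _ _ _ mu _ (lincomb [:: (1, fun x => g x * potential g x);
  (t, fun x => g x * potential psi x); (t, fun x => psi x * potential g x);
  (t ^+ 2, fun x => psi x * potential psi x)])); last by move=> x; rewrite E /=; ring.
rewrite e /= (potential_sym ig ip) -/(potential g).
have alg (i p q : R) : 1 * i + (t * p + (t * p + (t ^+ 2 * q + 0))) =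
  i + 2 * t * p + t ^+ 2 * q by ring.
exact: alg.
Qed.

(** First variation along psi, which moves a unit of mass from {g >= alpha} to
   {g <= s}. The potential of g is bounded by B times the L^1 distance of g to
   r, because W has mean zero. The inequality for t tending to 0 is the claim.
   *)
Lemma oscillation b g alpha s : 0 < b -> admissible L g ->
  (forall h, admissible L h -> energy L W b^-1 g <= energy L W b^-1 h) ->
  0 <= s -> s < alpha ->
  (0 < mu [set x | (alpha <= g x)%R])%E -> (0 < mu [set x | (g x <= s)%R])%E ->
  4 * b / 3 * (alpha ^+ 3 - s ^+ 3) <= 2 * (B * \int[mu]_x `|g x - r|).
Proof.
move=> b0 ag gmin s0 sa mA mS; have [ig g0 g1 ig4] := ag.
have mg := intg_meas ig.
set A := [set x | alpha <= g x] in mA; set S := [set x | g x <= s] in mS.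
have meA : measurable A := measurable_superlevel mg alpha.
have meS : measurable S := measurable_sublevel mg s.
have bi (E : set T) : measurable E -> bmeas (\1_E : T -> R).
  move=> mE; split; first exact: measurable_indic.
  by exists 1 => x; rewrite indicE; case: (_ \in _); rewrite ?normr1 ?normr0.
have inti (E : set T) : measurable E -> \int[mu]_x (\1_E x) = fine (mu E).
  by move=> mE; rewrite /Rintegral integral_indic// setIT.
pose nA := fine (mu A); pose nS := fine (mu S).
have nA0 : 0 < nA by rewrite fine_gt0// mA ltey_eq fin_num_measure.
have nS0 : 0 < nS by rewrite fine_gt0// mS ltey_eq fin_num_measure.
(* Normalised so that psi has integral zero and its absolute value has
   integral at most 2. *)
pose psi x : R := nS^-1 * \1_S x - nA^-1 * \1_A x.
have i1 : intg mu (fun x => nS^-1 * \1_S x) by apply/intgZ/bmeas_intg/bi.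
have i2 : intg mu (fun x => nA^-1 * \1_A x) by apply/intgZ/bmeas_intg/bi.
have e1 : \int[mu]_x (nS^-1 * \1_S x) = 1.
  by rewrite intZ ?inti// ?mulVf ?gt_eqF//; exact/bmeas_intg/bi.
have e2 : \int[mu]_x (nA^-1 * \1_A x) = 1.
  by rewrite intZ ?inti// ?mulVf ?gt_eqF//; exact/bmeas_intg/bi.
have bpsi : bmeas psi.
  by apply: bmeasB; apply: bmeasM; try exact: bmeas_cst; exact: bi.
have ipsi := bmeas_intg mu bpsi.
have psi0 : \int[mu]_x psi x = 0 by rewrite intB// e1 e2 subrr.
have psiE x : psi x = if x \in S then nS^-1 else if x \in A then - nA^-1 else 0.
  rewrite /psi !indicE; case: (boolP (x \in S)) => [/set_mem xS|xS] /=.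
    have -> : x \in A = false.
      by apply/negP => /set_mem xA; have := le_lt_trans (le_trans xA xS) sa; rewrite ltxx.
    by rewrite mulr1 mulr0 subr0.
  by case: (x \in A); rewrite ?mulr0 ?mulr1 sub0r ?oppr0.
have psi1 : \int[mu]_x `|psi x| <= 2.
  have -> : 2 = \int[mu]_x (nS^-1 * \1_S x + nA^-1 * \1_A x) :> R by rewrite intD// e1 e2; ring.
  apply: int_le; [exact: intg_norm | exact: intgD |].
  have pE (E : set T) n x : 0 < n -> `|n^-1 * \1_E x| <= n^-1 * \1_E x :> R.
    move=> n0; rewrite ger0_norm//; apply: mulr_ge0; first by rewrite invr_ge0 ltW.
    by rewrite indicE ler0n.
  by move=> x; rewrite (le_trans (ler_normB _ _))// lerD// pE.
set eta := B * \int[mu]_x `|g x - r|.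
have igr : intg mu (fun x => g x - r) by apply: intgB => //; exact/bmeas_intg/bmeas_cst.
have eta_pot x : `|potential g x| <= eta.
  have -> : potential g x = potential (fun y => g y - r) x.
    rewrite /potential -(conv_shift L0 cW sW W0 r x igr).
    by apply: int_eq => y; congr (_ * _); ring.
  exact: potential_bound.
have eta0 : 0 <= eta by rewrite mulr_ge0//; apply: int_ge0.
have pg : \int[mu]_x (psi x * potential g x) <= 2 * eta.
  have ipg := bmeas_intg mu (bmeasM bpsi (potential_bmeas ig)).
  apply: (le_trans (ler_norm _)); apply: (le_trans (int_norm ipg)).
  apply: (@le_trans _ _ (eta * \int[mu]_x `|psi x|)); last first.
    by rewrite mulrC ler_wpM2r.
  rewrite -intZ; last exact: intg_norm.
  apply: int_le; [exact: intg_norm | exact/intgZ/intg_norm |].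
  by move=> x; rewrite normrM mulrC ler_wpM2r.
have pp : \int[mu]_x (psi x * potential psi x) <= 4 * B.
  have ipp := bmeas_intg mu (bmeasM bpsi (potential_bmeas ipsi)).
  apply: (le_trans (ler_norm _)); apply: (le_trans (int_norm ipp)).
  apply: (@le_trans _ _ ((2 * B) * \int[mu]_x `|psi x|)); last first.
    have -> : 4 * B = (2 * B) * 2 :> R by ring.
    by rewrite ler_wpM2l// mulr_ge0.
  rewrite -intZ; last exact: intg_norm.
  apply: int_le; [exact: intg_norm | exact/intgZ/intg_norm |].
  move=> x; rewrite normrM mulrC ler_wpM2r//.
  by rewrite (le_trans (potential_bound x ipsi))// mulrC ler_wpM2r.
(* t * phi t bounds the energy difference along g + t psi from above. *)
pose phi t := 4 * b / 3 * ((s + t / nS) ^+ 3 - (alpha - t / nA) ^+ 3) + 2 * eta + 2 * B * t.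
have a0 : 0 < alpha by exact: le_lt_trans sa.
have phi_ge0 t : 0 < t -> t <= alpha * nA -> 0 <= phi t.
  move=> t0 tA; pose gt x := g x + t * psi x.
  have tnA : t / nA <= alpha by rewrite ler_pdivrMr.
  have tnS : 0 <= t / nS by apply: divr_ge0; exact: ltW.
  have agt : admissible L gt.
    split.
    - by apply: intgD => //; exact: intgZ.
    - move=> x; rewrite /gt psiE; case: ifPn => _; first by rewrite addr_ge0.
      case: ifPn => [/set_mem xA|_]; last by rewrite mulr0 addr0.
      by rewrite mulrN subr_ge0 (le_trans tnA).
    - by rewrite intD ?intZ ?psi0 ?mulr0 ?addr0//; exact: intgZ.
    - have := intg_quartic_diff ig ig4 (bmeasM (bmeas_cst T (- t)) bpsi).
      by congr intg; apply/funext => x; rewrite mulNr opprK.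
  have [igt gt0 _ igt4] := agt.
  have quart : \int[mu]_x (gt x ^+ 4) <= \int[mu]_x (g x ^+ 4) +
      4 * t * ((s + t / nS) ^+ 3 - (alpha - t / nA) ^+ 3).
    have -> : 4 * t * ((s + t / nS) ^+ 3 - (alpha - t / nA) ^+ 3) =
      \int[mu]_x (4 * t * (s + t / nS) ^+ 3 * (nS^-1 * \1_S x) -
        4 * t * (alpha - t / nA) ^+ 3 * (nA^-1 * \1_A x)).
      rewrite intB; [|exact: intgZ|exact: intgZ].
      by rewrite (intZ _ i1) (intZ _ i2) e1 e2; ring.
    rewrite -intD//; last by apply: intgB; exact: intgZ.
    apply: int_le => //; first by apply: intgD => //; apply: intgB; exact: intgZ.
    move=> x; have := quartic_tangent (g x) (gt x).
    have q4 : 0 <= (g x - gt x) ^+ 4 by exact: exprn_even_ge0.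
    suff : 4 * gt x ^+ 3 * (t * psi x) <=
      4 * t * (s + t / nS) ^+ 3 * (nS^-1 * \1_S x) -
      4 * t * (alpha - t / nA) ^+ 3 * (nA^-1 * \1_A x).
      have -> : g x - gt x = - (t * psi x) by rewrite /gt; ring.
      have q0 : 0 <= (- (t * psi x)) ^+ 4 by exact: exprn_even_ge0.
      have lin (y4 x4 c p e q : R) : 0 <= q -> c * p <= e ->
        y4 + c * (- p) + 3^-1 * q <= x4 -> y4 <= x4 + e by lra.
      by move=> h1 h2; exact: (lin _ _ _ _ _ _ q0 h1 h2).
    rewrite psiE !indicE; have gx0 := gt0 x; have gtE : gt x = g x + t * psi x by [].
    case: ifPn => [xS|xS] /=.
      have -> : x \in A = false.
        apply/negP => /set_mem xA; move/set_mem : xS => xS.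
        by have := le_lt_trans (le_trans xA xS) sa; rewrite ltxx.
      rewrite mulr1 !mulr0 subr0.
      have : gt x ^+ 3 <= (s + t / nS) ^+ 3.
        rewrite lerXn2r// ?nnegrE ?addr_ge0// gtE psiE xS lerD//.
        exact: (set_mem xS).
      have tS : 0 <= 4 * t * nS^-1 by rewrite mulr_ge0 ?mulr_ge0 ?invr_ge0 ?ltW.
      move=> /(ler_wpM2l tS) h.
      have -> : 4 * gt x ^+ 3 * (t / nS) = 4 * t * nS^-1 * gt x ^+ 3 by ring.
      by apply: le_trans h _; rewrite le_eqVlt; apply/orP; left; apply/eqP; ring.
    case: ifPn => [xA|xA] /=; last by rewrite !mulr0 subr0.
    rewrite mulr1 !mulr0 sub0r.
    have : (alpha - t / nA) ^+ 3 <= gt x ^+ 3.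
      rewrite lerXn2r// ?nnegrE ?subr_ge0// gtE psiE (negbTE xS) xA mulrN lerD2r.
      exact: (set_mem xA).
    have tS : 0 <= 4 * t * nA^-1 by rewrite mulr_ge0 ?mulr_ge0 ?invr_ge0 ?ltW.
    move=> /(ler_wpM2l tS) h.
    have -> : 4 * gt x ^+ 3 * (t * - nA^-1) = - (4 * t * nA^-1 * gt x ^+ 3) by ring.
    have -> : - (4 * t * (alpha - t / nA) ^+ 3 * nA^-1) = - (4 * t * nA^-1 * (alpha - t / nA) ^+ 3) by ring.
    by rewrite lerN2.
  have := gmin _ agt; rewrite /energy invrK (interaction_perturb t ig bpsi).
  set X4 := \int[mu]_x (g x ^+ 4) in quart *; set Y4 := \int[mu]_x (gt x ^+ 4) in quart *.
  set I0 := interaction L W g.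
  set P1 := \int[mu]_x (psi x * potential g x) in pg *.
  set P2 := \int[mu]_x (psi x * potential psi x) in pp *.
  move=> hE.
  have h1 : b / 3 * Y4 <= b / 3 * (X4 + 4 * t * ((s + t / nS) ^+ 3 - (alpha - t / nA) ^+ 3)).
    by rewrite ler_wpM2l ?divr_ge0 ?(ltW b0).
  have h2 : t * P1 <= t * (2 * eta) by rewrite ler_wpM2l// ltW.
  have h3 : t ^+ 2 * P2 <= t ^+ 2 * (4 * B) by rewrite ler_wpM2l// exprn_ge0// ltW.
  rewrite -(pmulr_rge0 _ t0) /phi.
  have alg (D : R) : t * (4 * b / 3 * D + 2 * eta + 2 * B * t) =
      b / 3 * (4 * t * D) + t * (2 * eta) + 2^-1 * (t ^+ 2 * (4 * B)) by field.
  rewrite alg.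
  move: hE h1; set Z := 4 * t * (_ - _) => hE h1.
  by rewrite mulrDr in h1; move: hE h1 h2 h3; lra.
have cphi : {for 0, continuous phi}.
  rewrite /phi; apply: cvgD; last by apply: cvgM; [exact: cvg_cst | exact: cvg_id].
  apply: cvgD; last exact: cvg_cst.
  have c1 (u : R) : t * u @[t --> (0 : R)] --> 0 * u.
    by apply: cvgM; [exact: cvg_id | exact: cvg_cst].
  apply: cvgM; first exact: cvg_cst.
  have cube (u : R -> R) (v : R) : u t @[t --> (0 : R)] --> v -> u t ^+ 3 @[t --> (0 : R)] --> v ^+ 3.
    by move=> uv; apply: cvgM => //; apply: cvgM.
  apply: cvgB; apply: cube.
    by apply: cvgD; [exact: cvg_cst | exact: c1].
  by apply: cvgB; [exact: cvg_cst | exact: c1].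
have : 0 <= phi 0.
  rewrite leNgt; apply/negP => neg.
  have /nbhs_ballP [e /= e0 he] : nbhs (0 : R) [set t | phi t < 0].
    exact: (cvgr_lt _ cphi 0 neg).
  pose t := Num.min (e / 2) (alpha * nA).
  have t0 : 0 < t by rewrite lt_min divr_gt0//= mulr_gt0.
  have : phi t < 0.
    apply: he; rewrite /ball /= sub0r normrN gtr0_norm//.
    by apply: (@le_lt_trans _ _ (e / 2)); [rewrite ge_min lexx | rewrite ltr_pdivrMr// ltr_pMr// ltr1n].
  by rewrite ltNge phi_ge0// ge_min lexx orbT.
rewrite /phi !mul0r addr0 subr0 mulr0 addr0.
by move=> h; rewrite -subr_ge0; apply: le_trans h _; rewrite le_eqVlt; apply/orP; left; apply/eqP; ring.
Qed.

End oscillation.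

(** * The transition *)

Section conclusion.
Variables (R : realType) (L : R) (d : nat).
Hypothesis L0 : 0 < L.
Local Notation T := (points R d).
Local Notation mu := (torus_measure L d).
Local Notation r := (rho_inf d L).

Variable W : 'rV[R]_d -> R.
Hypotheses (cW : continuous W) (sW : reflection_periodic L W).
Hypothesis W0 : \int[mu]_x W (vec x) = 0.
Variables (k : 'I_d -> nat) (a : R).
Hypotheses (k0 : exists i, k i != 0%N) (a0 : 0 < a).
Hypothesis wk : coefv L W k = - (4 * r ^+ 2 * a).
(* The gap at beta^-1 = a. *)
Hypothesis key : forall g : T -> R, admissible L g ->
  a / 72 * (\int[mu]_x ((g x - r) ^+ 4)) <=
  a / 3 * (\int[mu]_x (g x ^+ 4) - r ^+ 3) + 2^-1 * interaction L W g.

Lemma intg_quartic_dist g : admissible L g -> intg mu (fun x => (g x - r) ^+ 4).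
Proof. by move=> [ig _ _ ig4]; apply: intg_quartic_diff => //; exact: bmeas_cst. Qed.

(** The tangent inequality at the constant r. *)
Lemma quartic_ge_dist g : admissible L g ->
  r ^+ 3 + 3^-1 * (\int[mu]_x ((g x - r) ^+ 4)) <= \int[mu]_x (g x ^+ 4).
Proof.
move=> ag; have iD := intg_quartic_dist ag; have [ig g0 g1 ig4] := ag.
have i1 : intg mu (fun=> 1 : R) by exact/bmeas_intg/bmeas_cst.
pose s : seq (R * (T -> R)) := [:: (- (3 * r ^+ 4), fun=> 1); (4 * r ^+ 3, g);
  (3^-1, fun x => (g x - r) ^+ 4)].
have [iS es] := @int_lincomb _ _ _ mu s (conj i1 (conj ig (conj iD I))).
have -> : r ^+ 3 + 3^-1 * (\int[mu]_x ((g x - r) ^+ 4)) = \int[mu]_x lincomb s x.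
  rewrite es /s /= g1 torus_mass//.
  have e4 : r ^+ 4 * L ^+ d = r ^+ 3 by exact: rho_inf_pow_mass.
  have -> : - (3 * r ^+ 4) * L ^+ d = - (3 * (r ^+ 4 * L ^+ d)) by ring.
  by rewrite e4; ring.
apply: int_le => // x; apply: le_trans (quartic_tangent (g x) r).
by rewrite /s /= le_eqVlt; apply/orP; left; apply/eqP; ring.
Qed.

Lemma quartic_ge g : admissible L g -> r ^+ 3 <= \int[mu]_x (g x ^+ 4).
Proof.
move=> /quartic_ge_dist; apply: le_trans; rewrite lerDl mulr_ge0//.
by apply: int_ge0 => x; exact: exprn_even_ge0.
Qed.

Lemma quartic_le g : admissible L g ->
  \int[mu]_x (g x ^+ 4) <= 8 * \int[mu]_x ((g x - r) ^+ 4) + 8 * r ^+ 3.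
Proof.
move=> ag; have iD := intg_quartic_dist ag; have [ig g0 g1 ig4] := ag.
have -> : 8 * r ^+ 3 = \int[mu]_x (8 * r ^+ 4).
  by rewrite int_cst// -mulrA rho_inf_pow_mass.
rewrite -intZ// -intD; [|exact: intgZ|exact/bmeas_intg/bmeas_cst].
apply: int_le => //.
  by apply: intgD; [exact: intgZ|exact/bmeas_intg/bmeas_cst].
move=> x; have := quartic_sum (g x - r) (- r).
by rewrite opprK subrK (_ : (- r) ^+ 4 = r ^+ 4)//; ring.
Qed.

(** Comparison of the gap at a with minimality at b; for b >= a the right-hand
   side is nonpositive. *)
Lemma minimiser_dist b g : admissible L g ->
  energy L W b^-1 g <= energy L W b^-1 (fun=> r) ->
  a / 72 * (\int[mu]_x ((g x - r) ^+ 4)) <= (a - b) / 3 * (\int[mu]_x (g x ^+ 4) - r ^+ 3).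
Proof.
move=> ag; rewrite -subr_le0 energy_diff// invrK => h.
have := key ag; set X := _ - r ^+ 3 in h *; set J := interaction L W g in h *.
set D := \int[mu]_x _.
by move: h; lra.
Qed.

Lemma zero_dist_uniform (rho : probability T R) g : admissible L g -> has_density L rho g ->
  \int[mu]_x ((g x - r) ^+ 4) <= 0 -> same_measure rho (uniform_measure d L).
Proof.
move=> ag rg D0; have iD := intg_quartic_dist ag; have [ig _ _ _] := ag.
apply: (same_density_ae ig (bmeas_intg mu (bmeas_cst T r)) rg (uniform_has_density L0)).
have mD := intg_meas iD.
have q0 x : 0 <= (g x - r) ^+ 4 by exact: exprn_even_ge0.
have D00 : \int[mu]_x ((g x - r) ^+ 4) = 0.
  by apply/eqP; rewrite eq_le D0 int_ge0.
have z : (\int[mu]_x `|((g x - r) ^+ 4)%:E|)%E = 0%E.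
  rewrite (eq_integral (EFin \o (fun x => (g x - r) ^+ 4))); last first.
    by move=> x _ /=; rewrite ger0_norm.
  by rewrite -[LHS]fineK; [congr EFin | exact: integrable_fin_num].
move: z => /(ae_eq_integral_abs mu measurableT ((measurable_EFinP _ _).2 mD)).
apply: filterS => x /(_ Logic.I) /= [] /eqP.
by rewrite expf_eq0 /= subr_eq0 => /eqP.
Qed.

Lemma uniform_unique b (rho : probability T R) : a <= b ->
  is_minimiser L 4 W b^-1 rho -> same_measure rho (uniform_measure d L).
Proof.
move=> ab /(minimiser_density L0 cW sW) [g [ag rg gmin]].
apply: (zero_dist_uniform ag rg).
have := minimiser_dist ag (gmin _ (uniform_admissible d L0)).
have X0 : 0 <= \int[mu]_x (g x ^+ 4) - r ^+ 3 by rewrite subr_ge0 quartic_ge.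
have h : (a - b) / 3 * (\int[mu]_x (g x ^+ 4) - r ^+ 3) <= 0.
  by rewrite mulr_le0_ge0// pmulr_lle0// subr_le0.
move=> /le_trans /(_ h); rewrite pmulr_rle0// divr_gt0//.
Qed.

(** Before a^-1 no minimiser other than the uniform one exists, and after it
   the uniform one is not a minimiser. *)
Lemma transition_point_eq beta_c : transition_point L 4 W beta_c -> beta_c = a^-1.
Proof.
move=> [bc0 _ cmin above]; apply/eqP; rewrite eq_le; apply/andP; split.
  rewrite leNgt; apply/negP => lt.
  have ba : beta_c^-1 < a by rewrite invf_plt.
  have [h ah] := instability L0 cW sW W0 k0 wk bc0 ba.
  rewrite ltNge; apply/negP; rewrite negbK.
  have [_ umin] := cmin.
  have [nu nuh] := admissible_probability ah; have [ih _ _ _] := ah.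
  have := umin _ (has_density_torus_dom L0 ih nuh).
  rewrite (free_energy_density L0 cW sW _ (uniform_admissible d L0) (uniform_has_density L0)).
  by rewrite (free_energy_density L0 cW sW _ ah nuh) lee_fin.
rewrite leNgt; apply/negP => lt.
pose beta := (beta_c + a^-1) / 2.
have b1 : beta_c < beta by rewrite midf_lt.
have b2 : beta < a^-1 by rewrite midf_lt.
have [rho rmin nsame] := above _ b1.
apply: nsame; apply: (@uniform_unique beta^-1); last by rewrite invrK.
have beta0 : 0 < beta by exact: lt_trans b1.
by rewrite -[leLHS]invrK lef_pV2 ?posrE ?invr_gt0// ltW.
Qed.

Lemma linfty_dist_le (rho : probability T R) g e : has_density L rho g -> intg mu g ->
  (\forall x \ae mu, `|g x - r| <= e) -> (linfty_dist L rho <= e%:E)%E.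
Proof.
move=> rg ig ge; rewrite /linfty_dist unlock /Lnorm mu_pos//.
apply/ess_supP; apply: filterS2 (has_density_ae ig rg) ge => x E h /=; rewrite E.
by rewrite lee_fin.
Qed.

(** For b = beta^-1 within tau of a, the quartic distance D of a minimiser is
   at most D0, and then its L^1 distance to r is so small that the oscillation
   bound contradicts g exceeding r + e' or staying below r - e' on a set of
   positive measure. One of the level sets {g <= r}, {g >= r} serves as the
   other set there; both have positive measure since g has mean r. *)
Lemma near_uniform e : 0 < e -> exists2 beta1, a^-1 < beta1 &
  forall beta (rho : probability T R), a^-1 < beta -> beta < beta1 ->
    is_minimiser L 4 W beta rho -> (linfty_dist L rho <= e%:E)%E.
Proof.
move=> ee0; have [B WB] := reflection_periodic_bounded L0 cW sW.
have r0 := rho_inf_gt0 d L0; have B0 : 0 <= B by exact: le_trans (WB 0).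
(* Keeps r - e' nonnegative. *)
pose e' := Num.min e r.
have e0 : 0 < e' by rewrite lt_min ee0.
have er : e' <= r by rewrite ge_min lexx orbT.
have ee : e' <= e by rewrite ge_min lexx.
have Ld0 : 0 < L ^+ d by rewrite exprn_gt0.
have B1 : 0 < B + 1 by rewrite ltr_wpDl.
(* d1 L^d and D0 / d1^3, whose sum bounds the L^1 distance, both equal a e'^3
   / (12 (B + 1)). *)
pose d1 := a * e' ^+ 3 / (12 * (B + 1) * L ^+ d).
have e30 : 0 < e' ^+ 3 by rewrite exprn_gt0.
have r30 : 0 < r ^+ 3 by rewrite exprn_gt0.
have B12 : 0 < 12 * (B + 1) by rewrite mulr_gt0.
have d10 : 0 < d1 by apply: divr_gt0; exact: mulr_gt0.
pose D0 := a * e' ^+ 3 * d1 ^+ 3 / (12 * (B + 1)).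
have d30 : 0 < d1 ^+ 3 by rewrite exprn_gt0.
have D00 : 0 < D0 by apply: divr_gt0 => //; apply: mulr_gt0 => //; exact: mulr_gt0.
(* The first bound absorbs the multiple of D on the right-hand side of the gap
   estimate, the second makes its constant part at most a D0 up to a factor.
   *)
pose tau := Num.min (a / 384) (D0 * a / (384 * r ^+ 3)).
have c384 : 0 < 384 :> R by rewrite ltr0n.
have r384 : 0 < 384 * r ^+ 3 := mulr_gt0 c384 r30.
have tau0 : 0 < tau.
  rewrite lt_min; apply/andP; split; first exact: divr_gt0 a0 c384.
  exact: divr_gt0 (mulr_gt0 D00 a0) r384.
have taua : tau <= a / 384 by rewrite ge_min lexx.
have tauD : 384 * tau * r ^+ 3 <= D0 * a.
  have : tau <= D0 * a / (384 * r ^+ 3) by rewrite ge_min lexx orbT.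
  by rewrite (ler_pdivlMr _ _ r384) mulrA [_ * 384]mulrC.
have ata : 0 < a - tau by move: a0 taua; lra.
exists (a - tau)^-1.
  by rewrite ltf_pV2 ?posrE ?gtrBl.
move=> beta rho ab b1 /(minimiser_density L0 cW sW) [g [ag rg gmin]].
have beta0 : 0 < beta by apply: lt_trans ab; rewrite invr_gt0.
pose b := beta^-1; have b0 : 0 < b by rewrite invr_gt0.
have ba : b < a by rewrite /b invf_plt.
have bt : a - tau < b by rewrite /b -[ltLHS]invrK ltf_pV2 ?posrE ?invr_gt0.
have bE : beta = b^-1 by rewrite /b invrK.
rewrite bE in gmin.
have := minimiser_dist ag (gmin _ (uniform_admissible d L0)).
have := quartic_le ag; have iD := intg_quartic_dist ag; have [ig g0 g1 ig4] := ag.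
set D := \int[mu]_x ((g x - r) ^+ 4); set X4 := \int[mu]_x (g x ^+ 4) => X4le hD.
have Dge : 0 <= D by apply: int_ge0 => x; exact: exprn_even_ge0.
have DD0 : D <= D0.
  have h1 : (a - b) / 3 * (X4 - r ^+ 3) <= (a - b) / 3 * (8 * D + 8 * r ^+ 3).
    by rewrite ler_wpM2l//; [rewrite divr_ge0 ?subr_ge0 ?ltW|rewrite lerBlDr (le_trans X4le)// lerDl ltW].
  have h2 : (a - b) * D <= a / 384 * D by rewrite ler_wpM2r//; move: bt taua; lra.
  have h3 : (a - b) * r ^+ 3 <= tau * r ^+ 3 by rewrite ler_wpM2r// ?ltW//; move: bt; lra.
  have h4 : a * D <= a * D0.
    have := le_trans hD h1.
    have -> : (a - b) / 3 * (8 * D + 8 * r ^+ 3) = 8 / 3 * ((a - b) * D) + 8 / 3 * ((a - b) * r ^+ 3) by field.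
    by move: h2 h3 tauD; lra.
  by rewrite -(ler_pM2l a0).
have igr : intg mu (fun x => g x - r) by apply: intgB => //; exact/bmeas_intg/bmeas_cst.
have L1 := int_abs_le_quartic L0 d10 igr iD.
set N1 := \int[mu]_x `|g x - r| in L1.
have N10 : 0 <= N1 by exact: int_ge0.
have BN : 2 * (B * N1) < 4 * b / 3 * e' ^+ 3.
  have h1 : (B + 1) * N1 <= (B + 1) * (d1 * L ^+ d + d1^-1 ^+ 3 * D) by rewrite ler_wpM2l// ltW.
  have h2 : (B + 1) * (d1 * L ^+ d) = a * e' ^+ 3 / 12.
    by rewrite /d1; field; rewrite ?gt_eqF.
  have h3 : (B + 1) * (d1^-1 ^+ 3 * D) <= a * e' ^+ 3 / 12.
    have -> : a * e' ^+ 3 / 12 = (B + 1) * (d1^-1 ^+ 3 * D0).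
      by rewrite /D0; field; rewrite ?gt_eqF.
    by rewrite ler_wpM2l ?(ltW B1)// ler_wpM2l// exprn_ge0// invr_ge0 ltW.
  have h4 : B * N1 <= (B + 1) * N1 by rewrite ler_wpM2r// lerDl.
  have h5 : a / 2 * e' ^+ 3 < b * e' ^+ 3 by rewrite ltr_pM2r//; move: bt taua a0; lra.
  have h6 : 0 < a * e' ^+ 3 by exact: mulr_gt0.
  by move: h1 h3 h4 h5 h6; rewrite mulrDr h2; lra.
have cube_up : e' ^+ 3 <= (r + e') ^+ 3 - r ^+ 3.
  have -> : (r + e') ^+ 3 - r ^+ 3 = e' ^+ 3 + 3 * r * e' * (r + e') by ring.
  by rewrite lerDl !mulr_ge0 ?addr_ge0 ?(ltW r0) ?(ltW e0).
have cube_dn : e' ^+ 3 <= r ^+ 3 - (r - e') ^+ 3.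
  have -> : r ^+ 3 - (r - e') ^+ 3 = e' ^+ 3 + 3 * r * e' * (r - e') by ring.
  by rewrite lerDl !mulr_ge0 ?subr_ge0 ?(ltW r0) ?(ltW e0).
have b43 : 0 < 4 * b / 3 by rewrite divr_gt0// mulr_gt0.
have osc := oscillation L0 cW sW W0 WB b0 ag gmin.
have mg := intg_meas ig.
have igr0 : \int[mu]_x (g x - r) = 0.
  by rewrite intB ?g1 ?int_cst// ?rho_inf_mass ?subrr//; exact/bmeas_intg/bmeas_cst.
have igr0' : \int[mu]_x (r - g x) = 0.
  by rewrite intB ?g1 ?int_cst// ?rho_inf_mass ?subrr//; exact/bmeas_intg/bmeas_cst.
have igr' : intg mu (fun x => r - g x) by apply: intgB => //; exact/bmeas_intg/bmeas_cst.
have mle : (0 < mu [set x | (g x <= r)%R])%E.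
  have := zero_mean_nonpos L0 igr igr0; congr (0 < mu _)%E.
  by apply/seteqP; split=> x /=; rewrite subr_le0.
have mge : (0 < mu [set x | (r <= g x)%R])%E.
  have := zero_mean_nonpos L0 igr' igr0'; congr (0 < mu _)%E.
  by apply/seteqP; split=> x /=; rewrite subr_le0.
have up0 : mu [set x | (r + e' <= g x)%R] = 0%E.
  apply/eqP; rewrite eq_le measure_ge0 andbT leNgt; apply/negP => pos.
  have := osc _ _ (ltW r0) (_ : r < r + e') pos mle; rewrite ltrDl => /(_ e0).
  apply/negP; rewrite -ltNge (lt_le_trans BN)// ler_wpM2l// ltW//.
have dn0 : mu [set x | (g x <= r - e')%R] = 0%E.
  apply/eqP; rewrite eq_le measure_ge0 andbT leNgt; apply/negP => pos.
  have re0 : 0 <= r - e' by rewrite subr_ge0.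
  have := osc _ _ re0 (_ : r - e' < r) mge pos; rewrite ltrBlDr ltrDl => /(_ e0).
  apply/negP; rewrite -ltNge (lt_le_trans BN)// ler_wpM2l// ltW//.
have meU := measurable_superlevel mg (r + e').
have meD := measurable_sublevel mg (r - e').
apply: (linfty_dist_le rg ig).
have aeU : \forall x \ae mu, g x < r + e'.
  by exists [set x | (r + e' <= g x)%R]; split => // x /= /negP; rewrite -leNgt.
have aeD : \forall x \ae mu, r - e' < g x.
  by exists [set x | (g x <= r - e')%R]; split => // x /= /negP; rewrite -leNgt.
apply: filterS2 aeU aeD => x h1 h2; rewrite ler_norml lerBlDl.
rewrite (le_trans (ltW h1)) ?lerD2l// andbT lerBrDl.
by rewrite (le_trans _ (ltW h2))// lerD2l lerN2.
Qed.

Lemma limf_esup_linfty (rho : R -> probability T R) :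
  (forall beta, a^-1 < beta -> is_minimiser L 4 W beta (rho beta)) ->
  limf_esup (fun beta => linfty_dist L (rho beta)) (at_right a^-1) = 0%E.
Proof.
move=> rmin; apply/eqP; rewrite eq_le; apply/andP; split.
  apply/lee_addgt0Pr => e e0; rewrite add0e.
  have [b1 ab1 h] := near_uniform e0.
  pose V := [set beta | a^-1 < beta < b1].
  apply: (@le_trans _ _ (ereal_sup ((fun beta => linfty_dist L (rho beta)) @` V))).
    apply: ereal_inf_lbound; exists V => //.
    near=> x; apply/andP; split; first by near: x; exact: nbhs_right_gt.
    by near: x; exact: nbhs_right_lt.
  apply: ge_ereal_sup => _ [beta /andP[h1 h2] <-].
  exact: (h _ _ h1 h2 (rmin _ h1)).
apply: le_ereal_inf_tmp => _ [V VF <-].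
have [x Vx] : V !=set0 by apply: filter_ex VF.
apply: (@le_trans _ _ (linfty_dist L (rho x))); last first.
  by apply: ereal_sup_ubound; exists x.
exact: Lnorm_ge0.
Unshelve. all: by end_near. Qed.

Lemma continuous_transition beta_c : transition_point L 4 W beta_c ->
  beta_c = a^-1 /\ continuous_transition_point L 4 W beta_c.
Proof.
move=> tp; have e := transition_point_eq tp; split => //.
split=> //.
- have [_ _ um _] := tp; split => // rho; rewrite e => rm.
  exact: (uniform_unique (lexx a)).
- by move=> rho; rewrite e; exact: limf_esup_linfty.
Qed.

End conclusion.

(** * Fourier coefficients and the thresholds *)

Section coefficients.
Variables (R : realType) (L : R) (d : nat).
Hypothesis L0 : 0 < L.
Local Notation T := (points R d).
Local Notation mu := (torus_measure L d).
Local Notation r := (rho_inf d L).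
Local Notation RM := (measurableTypeR R).
Local Notation Theta := (@Theta R d).

Definition freq (k : 'rV[int]_d) : 'I_d -> nat := fun i => absz (k 0 i).
Definition of_freq (m : 'I_d -> nat) : 'rV[int]_d := \row_i (m i)%:Z.

Lemma of_freqK m : freq (of_freq m) =1 m.
Proof. by move=> i; rewrite /freq mxE. Qed.

Lemma Nd_of_freq m : Nd (of_freq m).
Proof. by move=> i; rewrite mxE. Qed.

Definition basis_norm : R := L `^ (- (d%:R / 2)).

Lemma basis_norm_gt0 : 0 < basis_norm.
Proof. exact: powR_gt0. Qed.

Lemma basis_norm_sqr : basis_norm ^+ 2 = r.
Proof.
rewrite /basis_norm -powR_mulrn ?powR_ge0// -powRrM mulNr divfK// powRN powR_mulrn ?ltW//.
Qed.

Lemma rho_inf_powR : r `^ (5 / 2) = basis_norm ^+ 5.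
Proof.
rewrite -basis_norm_sqr -powR_mulrn ?(ltW basis_norm_gt0)// -powRrM -powR_mulrn ?(ltW basis_norm_gt0)//.
by congr (_ `^ _); field.
Qed.

Lemma Theta_sqr k : Theta k ^+ 2 = \prod_i theta_sq R (freq k i).
Proof.
rewrite /Theta -prodrXl; apply: eq_bigr => i _.
rewrite sqr_sqrtr; first by rewrite /theta_sq /freq absz_eq0.
by case: eqP => _ /=; lra.
Qed.

Lemma Theta_gt0 k : 0 < Theta k.
Proof.
rewrite /Theta; apply: prodr_gt0 => i _; rewrite sqrtr_gt0.
by case: eqP => _ /=; lra.
Qed.

Lemma e1_cosn (n : int) t : 0 <= n -> e1 L n t = cosn L `|n|%N t.
Proof.
move=> n0; rewrite /e1 /cosn /phase.
have nE : n%:~R = (`|n|%N)%:R :> R by rewrite -[in LHS](gez0_abs n0).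
case: ltP => [_|n0']; first by rewrite nE; congr cos; ring.
have -> : n = 0 by apply/eqP; rewrite eq_le n0' n0.
by rewrite eqxx absz0 mul0r cos0.
Qed.

Lemma fourierE k x : Nd k -> fourier L k x = basis_norm * Theta k * cosv L (freq k) x.
Proof.
by move=> kN; congr (_ * _); apply: eq_bigr => i _; rewrite e1_cosn//; exact: kN.
Qed.

(** On N^d the Fourier basis consists of products of cosines. *)
Lemma hatE W k : Nd k -> bmeas (fun x : T => W (vec x)) ->
  hat L W k = basis_norm * Theta k * coefv L W (freq k).
Proof.
move=> kN bW; rewrite /hat /inner /coefv -intZ; last first.
  by apply: bmeas_intg; apply: bmeasM => //; exact: cosv_bmeas.
by apply: int_eq => x; rewrite fourierE//; ring.
Qed.

Lemma cosn_orth s m : \int[circle_measure L]_t (cosn L s t * cosn L m t) =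
  (s == m)%:R * (L / theta_sq R s).
Proof.
have := cosn_reproduce L0 s m 0 0.
rewrite /phase mulr0 mulr0 addr0 cos0 mulr1 => <-.
apply: int_eq => t; rewrite sub0r cosnN; congr (_ * _).
by rewrite addr0.
Qed.

Lemma int_cos2 k m : m \in freq2 k ->
  \int[circle_measure L]_t (cosn L k t * cosn L k t * cosn L m t) =
  L / (theta_sq R k * theta_sq R m).
Proof.
move=> mk.
have bm n : intg (circle_measure L) (fun t : RM => cosn L n t * cosn L m t).
  by apply: bmeas_intg; apply: bmeasM; exact: cosn_bmeas.
rewrite (@int_eq _ _ _ (circle_measure L) _ (fun t : RM =>
  2^-1 * (cosn L (2 * k) t * cosn L m t + cosn L 0 t * cosn L m t))); last first.
  move=> t; rewrite -mulrDl [RHS]mulrA; congr (_ * _); rewrite /cosn cos_cos.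
  by rewrite subrr mul0r natrM (_ : 2 * k%:R * phase L t = k%:R * phase L t + k%:R * phase L t)//; ring.
rewrite intZ; last exact: intgD.
rewrite intD// !cosn_orth; move: mk; rewrite /freq2.
case: eqP => [->|/eqP k0]; rewrite !inE.
  by move=> /eqP ->; rewrite muln0 eqxx /theta_sq /=; field.
have m2 : theta_sq R k = 2 by rewrite /theta_sq (negbTE k0) subr0.
have m22 : theta_sq R (2 * k) = 2 by rewrite /theta_sq muln_eq0 (negbTE k0) subr0.
have m0 : theta_sq R 0 = 1 by rewrite /theta_sq /=; lra.
move=> /orP[] /eqP ->.
  by rewrite eqxx muln_eq0 (negbTE k0) m2 m0 orbF !mul0r !mul1r divr1 add0r mulr1 mulrC.
by rewrite eqxx eq_sym muln_eq0 (negbTE k0) m2 m22 orbF !mul0r !mul1r addr0; field.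
Qed.

Lemma int_cos3 k m : m \in freq3 k ->
  L / (theta_sq R k ^+ 3) <=
  \int[circle_measure L]_t (cosn L k t * cosn L k t * cosn L k t * cosn L m t) /\
  theta_sq R m = theta_sq R k.
Proof.
move=> mk.
have bm n : intg (circle_measure L) (fun t : RM => cosn L n t * cosn L m t).
  by apply: bmeas_intg; apply: bmeasM; exact: cosn_bmeas.
rewrite (@int_eq _ _ _ (circle_measure L) _ (fun t : RM =>
  4^-1 * (3 * (cosn L k t * cosn L m t) + cosn L (3 * k) t * cosn L m t))); last first.
  move=> t; rewrite [3 * _]mulrA -mulrDl [RHS]mulrA; congr (_ * _).
  rewrite /cosn; set u := k%:R * phase L t.
  have -> : (3 * k)%N%:R * phase L t = u + u + u by rewrite natrM /u; ring.
  rewrite [cos u * cos u]cos_cos subrr cos0 -mulrA mulrDl cos_cos mul1r.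
  have -> : u + u - u = u by ring.
  by field.
rewrite intZ; last by apply: intgD => //; exact: intgZ.
rewrite intD//; last exact: intgZ.
rewrite intZ// !cosn_orth; move: mk; rewrite /freq3.
case: eqP => [->|/eqP k0]; rewrite !inE.
  have m0 : theta_sq R 0 = 1 by rewrite /theta_sq /=; lra.
  move=> /eqP ->; rewrite muln0 eqxx m0 expr1n !mul1r divr1; split => //. lra.
have m2 : theta_sq R k = 2 by rewrite /theta_sq (negbTE k0) subr0.
have m3 : theta_sq R (3 * k) = 2 by rewrite /theta_sq muln_eq0 (negbTE k0) subr0.
have k3 : (3 * k == k)%N = false by apply/eqP; move: k0; lia.
have k3' : (k == 3 * k)%N = false by apply/eqP; move: k0; lia.
have e8 : L / 2 ^+ 3 = L / 8 by field.
move=> /orP[] /eqP ->; rewrite ?eqxx ?k3 ?k3' ?m2 ?m3 !mul0r !mul1r e8; split => //.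
  have -> : 4^-1 * (3 * (L / 2) + 0) = 3 * (L / 8) by field.
  by have L8 : 0 < L / 8; [exact: divr_gt0 | lra].
by rewrite mulr0 add0r le_eqVlt; apply/orP; left; apply/eqP; field.
Qed.

Lemma sact_id (k : 'rV[int]_d) : sact [ffun=> false] k = k.
Proof. by apply/rowP => i; rewrite !mxE ffunE mul1r. Qed.

Lemma smul_id : smul [ffun=> false] [ffun=> false] = [ffun=> false] :> signs d.
Proof. by apply/ffunP => i; rewrite !ffunE. Qed.

Lemma id_Symk (k : 'rV[int]_d) : ([ffun=> false] : signs d) \in Symk k.
Proof. by rewrite inE; apply/forallP => i; rewrite ffunE implybT. Qed.

(** The coefficient for the trivial sign changes, which all lie in Symk: a
   single term already bounds the maxima from below. *)
Lemma coef2_id k j : Nd k -> Nd j -> (forall i, freq j i \in freq2 (freq k i)) ->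
  coef2 L k [ffun=> false] [ffun=> false] j = basis_norm / Theta j.
Proof.
move=> kN jN jk; rewrite /coef2 smul_id !sact_id /inner.
pose g i (t : RM) : R := cosn L (freq k i) t * cosn L (freq k i) t * cosn L (freq j i) t.
have bg i : bmeas (g i) by apply: bmeasM; [apply: bmeasM|]; exact: cosn_bmeas.
transitivity (\int[mu]_x ((basis_norm ^+ 3 * Theta k ^+ 2 * Theta j) * \prod_i g i (tnth x i))).
  apply: int_eq => x; rewrite /= !fourierE// /g !big_split /=.
  have E m : \prod_i cosn L (m i) (tnth x i) = cosv L m (vec x).
    by apply: eq_bigr => i _; rewrite mxE.
  by rewrite !E; ring.
rewrite intZ; last exact/bmeas_intg/bmeas_tnth_prod.
rewrite torus_integral_prod// (eq_bigr (fun i =>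
  L / (theta_sq R (freq k i) * theta_sq R (freq j i)))); last first.
  by move=> i _; exact: int_cos2.
rewrite prodf_div big_split /= -!Theta_sqr prodr_const card_ord.
have Lr : L ^+ d = (basis_norm ^+ 2)^-1 by rewrite basis_norm_sqr /rho_inf invrK.
have tk := Theta_gt0 k; have tj := Theta_gt0 j; have n0 := basis_norm_gt0.
by rewrite Lr; field; rewrite !gt_eqF.
Qed.

(** In one coordinate the coefficient on 3k is a third of the one on k, so
   only a lower bound is common to all of P3. The factors Theta agree because
   l and k vanish at the same coordinates. *)
Lemma coef3_id k l : Nd k -> Nd l -> (forall i, freq l i \in freq3 (freq k i)) ->
  r / Theta k ^+ 2 <= coef3 L k [ffun=> false] [ffun=> false] [ffun=> false] l /\
  Theta l = Theta k.
Proof.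
move=> kN lN lk.
have tk := Theta_gt0 k; have n0 := basis_norm_gt0.
have tl : Theta l = Theta k.
  apply/eqP; rewrite -(eqrXn2 (n := 2))// ?ltW ?Theta_gt0// !Theta_sqr.
  by apply/eqP; apply: eq_bigr => i _; case: (int_cos3 (lk i)).
split=> //; rewrite /coef3 !smul_id !sact_id /inner.
pose g i (t : RM) : R := cosn L (freq k i) t * cosn L (freq k i) t * cosn L (freq k i) t * cosn L (freq l i) t.
have bg i : bmeas (g i).
  by apply: bmeasM; [apply: bmeasM; [apply: bmeasM|]|]; exact: cosn_bmeas.
rewrite (@int_eq _ _ _ mu _ (fun x => (basis_norm ^+ 4 * Theta k ^+ 4) * \prod_i g i (tnth x i))); last first.
  move=> x; rewrite /= !fourierE// /g !big_split /= tl.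
  have E m : \prod_i cosn L (m i) (tnth x i) = cosv L m (vec x).
    by apply: eq_bigr => i _; rewrite mxE.
  by rewrite !E; ring.
rewrite intZ; last exact/bmeas_intg/bmeas_tnth_prod.
rewrite torus_integral_prod//.
have : \prod_i (L / (theta_sq R (freq k i) ^+ 3)) <= \prod_i \int[circle_measure L]_t g i t.
  apply: ler_prod => i _; have [h _] := int_cos3 (lk i); rewrite h andbT.
  by rewrite divr_ge0 ?exprn_ge0 ?ltW// theta_sq_gt0.
rewrite prodf_div prodrXl -Theta_sqr prodr_const card_ord => h.
apply: (@le_trans _ _ (basis_norm ^+ 4 * Theta k ^+ 4 * (L ^+ d / (Theta k ^+ 2) ^+ 3))); last first.
  by rewrite ler_wpM2l// mulr_ge0// exprn_ge0// ltW.
have Lr : L ^+ d = (basis_norm ^+ 2)^-1 by rewrite basis_norm_sqr /rho_inf invrK.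
rewrite Lr -basis_norm_sqr le_eqVlt; apply/orP; left; apply/eqP; field.
by rewrite !gt_eqF.
Qed.

Lemma bound2_ge k j : Nd k -> Nd j -> (forall i, freq j i \in freq2 (freq k i)) ->
  6 * Theta j ^+ 3 * (cardP k)%:R / Theta k <= bound2 L k j.
Proof.
move=> kN jN jk; rewrite /bound2.
pose s0 : signs d := [ffun=> false].
have s0S := id_Symk k.
apply: (le_trans _ (le_bigmax_cond _ _ s0S)).
apply: (le_trans _ (le_bigmax_cond _ _ s0S)).
rewrite coef2_id//; have tk := Theta_gt0 k; have tj := Theta_gt0 j; have n0 := basis_norm_gt0.
rewrite -basis_norm_sqr le_eqVlt; apply/orP; left; apply/eqP; field.
by rewrite !gt_eqF.
Qed.

Lemma bound3_ge k l : Nd k -> Nd l -> (forall i, freq l i \in freq3 (freq k i)) ->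
  2 / 3 * Theta k ^+ 6 * (cardP k)%:R <= bound3 L k l.
Proof.
move=> kN lN lk; rewrite /bound3.
have s0S := id_Symk k.
do 3 apply: (le_trans _ (le_bigmax_cond _ _ s0S)).
have [h tl] := coef3_id kN lN lk; rewrite tl.
set c := coef3 _ _ _ _ _ _ in h *.
have tk := Theta_gt0 k; have r0 := rho_inf_gt0 d L0.
have c2 : (r / Theta k ^+ 2) ^+ 2 <= c ^+ 2.
  have r2 : 0 <= r / Theta k ^+ 2 by rewrite divr_ge0 ?exprn_ge0 ?ltW.
  by rewrite lerXn2r ?nnegrE// (le_trans r2).
have -> : 2 / 3 * Theta k ^+ 6 * (cardP k)%:R =
   (2 / 3 * Theta k ^+ 10 * (cardP k)%:R / r ^+ 2) * (r / Theta k ^+ 2) ^+ 2.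
  by field; rewrite !gt_eqF.
have -> : 2 * Theta k ^+ 9 * Theta k * c ^+ 2 * (cardP k)%:R / (3 * r ^+ 2) =
   (2 / 3 * Theta k ^+ 10 * (cardP k)%:R / r ^+ 2) * c ^+ 2.
  by field; rewrite !gt_eqF.
by rewrite ler_wpM2l// divr_ge0 ?exprn_ge0 ?(ltW r0)// mulr_ge0// mulr_ge0// exprn_ge0// ltW.
Qed.

End coefficients.

(** * Resonant modes and the main theorem *)

Section resonant_modes.
Variables (R : realType) (d : nat).

Lemma neq0_coord (k : 'rV[int]_d) : k != 0 -> exists i, k 0 i != 0.
Proof.
move=> k0; apply/existsP; apply: contraR k0; rewrite negb_exists => /forallP h.
by apply/eqP/rowP => i; rewrite mxE; have := h i; rewrite negbK => /eqP.
Qed.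

(** Each nonzero coordinate contributes a factor 2, and there is one. *)
Lemma Theta_sqr_ge2 (k : 'rV[int]_d) : k != 0 -> 2 <= Theta R k ^+ 2.
Proof.
move=> /neq0_coord [i0 ki0]; rewrite Theta_sqr (bigD1 i0)//=.
have -> : theta_sq R (freq k i0) = 2 by rewrite /theta_sq /freq absz_eq0 (negbTE ki0) subr0.
rewrite ler_pMr//; elim/big_rec: _ => // i x _ x1.
by rewrite -[1]mulr1 ler_pM// /theta_sq; case: eqP => _ /=; lra.
Qed.

(** All elements have coordinates n_i k_i with n_i among 0, 1, 2, 3. *)
Lemma resonant_finite (k : 'rV[int]_d) : finite_set (P2 k `|` P3 k).
Proof.
pose h (phi : {ffun 'I_d -> 'I_4}) : 'rV[int]_d := \row_i ((phi i)%:Z * k 0 i).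
have H (j : 'rV[int]_d) : (forall i, exists n : 'I_4, j 0 i = n%:Z * k 0 i) -> (h @` setT) j.
  move=> /choice [phi jphi]; exists [ffun i => phi i] => //.
  by apply/rowP => i; rewrite mxE ffunE -jphi.
apply: (@sub_finite_set _ _ (h @` setT)); last exact/finite_image/finite_finset.
move=> j [] [_ _ jk]; apply: H => i; case: (jk i) => ->.
- by exists (inord 2); rewrite inordK.
- by exists ord0; rewrite mul0r.
- by exists (inord 3); rewrite inordK.
- by exists (inord 1); rewrite inordK// mul1r.
Qed.

(** 2k lies in P2 and 3k in P3. *)
Lemma cardP_ge2 (k : 'rV[int]_d) : Nd k -> k != 0 -> (2 <= cardP k)%N.
Proof.
move=> kN k0; have [i0 ki0] := neq0_coord k0.
pose k2 : 'rV[int]_d := \row_i (2 * k 0 i); pose k3 : 'rV[int]_d := \row_i (3 * k 0 i).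
have k23 : k2 != k3.
  by apply/eqP => /rowP /(_ i0); rewrite !mxE; move: ki0; lia.
have P2k : P2 k k2.
  split=> [i||i]; [by rewrite mxE mulr_ge0|apply/eqP => /rowP /(_ i0)|by left; rewrite mxE].
  by rewrite !mxE; move: ki0; lia.
have P3k : P3 k k3.
  split=> [i||i]; [by rewrite mxE mulr_ge0|apply/eqP => /rowP /(_ i0)|by left; rewrite mxE].
  by rewrite !mxE -[RHS]mul1r => /(mulIf ki0).
have -> : 2%N = #|` [fset k2; k3]|%fset by rewrite cardfs2 k23.
apply: fsubset_leq_card; apply/fsubsetP => j; rewrite !inE.
rewrite in_fset_set; last exact: resonant_finite.
by move=> /orP[] /eqP ->; apply/mem_set; [left|right].
Qed.

Lemma of_freq_P2 k m : (forall i, m i \in freq2 (freq k i)) -> Nd k ->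
  (exists i, m i != 0%N) -> P2 k (@of_freq d m).
Proof.
move=> mk kN [i0 mi0]; split=> [||i]; first exact: Nd_of_freq.
  by apply/eqP => /rowP /(_ i0); rewrite !mxE => /eqP; rewrite eqz_nat (negbTE mi0).
have := mk i; have := kN i; rewrite mxE /freq /freq2; case: eqP => [_|_]; rewrite !inE.
  by move=> _ /eqP ->; right.
by move=> ki /orP[] /eqP ->; [right|left; rewrite PoszM gez0_abs].
Qed.

Lemma of_freq_P3 k m : (forall i, m i \in freq3 (freq k i)) -> Nd k ->
  (exists i, m i != freq k i) -> P3 k (@of_freq d m).
Proof.
move=> mk kN [i0 mi0]; split=> [||i]; first exact: Nd_of_freq.
  by apply/eqP => e; move: mi0; rewrite -e of_freqK eqxx.
have := mk i; have := kN i; rewrite mxE /freq /freq3; case: eqP => [/eqP|_]; rewrite !inE.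
  by rewrite absz_eq0 => /eqP -> _ /eqP ->; right.
by move=> ki /orP[] /eqP ->; [right|left]; rewrite ?PoszM gez0_abs.
Qed.

End resonant_modes.

Section no_transition.
Variables (R : realType) (L : R) (d : nat).
Hypothesis L0 : 0 < L.
Variable W : 'rV[R]_d -> R.
Hypotheses (cW : continuous W) (sW : reflection_periodic L W).
Hypothesis W0 : \int[torus_measure L d]_x W (vec x) = 0.

(** The interaction is then a nonnegative quadratic form, so the uniform
   density is the unique minimiser at every beta. *)
Lemma positive_no_transition beta_c : (forall m, 0 <= coefv L W m) ->
  ~ transition_point L 4 W beta_c.
Proof.
move=> w0 [bc0 _ _ above]; have [|rho rmin] := above (beta_c + 1); first by rewrite ltrDl.
apply; have b0 : 0 < beta_c + 1 by exact: addr_gt0.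
have [g [ag rg gmin]] := minimiser_density L0 cW sW rmin.
apply: (zero_dist_uniform L0 ag rg).
have := gmin _ (uniform_admissible d L0); rewrite -(subr_le0 (energy L W _ _)) (energy_diff L0 cW sW W0) => h.
have ig : intg (torus_measure L d) g by case: ag.
have I0 : 0 <= interaction L W g by exact: (positive_definite L0 cW sW w0 ig).
have := quartic_ge_dist L0 ag; move: h.
set D := \int[_]_x ((g x - _) ^+ 4); set X4 := \int[_]_x (g x ^+ 4).
move=> h X4D; have : (beta_c + 1)^-1 / 3 * (X4 - rho_inf d L ^+ 3) <= 0.
  by move: h I0; lra.
by rewrite pmulr_rle0 ?divr_gt0 ?invr_gt0//; lra.
Qed.

End no_transition.

Theorem theorem5p24 (R : realType) (d : nat) (L : R) (W : 'rV[R]_d -> R)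
    (beta_c : R) (ksharp : 'rV[int]_d) :
  0 < L ->
  torus_periodic L W -> C2 W -> coord_even W -> mean_zero L W ->
  ~ H_stable L W ->
  transition_point L 4 W beta_c ->
  argmin_ratio L W = [set ksharp] ->
  (forall k, Nd k -> k != ksharp -> 0 <= hat L W k) ->
  (forall j, P2 ksharp j ->
     bound2 L ksharp j * `|hat L W ksharp| < hat L W j) ->
  (forall l, P3 ksharp l ->
     bound3 L ksharp l * `|hat L W ksharp| < hat L W l) ->
  beta_c = beta_sharp4 L W /\ continuous_transition_point L 4 W beta_c.
Proof.
move=> L0 pW [cW _] eW W0 _ tp argk hat_ge0 h2 h3.
have sW := symmetric_reflection_periodic pW eW.
have bW := bmeas_vec L0 cW sW.
have [kN k0 kmin] : argmin_ratio L W ksharp by rewrite argk.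
set r := rho_inf d L; have r0 : 0 < r := rho_inf_gt0 d L0.
set k := freq ksharp; set n := basis_norm L d; have n0 : 0 < n := basis_norm_gt0 d L0.
set w := coefv L W; set t := Theta R ksharp; have t0 : 0 < t := Theta_gt0 R ksharp.
have hatw m : hat L W (of_freq m) = n * Theta R (of_freq m) * w m.
  rewrite hatE//; last exact: Nd_of_freq.
  by congr (_ * coefv L W _); apply/funext => i; exact: of_freqK.
have hatk : hat L W ksharp = n * t * w k by rewrite hatE.
have w_ge0 m : (exists i, m i != k i) -> 0 <= w m.
  move=> [i mi]; have := hat_ge0 _ (Nd_of_freq m).
  rewrite hatw pmulr_rge0; last by apply: mulr_gt0 => //; exact: Theta_gt0.
  apply; apply/eqP => e; move: mi; rewrite /k -e of_freqK eqxx//.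
(* A nonnegative coefficient at k would make all coefficients nonnegative. *)
have wk0 : w k < 0.
  rewrite ltNge; apply/negP => wk0.
  apply: (positive_no_transition L0 cW sW W0 _ tp) => m.
  have [/existsP|] := boolP [exists i, m i != k i]; first exact: w_ge0.
  rewrite negb_exists => /forallP e; have -> // : m = k.
  by apply/funext => i; have := e i; rewrite negbK => /eqP.
(* Chosen so that the quadratic part of the energy at the frequency k changes
   sign at beta^-1 = a. *)
pose a := - w k / (4 * r ^+ 2).
have r20 : 0 < r ^+ 2 by rewrite exprn_gt0.
have a0 : 0 < a by rewrite divr_gt0 ?oppr_gt0// mulr_gt0.
have wk : w k = - (4 * r ^+ 2 * a) by rewrite /a; field; rewrite gt_eqF.
have minE : min_ratio L W = n * w k.
  have -> : n * w k = Defs.ratio L W ksharp.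
    by rewrite /Defs.ratio hatk -/t; field; rewrite gt_eqF.
  apply/eqP; rewrite eq_le; apply/andP; split.
    apply: ge_inf; last by exists ksharp.
    by exists (Defs.ratio L W ksharp) => _ [k' [k'N k'0] <-]; exact: kmin.
  apply: lb_le_inf; first by exists (Defs.ratio L W ksharp), ksharp.
  by move=> _ [k' [k'N k'0] <-]; exact: kmin.
have bE : beta_sharp4 L W = a^-1.
  rewrite /beta_sharp4 minE rho_inf_powR// -/n (_ : n ^+ 5 = n * r ^+ 2); last first.
    by rewrite /r -basis_norm_sqr// -/n; ring.
  by rewrite /a; field; rewrite ?(gt_eqF r0) ?(gt_eqF n0) ?(lt_eqF wk0).
have hp : 0 <= n * t * (4 * r ^+ 2 * a).
  by apply: ltW; apply: mulr_gt0 (mulr_gt0 n0 t0) (mulr_gt0 (mulr_gt0 _ r20) a0).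
have habs : `|hat L W ksharp| = n * t * (4 * r ^+ 2 * a).
  by rewrite hatk wk mulrN normrN ger0_norm.
have M2 : 2 <= (cardP ksharp)%:R :> R by rewrite ler_nat cardP_ge2.
set M : R := (cardP ksharp)%:R in M2.
have ra0 : 0 < r ^+ 2 * a by exact: mulr_gt0.
have w2 m : (forall i, m i \in freq2 (k i)) -> (exists i, m i != 0%N) ->
    96 * a * r ^+ 2 <= w m.
  move=> mk m0; have P2j := of_freq_P2 mk kN m0; have [jN j0 _] := P2j.
  have jk i : freq (of_freq m) i \in freq2 (freq ksharp i) by rewrite of_freqK.
  have := h2 _ P2j; rewrite habs hatw; set b2 := bound2 _ _ _.
  have := bound2_ge L0 kN jN jk; rewrite -/b2 -/M -/t.
  have := Theta_sqr_ge2 R j0; have := Theta_gt0 R (of_freq m).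
  set s := Theta R _ => s0 s2 b2ge bh.
  have hb : 24 * s ^+ 2 * M * (r ^+ 2 * a) <= w m.
    have ns : 0 < n * s by exact: mulr_gt0.
    rewrite -(ler_pM2l ns); apply: le_trans (ltW bh).
    have := ler_wpM2r hp b2ge.
    apply: le_trans.
    by rewrite le_eqVlt; apply/orP; left; apply/eqP; field; rewrite gt_eqF.
  (* The squared Theta of j and the cardinal M are both at least 2. *)
  apply: le_trans hb; have -> : 96 * a * r ^+ 2 = 24 * (2 * 2) * (r ^+ 2 * a) by ring.
  by rewrite ler_pM2r// -mulrA ler_pM2l// ler_pM.
have w3 m : (forall i, m i \in freq3 (k i)) -> (exists i, m i != k i) ->
    32 / 3 * a * (r * \prod_i theta_sq R (k i)) ^+ 2 <= w m.
  move=> mk m0; have P3l := of_freq_P3 mk kN m0; have [lN l0 _] := P3l.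
  have lk i : freq (of_freq m) i \in freq3 (freq ksharp i) by rewrite of_freqK.
  have := h3 _ P3l; rewrite habs hatw; set b3 := bound3 _ _ _.
  have := bound3_ge L0 kN lN lk; rewrite -/b3 -/M -/t.
  have [_ ->] := coef3_id L0 kN lN lk; rewrite -/t => b3ge bh.
  have t2 := Theta_sqr_ge2 R k0; rewrite -/t in t2.
  have hb : 8 / 3 * t ^+ 6 * M * (r ^+ 2 * a) <= w m.
    have nt : 0 < n * t by exact: mulr_gt0.
    rewrite -(ler_pM2l nt); apply: le_trans (ltW bh).
    have := ler_wpM2r hp b3ge.
    apply: le_trans.
    by rewrite le_eqVlt; apply/orP; left; apply/eqP; field.
  apply: le_trans hb; rewrite -Theta_sqr -/t.
  have -> : 32 / 3 * a * (r * t ^+ 2) ^+ 2 = (8 / 3 * t ^+ 4) * (2 * 2) * (r ^+ 2 * a) by field.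
  have -> : 8 / 3 * t ^+ 6 * M * (r ^+ 2 * a) = (8 / 3 * t ^+ 4) * (t ^+ 2 * M) * (r ^+ 2 * a) by field.
  have t4 : 0 < 8 / 3 * t ^+ 4 by rewrite mulr_gt0// exprn_gt0.
  by rewrite ler_pM2r// ler_pM2l// ler_pM.
have kn0 : exists i, k i != 0%N.
  by have [i ki] := neq0_coord k0; exists i; rewrite absz_eq0.
rewrite bE; apply: (continuous_transition L0 cW sW W0 kn0 a0 wk _ tp).
move=> g [ig g0 g1 ig4].
exact: (key_inequality L0 cW sW kn0 a0 wk w_ge0 w2 w3 ig g1 g0 ig4).
Qed.
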